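(* Let $n\ge1$, let $Y$ be a Banach space, and suppose that one of the following holds: (i) $q\in(1,\infty)$ and $T:H^{1,q}_{\mathrm{fin}}(\mathbb{R}^n)\to Y$ is a linear operator such that $$\sup\{\|Ta\|_Y : a \text{ is a } (1,q)\text{-atom}\}<\infty;$$ (ii) $T$ is a $Y$-valued linear operator defined on the vector space of finite linear combinations of continuous $(1,\infty)$-atoms in $\mathbb{R}^n$, such that $$\sup\{\|Ta\|_Y : a \text{ is a continuous } (1,\infty)\text{-atom}\}<\infty.$$ Then there exists a unique bounded linear operator $\widetilde T$ from $H^1(\mathbb{R}^n)$ to $Y$ which extends $T$.
   Context: Let $\mathbb{R}^n$ carry Lebesgue measure $|\cdot|$. For $q\in(1,\infty]$, a $(1,q)$-atom is a function $a\in L^q(\mathbb{R}^n)$ supported in a closed ball $B$, with $\int a\,dx=0$, and such that $\bigl(\frac1{|B|}\int_B|a|^q\,dx\bigr)^{1/q}\le |B|^{-1}$ if $q<\infty$, respectively $\|a\|_\infty\le |B|^{-1}$ if $q=\infty$. A continuous $(1,\infty)$-atom is a $(1,\infty)$-atom that is a continuous function on $\mathbb{R}^n$. $H^{1,q}(\mathbb{R}^n)$ is the space of all $g\in L^1(\mathbb{R}^n)$ that can be written $g=\sum_j\lambda_j a_j$ with $a_j$ $(1,q)$-atoms and $\lambda_j\in\mathbb{C}$, $\sum_j|\lambda_j|<\infty$; its norm is the infimum of $\sum_j|\lambda_j|$ over all such decompositions. It is well known that all the spaces $H^{1,q}(\mathbb{R}^n)$, $q\in(1,\infty]$, coincide with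 equivalent norms; the common space is denoted $H^1(\mathbb{R}^n)$. $H^{1,q}_{\mathrm{fin}}(\mathbb{R}^n)$ is the vector space of all finite linear combinations of $(1,q)$-atoms. *)

(* Defs.v *)
From HB Require Import structures.
From mathcomp Require Import all_boot all_order all_algebra.
From mathcomp Require Import all_classical all_reals all_analysis.
From mathcomp Require Import complex.

Set Implicit Arguments.
Unset Strict Implicit.
Unset Printing Implicit Defensive.

Import Order.TTheory GRing.Theory Num.Theory numFieldNormedType.Exports.

Local Open Scope classical_set_scope.
Local Open Scope complex_scope.
Local Open Scope ring_scope.

(* R^n is 'rV[R]_n with the product topology of the library and the sigma-algebra
   generated by the coordinate maps, i.e. the Borel sets.  Every Lebesgue
   measurable function has a Borel representative, and elements of L^q are only
   considered up to null sets below. *)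
Section measurable_rV.
Variables (R : realType) (n : nat).

Definition rV_coord (i : 'I_n) (x : 'rV[R]_n) : measurableTypeR R := x ord0 i.

Let rV_measurable0 : g_sigma_preimage rV_coord set0.
Proof. exact: sigma_algebra0. Qed.

Let rV_measurableC A : g_sigma_preimage rV_coord A ->
  g_sigma_preimage rV_coord (~` A).
Proof. exact: sigma_algebraC. Qed.

Let rV_measurable_bigcup (F : (set 'rV[R]_n)^nat) :
  (forall i, g_sigma_preimage rV_coord (F i)) ->
  g_sigma_preimage rV_coord (\bigcup_i F i).
Proof. exact: sigma_algebra_bigcup. Qed.

HB.instance Definition _ := @isMeasurable.Build default_measure_display
  'rV[R]_n (g_sigma_preimage rV_coord)
  rV_measurable0 rV_measurableC rV_measurable_bigcup.

Lemma measurable_rV_coord (i : 'I_n) :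
  measurable_fun [set: 'rV[R]_n] (rV_coord i).
Proof.
move=> _ Y mY; rewrite setTI; apply: sub_sigma_algebra => /=.
rewrite -bigcup_seq/=; exists i => /=; first by rewrite mem_index_enum.
by exists Y => //; rewrite setTI.
Qed.

Lemma measurable_fun_rV d (T : measurableType d) (f : T -> 'rV[R]_n) :
  (forall i, measurable_fun [set: T] (rV_coord i \o f)) ->
  measurable_fun [set: T] f.
Proof.
move=> mf _ A mA; rewrite setTI.
suff : g_sigma_preimage rV_coord `<=` [set B | measurable (f @^-1` B)].
  by apply.
apply: smallest_sub.
  split=> /=.
  - by rewrite preimage_set0.
  - by move=> B mB; rewrite setTD preimage_setC; exact: measurableC.
  - by move=> F mF; rewrite preimage_bigcup; exact: bigcup_measurable.
rewrite -bigcup_seq => B [i _ [C mC <-]] /=; rewrite setTI.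
by have := mf i measurableT C mC; rewrite setTI.
Qed.

End measurable_rV.

Section lebesgue_rV.
Variable R : realType.

Definition rV_cons n (p : measurableTypeR R * 'rV[R]_n) : 'rV[R]_n.+1 :=
  row_mx (const_mx p.1 : 'rV[R]_1) p.2.

Lemma measurable_rV_cons n :
  measurable_fun [set: measurableTypeR R * 'rV[R]_n] (@rV_cons n).
Proof.
apply: measurable_fun_rV => i; case: (split_ordP (i : 'I_(1 + n))) => j ij.
  rewrite (_ : _ \o _ = fst); first exact: measurable_fst.
  apply/funext => -[x v] /=; rewrite /rV_coord /rV_cons ij /=.
  by rewrite (row_mxEl (const_mx x : 'rV_1) v ord0 j) mxE.
rewrite (_ : _ \o _ = rV_coord j \o snd).
  by apply: measurableT_comp; [exact: measurable_rV_coord|exact: measurable_snd].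
apply/funext => -[x v] /=; rewrite /rV_coord /rV_cons ij /=.
by rewrite (row_mxEr (const_mx x : 'rV_1) v ord0 j).
Qed.

Section step.
Variables (n : nat) (mu : {sigma_finite_measure set 'rV[R]_n -> \bar R}).

Definition lebesgue_rV_step : set 'rV[R]_n.+1 -> \bar R :=
  pushforward (lebesgue_measure \x mu)%E (@rV_cons n).

Let step0 : lebesgue_rV_step set0 = 0%E.
Proof. by rewrite /lebesgue_rV_step /pushforward preimage_set0 measure0. Qed.

Let step_ge0 A : (0 <= lebesgue_rV_step A)%E.
Proof. by rewrite /lebesgue_rV_step /pushforward measure_ge0. Qed.

Let step_sigma_additive : semi_sigma_additive lebesgue_rV_step.
Proof.
have := @measure_semi_sigma_additive _ _ _
  (pushforward (lebesgue_measure \x mu)%E (@rV_cons n)).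
by apply; exact: measurable_rV_cons.
Qed.

HB.instance Definition _ := isMeasure.Build _ _ _ lebesgue_rV_step
  step0 step_ge0 step_sigma_additive.

Let rV_uncons (v : 'rV[R]_n.+1) : measurableTypeR R * 'rV[R]_n :=
  (v ord0 ord0, rsubmx (v : 'rV_(1 + n))).

Let step_sigma_finite : sigma_finite setT lebesgue_rV_step.
Proof.
have m_uncons : measurable_fun setT rV_uncons.
  apply/measurable_fun_pairP; split.
    exact: (measurable_rV_coord ord0).
  apply: measurable_fun_rV => i.
  rewrite (_ : _ \o _ = rV_coord (rshift 1 i : 'I_n.+1)).
    exact: measurable_rV_coord.
  by apply/funext => v; rewrite /rV_coord /= mxE.
have unconsK p : rV_uncons (rV_cons p) = p.
  case: p => x v; rewrite /rV_uncons /rV_cons /= row_mxKr; congr pair.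
  have -> : ord0 = lshift n ord0 :> 'I_(1 + n) by apply/val_inj.
  by rewrite (row_mxEl (const_mx x : 'rV_1) v ord0 ord0) mxE.
have /sigma_finiteP[F [TF ndF Foo]] := sigma_finiteT (@lebesgue_measure R).
have /sigma_finiteP[G [TG ndG Goo]] := sigma_finiteT mu.
exists (fun k => rV_uncons @^-1` (F k `*` G k)).
  rewrite predeqE => v; split=> // _.
  have [k _ Fkv] : (\bigcup_k F k) (rV_uncons v).1 by rewrite -TF.
  have [l _ Glv] : (\bigcup_k G k) (rV_uncons v).2 by rewrite -TG.
  exists (maxn k l) => //; split.
  - by move: Fkv; exact/subsetPset/ndF/leq_maxl.
  - by move: Glv; exact/subsetPset/ndG/leq_maxr.
move=> k; have [mFk Fkoo] := Foo k; have [mGk Gkoo] := Goo k; split.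
  by rewrite -[X in measurable X]setTI; apply: m_uncons => //; exact: measurableX.
rewrite /lebesgue_rV_step /pushforward -comp_preimage.
rewrite (_ : _ \o _ = id); last by apply/funext => p; exact: unconsK.
by rewrite preimage_id product_measure1E// lte_mul_pinfty// ge0_fin_numE.
Qed.

HB.instance Definition _ := Measure_isSigmaFinite.Build _ _ _ lebesgue_rV_step
  step_sigma_finite.

End step.

(* Lebesgue measure on R^n as the n-fold product of the one-dimensional one. *)
Fixpoint lebesgue_rV n : {sigma_finite_measure set 'rV[R]_n -> \bar R} :=
  match n with
  | 0 => dirac (0 : 'rV[R]_0)
  | m.+1 => lebesgue_rV_step (lebesgue_rV m)
  end.

End lebesgue_rV.

Section hardy.
Variables (R : realType) (n : nat).
Local Notation Rn := 'rV[R]_n.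
Local Notation mu := (lebesgue_rV R n).
Implicit Types (f g a : Rn -> R[i]) (q : \bar R) (D : set (Rn -> R[i])).

(* The euclidean ball; the norm of the library on 'rV[R]_n is the sup norm. *)
Definition euclidean_closed_ball (c : Rn) (r : R) : set Rn :=
  [set x | Num.sqrt (\sum_(i < n) (x ord0 i - c ord0 i) ^+ 2) <= r].

Definition cabs f : Rn -> R := fun x => ComplexField.Normc.normc (f x).

Definition cmeasurable f : Prop :=
  measurable_fun setT (fun x => complex.Re (f x)) /\
  measurable_fun setT (fun x => complex.Im (f x)).

Definition cintegral f : R[i] :=
  (\int[mu]_x complex.Re (f x)) +i* (\int[mu]_x complex.Im (f x)).

Definition cLnorm q f : \bar R := 'N[mu]_q[EFin \o cabs f]%E.

(* Elements of L^q are represented by functions; equality in L^q is ae_eq. *)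
Definition cLspace q : set (Rn -> R[i]) :=
  [set f | cmeasurable f /\ (cLnorm q f < +oo)%E].

Definition cae_eq f g : Prop := {ae mu, forall x, f x = g x}.

Definition atom_size q (B : set Rn) a : Prop :=
  let vol : R := fine (mu B) in
  match q with
  | r%:E => ((vol^-1%:E * \int[mu]_(x in B) (cabs a x `^ r)%:E) `^ r^-1
              <= vol^-1%:E)%E
  | +oo%E => (cLnorm +oo a <= vol^-1%:E)%E
  | -oo%E => False
  end.

(* "Supported in B" is read almost everywhere, so that being an atom does not
   depend on the representative. *)
Definition atom q : set (Rn -> R[i]) := [set a |
  exists (c : Rn) (r : R), let B := euclidean_closed_ball c r in
  [/\ 0 < r,
      cLspace q a,
      {ae mu, forall x, ~ B x -> a x = 0},
      cintegral a = 0
    & atom_size q B a]].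

Definition continuous_atom : set (Rn -> R[i]) :=
  [set a | atom +oo%E a /\ continuous (a : Rn -> R[i]^o)].

Definition lincomb N (lam : 'I_N -> R[i]) (a : 'I_N -> Rn -> R[i]) : Rn -> R[i] :=
  fun x => \sum_(j < N) lam j * a j x.

Definition finite_span (A : set (Rn -> R[i])) : set (Rn -> R[i]) :=
  [set f | exists N (lam : 'I_N -> R[i]) (a : 'I_N -> Rn -> R[i]),
     (forall j, A (a j)) /\ f = lincomb lam a].

(* H^{1,q}_fin; a measurable function that vanishes almost everywhere is an
   atom, so this set is stable under change of representative. *)
Definition H1q_fin q : set (Rn -> R[i]) := finite_span (atom q).

Definition continuous_H1_fin : set (Rn -> R[i]) := finite_span continuous_atom.

Definition atomic_mass (lam : nat -> R[i]) : \bar R :=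
  (\sum_(0 <= j <oo) (ComplexField.Normc.normc (lam j))%:E)%E.

(* g = \sum_j lam j * a j, the series being convergent in L^1. *)
Definition atomic_decomposition q g (lam : nat -> R[i]) (a : nat -> Rn -> R[i]) :
    Prop :=
  [/\ forall j, atom q (a j),
      (atomic_mass lam < +oo)%E
    & (fun N => cLnorm 1 (fun x => g x - \sum_(j < N) lam j * a j x))
        @ \oo --> (0 : \bar R)].

Definition H1q q : set (Rn -> R[i]) :=
  [set g | cLspace 1 g /\
     exists lam (a : nat -> Rn -> R[i]), atomic_decomposition q g lam a].

Definition H1q_norm q g : \bar R :=
  ereal_inf [set s | exists lam (a : nat -> Rn -> R[i]),
    atomic_decomposition q g lam a /\ s = atomic_mass lam].

(* All the spaces H^{1,q}, 1 < q <= oo, coincide with equivalent norms; H^{1,oo}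
   is taken as the concrete model of H^1. *)
Definition H1 : set (Rn -> R[i]) := H1q +oo%E.

Definition H1_norm g : \bar R := H1q_norm +oo%E g.

Section operators.
Variable Y : completeNormedModType R[i].
Implicit Types T : (Rn -> R[i]) -> Y.

(* The norm of Y takes its values in the nonnegative reals of R[i]. *)
Definition Ynorm (y : Y) : R := complex.Re `|y|.

(* Operators defined on a subspace D are total maps whose values outside D are
   irrelevant. *)
Definition linear_on D T : Prop :=
  forall (k : R[i]) f g, D f -> D g ->
    T (fun x => k * f x + g x) = k *: T f + T g.

Definition ae_compatible D T : Prop :=
  forall f g, D f -> D g -> cae_eq f g -> T f = T g.

Definition uniformly_bounded_on (A : set (Rn -> R[i])) T : Prop :=
  (ereal_sup [set (Ynorm (T a))%:E | a in A] < +oo)%E.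

Definition H1_bounded_operator T : Prop :=
  [/\ linear_on H1 T, ae_compatible H1 T
    & exists M : R, forall g, H1 g -> ((Ynorm (T g))%:E <= M%:E * H1_norm g)%E].

Definition extends D T (T' : (Rn -> R[i]) -> Y) : Prop :=
  forall f, D f -> H1 f /\ T' f = T f.

Definition has_unique_H1_extension D T : Prop :=
  exists T', [/\ H1_bounded_operator T', extends D T T'
    & forall T'', H1_bounded_operator T'' -> extends D T T'' ->
        forall g, H1 g -> T'' g = T' g].

End operators.
End hardy.

Arguments H1q_fin {R n} q.
Arguments continuous_H1_fin {R n}.
Arguments atom {R n} q.
Arguments continuous_atom {R n}.

(* Main.v *)
(* The extension exists as soon as the domain D of T is dense in H^1 and
   |T f| <= C m whenever f in D has a decomposition f = sum_j lam_j a_j of mass m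
   into (1,oo)-atoms. The latter is not formal, because T cannot be applied to
   the series term by term. If f is supported in [-s, s]^n, let F fold R^n onto
   [-s, s]^n by a triangle wave in each coordinate, and let
   K g x = int k(x, F y) g(y) dy for a tensor product kernel k of width t <= s.
   (a) K maps every (1,oo)-atom, however large or distant its ball, to a multiple
   of an atom with a factor that depends on n only. (b) If S_N are the partial
   sums, K (f - S_N) -> 0 uniformly, with support in a fixed cube, since
   f - S_N -> 0 in L^1; hence |T (K f)| <= C m. (c) As t -> 0, K f -> f in the
   norm that controls T: uniformly if f is continuous and k is a hat function, in
   L^q if k is the kernel of the averages over dyadic cubes.
   A Calderon-Zygmund decomposition of the dyadic averages shows that a function
   of mean zero in L^q with support in a fixed cube is in H^1, with a norm that is
   small when its L^q norm is. For q = 2 this gives the density of the continuous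
   functions: an atom is close in L^2 to its dyadic averages, and these to their
   averages against hat functions. *)

(* Folding takes the place of a cut-off: multiplication by a cut-off would destroy the mean value
   zero, whereas a push-forward preserves integrals; and since F is 1-Lipschitz, it sends a cube of
   radius r into one of the same radius. A ball much larger than the cube is wrapped around it many
   times, but the height of its atom is lower by the same factor; this is why the constant in (a)
   depends neither on s nor on t. The independence of t is indispensable, because t tends to 0 at
   the end. The constants in (b) may blow up as t -> 0, since there t is fixed and N tends to
   infinity. In (c) the remainder is a single multiple of an atom, with a small factor. For q = oo
   averages converge uniformly only if the function is continuous, whence the continuous atoms in
   (ii); uniform boundedness on all (1,oo)-atoms is known not to suffice. The Calderon-Zygmund
   decomposition is applied only to functions that are constant on the cells of some generation, so
   that it ends after finitely many steps; a general function is a telescoping series of differences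
   of its dyadic averages. *)
Require Import Defs.
From HB Require Import structures.
From mathcomp Require Import all_boot all_order all_algebra.
From mathcomp Require Import all_classical all_reals all_analysis measurable_realfun ess_sup_inf.
From mathcomp Require Import complex ring lra zify.

Set Implicit Arguments.
Unset Strict Implicit.
Unset Printing Implicit Defensive.

Import Order.TTheory GRing.Theory Num.Theory numFieldNormedType.Exports.

Local Open Scope classical_set_scope.
Local Open Scope complex_scope.
Local Open Scope ring_scope.

(** * Integration on R^n *)

Section product_integral.
Variable R : realType.
Local Notation mu n := (lebesgue_rV R n).

Lemma measurable_coord n (i : 'I_n) :
  measurable_fun [set: 'rV[R]_n] (fun x : 'rV[R]_n => x ord0 i : R).
Proof. exact: measurable_rV_coord. Qed.

Lemma measurable_coord_comp n (i : 'I_n) (h : R -> R) :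
  measurable_fun setT h ->
  measurable_fun [set: 'rV[R]_n] (fun x : 'rV[R]_n => h (x ord0 i)).
Proof. move=> mh; apply: (measurableT_comp mh); exact: measurable_coord. Qed.

(** Induction on [n]: the measure on R^(n+1) is the push-forward under [rV_cons] of a product
    measure, so Tonelli splits off the first coordinate. The values [c i] are real numbers, which
    keeps products such as 0 * oo out of the formula. *)
Lemma integral_rV_prod n (h : 'I_n -> R -> R) (c : 'I_n -> R) :
  (forall i, measurable_fun setT (h i)) -> (forall i x, 0 <= h i x) ->
  (forall i, \int[lebesgue_measure]_u (h i u)%:E = (c i)%:E)%E ->
  (\int[mu n]_x (\prod_i h i (x ord0 i))%:E = (\prod_i c i)%:E)%E.
Proof.
have mprod k (g : 'I_k -> R -> R) : (forall i, measurable_fun setT (g i)) ->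
    measurable_fun [set: 'rV[R]_k] (EFin \o (fun x : 'rV[R]_k => \prod_i g i (x ord0 i))).
  move=> mg; apply/measurable_EFinP.
  by apply: measurable_prod => i _; exact: measurable_coord_comp.
elim: n h c => [|n IH] h c mh h0 hc.
  rewrite /= integral_dirac//=; last exact: mprod.
  by rewrite diracE in_setT mul1e !big_ord0.
have prod_ge0 k (g : 'I_k -> R -> R) (x : 'rV[R]_k) : (forall i x, 0 <= g i x) ->
    (0 <= \prod_i g i (x ord0 i)) by move=> g0; apply: prodr_ge0.
pose g (p : measurableTypeR R * 'rV[R]_n) : R :=
  h ord0 p.1 * \prod_(i < n) h (lift ord0 i) (p.2 ord0 i).
have gE (p : measurableTypeR R * 'rV[R]_n) :
    \prod_i h i (rV_cons p ord0 i) = g p.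
  rewrite big_ord_recl /g; congr (h _ _ * _).
    rewrite /rV_cons; have -> : ord0 = lshift n ord0 :> 'I_(1 + n) by apply/val_inj.
    by rewrite (row_mxEl (const_mx p.1 : 'rV_1) p.2 ord0 ord0) mxE.
  apply: eq_bigr => i _; congr (h _ _).
  rewrite /rV_cons; have -> : lift ord0 i = rshift 1 i :> 'I_(1 + n) by apply/val_inj.
  by rewrite (row_mxEr (const_mx p.1 : 'rV_1) p.2 ord0 i).
have mg : measurable_fun setT (EFin \o g).
  apply/measurable_EFinP; apply: measurable_funM.
    by apply: (measurableT_comp (mh ord0)); exact: measurable_fst.
  apply: (@measurableT_comp _ _ _ _ _ _
    (fun v : 'rV[R]_n => \prod_(i < n) h (lift ord0 i) (v ord0 i))).
    by apply/measurable_EFinP; apply: (mprod _ (fun i => h (lift ord0 i))).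
  exact: measurable_snd.
transitivity (\int[lebesgue_measure \x mu n]_p (g p)%:E)%E.
  rewrite [LHS](@ge0_integral_pushforward _ _ _ _ R (@rV_cons R n)
    (@measurable_rV_cons R n) (lebesgue_measure \x mu n)%E setT)//.
  - by rewrite preimage_setT; apply: eq_integral => p _ /=; rewrite gE.
  - exact: (mprod _ h).
  - by move=> x _; rewrite lee_fin prod_ge0.
rewrite (fubini_tonelli1 (EFin \o g))//; last first.
  by move=> p /=; rewrite lee_fin mulr_ge0// (prod_ge0 _ (fun i => h (lift ord0 i))).
rewrite /fubini_F /= big_ord_recl EFinM -(hc ord0).
rewrite -(IH (fun i => h (lift ord0 i)))//.
under eq_integral => u _.
  rewrite /g /=; under eq_integral do rewrite EFinM.
  rewrite ge0_integralZl//; last 3 first.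
  - exact: (mprod _ (fun i => h (lift ord0 i))).
  - by move=> x _; rewrite lee_fin (prod_ge0 _ (fun i => h (lift ord0 i))).
  - by rewrite lee_fin.
  over.
rewrite (IH (fun i => h (lift ord0 i)) (fun i => c (lift ord0 i)))//.
rewrite ge0_integralZr//.
- by apply/measurable_EFinP; exact: mh.
- by move=> x _; rewrite lee_fin.
- rewrite lee_fin; apply: prodr_ge0 => i _; rewrite -lee_fin -hc.
  by apply: integral_ge0 => x _; rewrite lee_fin.
Qed.

Lemma measurable_rV_box n (A : 'I_n -> set R) : (forall i, measurable (A i)) ->
  measurable [set x : 'rV[R]_n | forall i, A i (x ord0 i)].
Proof.
move=> mA; rewrite (_ : mkset _ = \big[setI/setT]_(i < n) ((fun x : 'rV[R]_n => x ord0 i) @^-1` A i)).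
  apply: bigsetI_measurable => i _; rewrite -[X in measurable X]setTI.
  exact: measurable_coord.
apply/seteqP; split => x.
  by move=> Ax; rewrite -bigcap_seq => i _; exact: Ax.
by rewrite -bigcap_seq => Ax i; apply: (Ax i); rewrite /= mem_index_enum.
Qed.

(** The indicator of a box is the product of the indicators of its sides. *)
Lemma lebesgue_rV_box n (A : 'I_n -> set R) (c : 'I_n -> R) :
  (forall i, measurable (A i)) ->
  (forall i, lebesgue_measure (A i) = (c i)%:E) ->
  mu n [set x | forall i, A i (x ord0 i)] = (\prod_i c i)%:E.
Proof.
move=> mA Ac.
transitivity (\int[mu n]_x (\1_[set x : 'rV[R]_n | forall i, A i (x ord0 i)] x)%:E)%E.
  by rewrite integral_indic ?setIT//; exact: measurable_rV_box.
rewrite -(@integral_rV_prod n (fun i => \1_(A i)) c)//.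
- apply: eq_integral => x _; congr (_%:E); rewrite indicE.
  case: (boolP (x \in _)) => [/set_mem/= Ax|/negP Ax].
    by rewrite big1// => i _; rewrite indicE mem_set.
  apply/esym/eqP; rewrite prodf_seq_eq0; apply/hasP.
  apply: contrapT => nh; apply: Ax; apply: mem_set => i /=; apply: contrapT => nA.
  apply: nh; exists i; rewrite ?mem_index_enum//= indicE memNset//.
- by move=> i; rewrite integral_indic ?setIT; [rewrite -Ac; congr (lebesgue_measure _); exact: setIT | | exact: mA].
Qed.

Lemma lebesgue_rV_box_le n (A : 'I_n -> set R) (c : 'I_n -> R) :
  (forall i, measurable (A i)) ->
  (forall i, (lebesgue_measure (A i) <= (c i)%:E)%E) ->
  (mu n [set x | forall i, A i (x ord0 i)] <= (\prod_i c i)%:E)%E.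
Proof.
move=> mA Ac.
have fA i : lebesgue_measure (A i) \is a fin_num.
  by rewrite ge0_fin_numE//; exact: le_lt_trans (Ac i) (ltry _).
rewrite (@lebesgue_rV_box n A (fun i => fine (lebesgue_measure (A i))))//.
  rewrite lee_fin; apply: ler_prod => i _; rewrite fine_ge0//=.
  by rewrite -lee_fin fineK.
by move=> i; rewrite fineK.
Qed.

End product_integral.

(** * Averages of folded functions *)

Section fold.
Variables (R : realType) (s : R).

(* The 1-Lipschitz triangle wave of period [4 * s] that is the identity on
   [-s, s]; it is the distance to [4 * s * int - s], minus [s]. *)
Definition fold (y : R) : R :=
  `|y + s - 4 * s * (Num.floor ((y + 3 * s) / (4 * s)))%:~R| - s.

Lemma fold_floor (y : R) : 0 < s -> let k := (Num.floor ((y + 3 * s) / (4 * s)))%:~R : R in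
  4 * s * k - 3 * s <= y < 4 * s * k + s.
Proof.
move=> s0; have s4 : 0 < 4 * s by lra.
have /andP[] := floor_itv ((y + 3 * s) / (4 * s)); rewrite intrD /=; set k := _%:~R.
rewrite ler_pdivlMr// ltr_pdivrMr// => h1 h2; apply/andP; split; lra.
Qed.

Lemma fold_bound y : 0 < s -> - s <= fold y <= s.
Proof.
move=> s0; have /andP[h1 h2] := fold_floor y s0; rewrite /fold.
set k := (Num.floor _)%:~R in h1 h2 *.
have : `|y + s - 4 * s * k| <= 2 * s by rewrite ler_norml; apply/andP; split; lra.
have := normr_ge0 (y + s - 4 * s * k); lra.
Qed.

(** The floor picks the nearest among the points [4 * s * j - s]: from any other one [y] is at least
    [2 * s] away, whereas [fold y <= s]. Thus [fold] is a minimum of the functions on the right. *)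
Lemma fold_le (y : R) (j : int) : 0 < s -> fold y <= `|y + s - 4 * s * j%:~R| - s.
Proof.
move=> s0; have /andP[_ fs] := fold_bound y s0.
have /andP[h1 h2] := fold_floor y s0; rewrite /fold in fs *.
set k := Num.floor _ in h1 h2 fs *; case: (eqVneq j k) => [->//|jk].
suff : 2 * s <= `|y + s - 4 * s * j%:~R| by lra.
have [jlek|jgtk] := ltP j k.
  have : j%:~R <= k%:~R - 1 :> R by rewrite -(intrB _ k 1) ler_int -ltzD1 subrK.
  move=> jk1; apply: le_trans (ler_norm _).
  have : 4 * s * j%:~R <= 4 * s * (k%:~R - 1) by rewrite ler_pM2l//; lra.
  lra.
have : k%:~R + 1 <= j%:~R :> R.
  by rewrite -(intrD _ k 1) ler_int -ltzD1 ltrD2r lt_neqAle eq_sym jk jgtk.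
move=> jk1; rewrite -normrN; apply: le_trans (ler_norm _).
have : 4 * s * (k%:~R + 1) <= 4 * s * j%:~R by rewrite ler_pM2l//; lra.
lra.
Qed.

Lemma fold_id y : 0 < s -> - s <= y <= s -> fold y = y.
Proof.
move=> s0 /andP[y1 y2]; apply/le_anti/andP; split.
  by have := fold_le y 0 s0; rewrite mulr0 subr0 ger0_norm; lra.
have /andP[h1 h2] := fold_floor y s0; rewrite /fold.
set k := Num.floor _ in h1 h2 *.
have : 0 <= k.
  rewrite -ltzD1 -(ltr_int R) intrD -subr_gt0 -(pmulr_rgt0 _ (_ : 0 < 4 * s)); lra.
move=> kge0; have [->|kn0] := eqVneq k 0.
  by rewrite mulr0 subr0 ger0_norm; lra.
(* This happens only at the right endpoint [y = s], where two branches of the wave meet. *)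
have k1 : 1 <= k%:~R :> R.
  by rewrite -[1]/(1%:~R) ler_int -gtz0_ge1 lt_neqAle eq_sym kn0.
have : 4 * s <= 4 * s * k%:~R by rewrite ler_peMr//; lra.
move=> h; rewrite ler0_norm; lra.
Qed.

(** A minimum of 1-Lipschitz functions is 1-Lipschitz: [fold u] is compared with the function that
    realises the minimum at [v]. *)
Lemma fold_lipschitz x y : 0 < s -> `|fold x - fold y| <= `|x - y|.
Proof.
move=> s0; suff h u v : fold u - fold v <= `|u - v|.
  by rewrite ler_norml lerNl opprB distrC h distrC h.
have := fold_le u (Num.floor ((v + 3 * s) / (4 * s))) s0.
rewrite {3}/fold; set k := (_ %:~R : R) => h.
have := ler_normD (u - v) (v + s - 4 * s * k).
by rewrite (_ : u - v + _ = u + s - 4 * s * k); [lra|ring].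
Qed.

Lemma measurable_fold : 0 < s -> measurable_fun [set: R] fold.
Proof.
move=> s0; apply: continuous_measurable_fun => x; apply/cvgrPdist_lt => e e0; near=> y.
by apply: le_lt_trans (fold_lipschitz _ _ s0) _; near: y; apply: cvgr_dist_lt.
Unshelve. all: by end_near. Qed.

Lemma measurable_fold_ball (c r x t : R) : 0 < s ->
  measurable [set y : R | `|y - c| <= r /\ `|fold y - x| <= t].
Proof.
move=> s0; rewrite (_ : mkset _ =
    `[c - r, c + r]%classic `&` fold @^-1` `[x - t, x + t]%classic).
  apply: measurableI; first exact: measurable_itv.
  rewrite -[X in measurable X]setTI.
  exact: (measurable_fold s0 measurableT (measurable_itv _)).
apply/seteqP; split => y; rewrite /= !in_itv/= !ler_distl.
  by move=> [-> ->].
by move=> [-> ->].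
Qed.

(** In each period of the wave the values within [t] of [x] are taken on two intervals of length at
    most [2 * t], one on each branch. The interval of radius [r] around [c] meets at most
    [2 * N + 1] periods, and [2 * N + 1 <= r / (2 * s) + 3]. *)
Lemma lebesgue_fold_le (c r x t : R) : 0 < s -> 0 <= r -> 0 < t ->
  (lebesgue_measure [set y : R | `|y - c| <= r /\ `|fold y - x| <= t]%R
    <= ((r / s + 3) * (4 * t))%:E)%E.
Proof.
move=> s0 r0 t0.
pose kc := Num.floor ((c + 3 * s) / (4 * s)).
pose N := (Num.trunc (r / (4 * s))).+1.
have rs0 : 0 <= r / (4 * s) by rewrite divr_ge0//; lra.
have NE : N%:R <= r / (4 * s) + 1.
  by rewrite /N -natr1 lerD2r; have /andP[] := truncn_itv rs0.
(* In period [k] the rising branch is [y - 4 * s * k] and the falling one is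
   [4 * s * k - 2 * s - y]. *)
pose J (k : int) : set R := `[4 * s * k%:~R + x - t, 4 * s * k%:~R + x + t]%classic
  `|` `[4 * s * k%:~R - x - 2 * s - t, 4 * s * k%:~R - x - 2 * s + t]%classic.
have mJ k : measurable (J k) by apply: measurableU; exact: measurable_itv.
have lI a : (lebesgue_measure `[(a - t)%R, (a + t)%R]%classic <= (2 * t)%:E)%E.
  rewrite lebesgue_measure_itv /= lte_fin ifT; last lra.
  by rewrite -EFinD lee_fin; lra.
have lJ k : (lebesgue_measure (J k) <= (4 * t)%:E)%E.
  apply: (le_trans (measureU2 _ _ _)); [exact: measurable_itv|exact: measurable_itv|].
  by rewrite (_ : 4 * t = 2 * t + 2 * t) ?EFinD; [apply: leeD; exact: lI|ring].
set A := mkset _.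
have mA : measurable A by exact: measurable_fold_ball.
pose B (i : nat) := J (kc + i%:Z - N%:Z).
have AB : A `<=` \big[setU/set0]_(i < (2 * N).+1) B i.
  move=> y [yc yx]; rewrite -bigcup_mkord.
  pose ky := Num.floor ((y + 3 * s) / (4 * s)).
  have kyc : `|ky - kc| <= N%:Z.
    rewrite -ltzD1 -(ltr_int R) intr_norm intrB intrD.
    have /andP[a1 a2] := floor_itv ((y + 3 * s) / (4 * s)).
    have /andP[b1 b2] := floor_itv ((c + 3 * s) / (4 * s)).
    rewrite -/ky -/kc !intrD in a1 a2 b1 b2.
    have : `|(y + 3 * s) / (4 * s) - (c + 3 * s) / (4 * s)| <= r / (4 * s).
      rewrite -mulrBl normrM [X in _ * X]ger0_norm; last by rewrite invr_ge0; lra.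
      rewrite ler_pM2r ?invr_gt0; last by lra.
      by rewrite (_ : _ - _ = y - c); [|ring].
    have : r / (4 * s) < N%:R by have /andP[] := truncn_itv rs0.
    rewrite ler_norml => h1 /andP[h2 h3].
    rewrite ltr_norml; apply/andP; split; rewrite -pmulrn; lra.
  have kpos : 0 <= ky - kc + N%:Z by move: kyc; rewrite ler_norml => /andP[]; lra.
  exists (absz (ky - kc + N%:Z)) => /=.
    move: kyc; rewrite ler_norml => /andP[_ h].
    rewrite ltnS -lez_nat gez0_abs// mul2n -addnn PoszD; lra.
  rewrite /B gez0_abs//; have -> : kc + (ky - kc + N%:Z) - N%:Z = ky by ring.
  move: yx; rewrite /fold -/ky /J /= !in_itv/=.
  have [h|h] := leP 0 (y + s - 4 * s * ky%:~R).
    rewrite (ger0_norm h) ler_norml => /andP[h1 h2]; left; apply/andP; split; lra.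
  rewrite (ltr0_norm h) ler_norml => /andP[h1 h2]; right; apply/andP; split; lra.
apply: (le_trans (@content_subadditive _ _ _
    (lebesgue_measure : {measure set (measurableTypeR R) -> \bar R}) A B _ _ mA AB)).
  by move=> k _; exact: mJ.
apply: (@le_trans _ _ (\sum_(i < (2 * N).+1) (4 * t)%:E)%E).
  by apply: lee_sum => i _; exact: lJ.
rewrite sumEFin lee_fin sumr_const card_ord -[leLHS]mulr_natl.
rewrite ler_wpM2r//; first lra.
rewrite -natr1 natrM.
have : r / (4 * s) <= r / s / 4 by rewrite invfM mulrA mulrAC.
have : 0 <= r / s by rewrite divr_ge0//; lra.
lra.
Qed.

End fold.

(** * Real-valued integrable functions *)

Section integrable_real.
Context d (T : measurableType d) (R : realType) (mu : {measure set T -> \bar R}).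
Implicit Types f g : T -> R.
Local Notation L1 f := (mu.-integrable setT (EFin \o f)).

Lemma integrable_measurable f : L1 f -> measurable_fun setT f.
Proof. by move=> /measurable_int/measurable_EFinP. Qed.

Lemma ae_le_integrable f g : measurable_fun setT f -> L1 g ->
  {ae mu, forall x, `|f x| <= g x} -> L1 f.
Proof.
move=> mf /integrableP[mg g_oo] fg; apply/integrableP; split.
  exact/measurable_EFinP.
apply: le_lt_trans g_oo; apply: ae_ge0_le_integral => //.
- by apply: measurableT_comp => //; exact/measurable_EFinP.
- exact: measurableT_comp.
- apply: filterS fg => x fgx _ /=; rewrite lee_fin.
  exact: le_trans fgx (ler_norm _).
Qed.

Lemma le_L1 f g : measurable_fun setT f -> L1 g ->
  (forall x, `|f x| <= g x) -> L1 f.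
Proof. by move=> mf g1 fg; apply: (ae_le_integrable mf g1); exact: aeW. Qed.

Lemma integrable_indic_lty (A : set T) : measurable A -> (mu A < +oo)%E ->
  L1 (\1_A : T -> R).
Proof.
move=> mA Aoo; apply/integrableP; split.
  by apply/measurable_EFinP; exact: measurable_indic.
under eq_integral => x _ do rewrite /= ger0_norm ?indicE//.
by rewrite -[X in (X < _)%E]/(\int[mu]_x (\1_A x)%:E)%E integral_indic// setIT.
Qed.

Lemma Rintegral_indic (A : set T) : measurable A -> \int[mu]_x \1_A x = fine (mu A) :> R.
Proof. by move=> mA; rewrite /Rintegral integral_indic// setIT. Qed.

Lemma integrable_EFinD f g : L1 f -> L1 g -> L1 (fun x => f x + g x).
Proof. by move=> f1 g1; have := integrableD measurableT f1 g1; exact: eq_integrable. Qed.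

Lemma integrable_EFinB f g : L1 f -> L1 g -> L1 (fun x => f x - g x).
Proof. by move=> f1 g1; have := integrableB measurableT f1 g1; exact: eq_integrable. Qed.

Lemma integrable_EFinZ (k : R) f : L1 f -> L1 (fun x => k * f x).
Proof. by move=> f1; have := integrableZl measurableT k f1; exact: eq_integrable. Qed.

Lemma integrable_bounded_mul (k : T -> R) (C : R) f : measurable_fun setT k ->
  (forall x, `|k x| <= C) -> L1 f -> L1 (fun x => k x * f x).
Proof.
move=> mk kC f1; apply: (@le_L1 _ (fun x => C * `|f x|)).
- by apply: measurable_funM => //; exact: integrable_measurable.
- by apply: integrable_EFinZ; exact: integrable_norm.
- by move=> x; rewrite normrM ler_wpM2r.
Qed.

Lemma le_ae_Rintegral f g : L1 f -> L1 g -> {ae mu, forall x, f x <= g x} ->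
  \int[mu]_x f x <= \int[mu]_x g x.
Proof.
move=> f1 g1 fg; rewrite -subr_ge0 -RintegralB//.
have mB : measurable_fun setT (fun x => (g x - f x)%:E).
  by apply/measurable_EFinP; apply: measurable_funB; exact: integrable_measurable.
rewrite /Rintegral (_ : integral _ _ _ = \int[mu]_x `|g x - f x|%:E)%E.
  by apply: fine_ge0; apply: integral_ge0 => x _; rewrite lee_fin.
apply: ae_eq_integral => //.
  by apply/measurable_EFinP; apply: measurableT_comp => //; exact/measurable_EFinP.
by apply: filterS fg => x fgx _ /=; rewrite ger0_norm// subr_ge0.
Qed.

Lemma eq_ae_Rintegral f g : measurable_fun setT f -> measurable_fun setT g ->
  {ae mu, forall x, f x = g x} -> \int[mu]_x f x = \int[mu]_x g x.
Proof.
move=> mf mg fg; congr fine; apply: ae_eq_integral => //; try exact/measurable_EFinP.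
by apply: filterS fg => x fgx _ /=; rewrite fgx.
Qed.

Lemma norm_Rintegral_le f g : measurable_fun setT f -> L1 g ->
  {ae mu, forall x, `|f x| <= g x} -> `|\int[mu]_x f x| <= \int[mu]_x g x.
Proof.
move=> mf g1 fg; have f1 := ae_le_integrable mf g1 fg.
apply: (le_trans (le_normr_Rintegral measurableT f1)).
by apply: le_ae_Rintegral => //; exact: integrable_norm.
Qed.

End integrable_real.

(** * Tensor product kernels composed with the folding map *)

Section fold_mollify.
Variables (R : realType) (n : nat).
Local Notation Rn := 'rV[R]_n.
Local Notation mu := (lebesgue_rV R n).
Local Notation L1 f := (mu.-integrable setT (EFin \o f)).
Implicit Types (s t r : R) (x y c : Rn) (g : Rn -> R).

(** The mass is normalised in the output variable [u], so that averages keep the integral of the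
    input. The bound by [t^-1] turns L^1 bounds into uniform ones, and the width [t] controls
    supports. *)
Definition mollifier t (k1 : R -> R -> R) : Prop :=
  [/\ measurable_fun setT (fun p : measurableTypeR R * measurableTypeR R => k1 p.1 p.2),
      forall u v, 0 <= k1 u v <= t^-1,
      forall u v, t < `|u - v| -> k1 u v = 0
    & forall v, (\int[lebesgue_measure]_u (k1 u v)%:E = 1)%E].

Definition fold_kernel s (k1 : R -> R -> R) x y : R :=
  \prod_i k1 (x ord0 i) (fold s (y ord0 i)).

(* The kernel [k1] applied in each coordinate to the push-forward of [g] by
   the folding map R^n -> [-s, s]^n. *)
Definition fold_mollify s k1 g x : R := \int[mu]_y (fold_kernel s k1 x y * g y).

(** Balls of the sup norm fit tensor product kernels, since membership is checked in each coordinate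
    separately. *)
Definition cube c r : set Rn := [set x | forall i, `|x ord0 i - c ord0 i| <= r].

Lemma notin_cube c r x : ~ cube c r x -> exists i, r < `|x ord0 i - c ord0 i|.
Proof. by move=> /existsNP[j /negP]; rewrite -ltNge => h; exists j. Qed.

Variables (s t : R) (k1 : R -> R -> R).
Hypotheses (s0 : 0 < s) (t0 : 0 < t) (hk : mollifier t k1).
Local Notation kk := (fold_kernel s k1).
Local Notation K := (fold_mollify s k1).

Lemma fold_kernel_ge0 x y : 0 <= kk x y.
Proof. by case: hk => _ k01 _ _; apply: prodr_ge0 => i _; case/andP: (k01 (x ord0 i) (fold s (y ord0 i))). Qed.

Lemma fold_kernel_le x y : kk x y <= t^-1 ^+ n.
Proof.
case: hk => _ k01 _ _; rewrite -[X in _ ^+ X]card_ord -prodr_const.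
by apply: ler_prod => i _; exact: k01.
Qed.

Lemma norm_fold_kernel x y : `|kk x y| <= t^-1 ^+ n.
Proof. by rewrite ger0_norm ?fold_kernel_ge0// fold_kernel_le. Qed.

Lemma fold_kernel_eq0 x y i : t < `|x ord0 i - fold s (y ord0 i)| -> kk x y = 0.
Proof.
case: hk => _ _ k0 _ xy; rewrite /fold_kernel (bigD1 i)//= k0 ?mul0r//.
Qed.

Lemma measurable_fold_kernel : measurable_fun setT (fun p : Rn * Rn => kk p.1 p.2).
Proof.
case: hk => mk _ _ _; apply: measurable_prod => i _.
suff mp : measurable_fun setT (fun p : Rn * Rn =>
    (p.1 ord0 i : measurableTypeR R, fold s (p.2 ord0 i) : measurableTypeR R)).
  exact: (measurableT_comp mk mp).
apply: measurable_fun_pair.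
  exact: (measurableT_comp (measurable_coord i) measurable_fst).
apply: (measurableT_comp (measurable_fold s0)).
exact: (measurableT_comp (measurable_coord i) measurable_snd).
Qed.

Lemma integral_fold_kernel y : (\int[mu]_x (kk x y)%:E = 1)%E.
Proof.
case: hk => mk k01 _ k_int.
rewrite (@integral_rV_prod R n (fun i u => k1 u (fold s (y ord0 i))) (fun=> 1)).
- by rewrite big1.
- move=> i.
  have mp : measurable_fun setT (fun u : measurableTypeR R =>
    (u, fold s (y ord0 i) : measurableTypeR R)) by exact: measurable_fun_pair.
  exact: (measurableT_comp mk mp).
- by move=> i u; case/andP: (k01 u (fold s (y ord0 i))).
- by move=> i; rewrite k_int.
Qed.

Let measurable_kernel_slice x : measurable_fun setT (kk x).
Proof. exact: (measurableT_comp measurable_fold_kernel (pair1_measurable x)). Qed.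

Let measurable_kernel_fun g : measurable_fun setT g ->
  measurable_fun setT (fun p : Rn * Rn => kk p.1 p.2 * g p.2).
Proof.
move=> mg; apply: measurable_funM; first exact: measurable_fold_kernel.
by apply: measurableT_comp => //; exact: measurable_snd.
Qed.

Lemma integrable_kernel_mul g x : L1 g -> L1 (fun y => kk x y * g y).
Proof. by move=> g1; apply: (integrable_bounded_mul _ (norm_fold_kernel x)). Qed.

(** Tonelli with the integral over [x] inside: the kernel has mass one there, which leaves the
    integral of [|g|]. *)
Let integrable_prod g : L1 g ->
  (mu \x mu)%E.-integrable setT (EFin \o (fun p : Rn * Rn => kk p.1 p.2 * g p.2)).
Proof.
move=> g1; have mg := integrable_measurable g1.
have mkg := measurable_kernel_fun mg.
apply/integrable21ltyP; first exact/measurable_EFinP.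
rewrite (_ : integral _ _ _ = \int[mu]_y `|(g y)%:E|)%E.
  by case/integrableP : g1.
apply: eq_integral => y _ /=.
under eq_integral do rewrite normrM (ger0_norm (fold_kernel_ge0 _ _)) EFinM.
rewrite ge0_integralZr//.
- by rewrite integral_fold_kernel mul1e.
- apply/measurable_EFinP.
  exact: (measurableT_comp measurable_fold_kernel (pair2_measurable y)).
- by move=> x _; rewrite lee_fin fold_kernel_ge0.
Qed.

Lemma integrable_fold_mollify g : L1 g -> L1 (K g).
Proof.
move=> g1; have := integrable_fubini_F (integrable_prod g1).
apply: eq_integrable => // x _; rewrite /fubini_F /= /fold_mollify.
rewrite /Rintegral fineK//; apply: (integrable_fin_num measurableT).
exact: integrable_kernel_mul.
Qed.

(** Fubini and the mass one of the kernel in [x]. In particular mean zero is preserved, as atoms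
    require. *)
Lemma Rintegral_fold_mollify g : L1 g -> \int[mu]_x K g x = \int[mu]_y g y.
Proof.
move=> g1; rewrite /Rintegral; congr fine.
transitivity (\int[mu]_x \int[mu]_y (kk x y * g y)%:E)%E.
  apply: eq_integral => x _; rewrite /fold_mollify /Rintegral fineK//.
  by apply: (integrable_fin_num measurableT); exact: integrable_kernel_mul.
rewrite (Fubini (integrable_prod g1)); apply: eq_integral => y _ /=.
have k_int : L1 (fun x => kk x y).
  apply/integrableP; split.
    apply/measurable_EFinP.
    exact: (measurableT_comp measurable_fold_kernel (pair2_measurable y)).
  under eq_integral do rewrite /= (ger0_norm (fold_kernel_ge0 _ _)).
  by rewrite integral_fold_kernel ltry.
under eq_integral do rewrite EFinM.
by rewrite integralZr// integral_fold_kernel mul1e.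
Qed.

Lemma fold_mollify_linear (a : R) g h x : L1 g -> L1 h ->
  K (fun y => a * g y + h y) x = a * K g x + K h x.
Proof.
move=> g1 h1; rewrite /fold_mollify -RintegralZl//; last exact: integrable_kernel_mul.
rewrite -RintegralD//; last 2 first.
- by apply: integrable_EFinZ; exact: integrable_kernel_mul.
- exact: integrable_kernel_mul.
by apply: eq_Rintegral => y _; ring.
Qed.

Lemma norm_fold_mollify_le g x : L1 g ->
  `|K g x| <= t^-1 ^+ n * \int[mu]_y `|g y|.
Proof.
move=> g1; rewrite -RintegralZl//; last exact: integrable_norm.
apply: norm_Rintegral_le.
- by apply: integrable_measurable; exact: integrable_kernel_mul.
- by apply: integrable_EFinZ; exact: integrable_norm.
- by apply: aeW => y; rewrite normrM ler_wpM2r// norm_fold_kernel.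
Qed.

Lemma fold_mollify_eq0 g x : {ae mu, forall y, g y != 0 -> kk x y = 0} ->
  measurable_fun setT g -> K g x = 0.
Proof.
move=> gx mg; rewrite /fold_mollify (@eq_ae_Rintegral _ _ _ _ _ (cst 0)).
- by rewrite /= Rintegral_cst// mul0r.
- exact: measurable_funM.
- exact: measurable_cst.
- apply: filterS gx => y /=; have [->|_ ->//] := eqVneq (g y) 0; first by rewrite mulr0.
  by rewrite mul0r.
Qed.

Lemma fold_mollify_support g x i : measurable_fun setT g -> s + t < `|x ord0 i| ->
  K g x = 0.
Proof.
move=> mg xi; apply: fold_mollify_eq0 => //; apply: aeW => y _.
apply: (@fold_kernel_eq0 _ _ i).
have /andP[f1 f2] := fold_bound (y ord0 i) s0.
have : `|fold s (y ord0 i)| <= s by rewrite ler_norml f1.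
have := lerB_dist (x ord0 i) (fold s (y ord0 i)); lra.
Qed.

(** [fold s] is 1-Lipschitz, so it moves the cube of radius [r] around [c] into the cube of radius
    [r] around the folded centre; the kernel adds [t]. *)
Lemma fold_mollify_support_cube g c r x i : measurable_fun setT g ->
  {ae mu, forall y, ~ cube c r y -> g y = 0} ->
  r + t < `|x ord0 i - fold s (c ord0 i)| -> K g x = 0.
Proof.
move=> mg gc xi; apply: fold_mollify_eq0 => //.
apply: filterS gc => y /= gy gy0; have [/(_ i) yc|/gy/eqP] := pselect (cube c r y); last first.
  by rewrite (negbTE gy0).
apply: (@fold_kernel_eq0 _ _ i).
have := fold_lipschitz (y ord0 i) (c ord0 i) s0.
have := ler_distD (fold s (y ord0 i)) (x ord0 i) (fold s (c ord0 i)); lra.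
Qed.

(** The kernel is at most [t^-1 ^+ n] and vanishes unless every coordinate of [y] folds to within
    [t] of that of [x]; inside the cube this leaves a box whose sides have measure at most [b]. *)
Lemma fold_mollify_bound g c r M b x : L1 g -> 0 <= M ->
  {ae mu, forall y, `|g y| <= M} ->
  {ae mu, forall y, ~ cube c r y -> g y = 0} ->
  (forall i, (lebesgue_measure [set u : R | `|u - c ord0 i| <= r /\
     `|fold s u - x ord0 i| <= t]%R <= b%:E)%E) ->
  `|K g x| <= M * (t^-1 * b) ^+ n.
Proof.
move=> g1 M0 gM gc hb.
pose A i : set R := [set u : R | `|u - c ord0 i| <= r /\ `|fold s u - x ord0 i| <= t].
have mA i : measurable (A i) by exact: measurable_fold_ball.
pose B : set Rn := [set y | forall i, A i (y ord0 i)].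
have mB : measurable B by exact: measurable_rV_box.
have muB : (mu B <= (b ^+ n)%:E)%E.
  by rewrite -[X in _ ^+ X]card_ord -prodr_const; exact: lebesgue_rV_box_le.
have fB : mu B \is a fin_num by rewrite ge0_fin_numE//; exact: le_lt_trans muB (ltry _).
have B1 : L1 \1_B by apply: integrable_indic_lty => //; exact: le_lt_trans muB (ltry _).
rewrite exprMn mulrA.
have tn0 : 0 <= t^-1 ^+ n by rewrite exprn_ge0// invr_ge0 ltW.
apply: (@le_trans _ _ (M * t^-1 ^+ n * \int[mu]_y \1_B y)); last first.
  apply: ler_wpM2l; first exact: mulr_ge0.
  by rewrite Rintegral_indic// -lee_fin fineK.
rewrite -RintegralZl//; apply: norm_Rintegral_le.
- by apply: integrable_measurable; exact: integrable_kernel_mul.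
- exact: integrable_EFinZ.
apply: filterS2 gM gc => y gM gc; rewrite normrM indicE.
have [yc|/gc->] := pselect (cube c r y); last first.
  by rewrite normr0 mulr0 mulr_ge0// mulr_ge0.
case: (boolP (y \in B)) => [_|/negP nB].
  by rewrite mulr1 mulrC ler_pM// norm_fold_kernel.
rewrite mulr0; suff -> : kk x y = 0 by rewrite normr0 mul0r.
have /existsNP[i nA] : ~ B y by move=> By; apply: nB; exact: mem_set.
apply: (@fold_kernel_eq0 _ _ i); rewrite ltNge distrC; apply/negP => h.
by apply: nA; split => //; exact: yc.
Qed.

End fold_mollify.

(** * Complex functions and atoms *)

Section complex_modulus.
Variable R : realType.
Local Notation nrm := (@ComplexField.Normc.normc R).
Implicit Types z w : R[i].

Lemma normc_ge0 z : 0 <= nrm z.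
Proof. by case: z => a b; rewrite sqrtr_ge0. Qed.

Lemma normc_0 : nrm 0 = 0.
Proof. exact: ComplexField.Normc.normc0. Qed.

Lemma normc_D z w : nrm (z + w) <= nrm z + nrm w.
Proof. by rewrite -lecR rmorphD /=; exact: (@ler_normD _ R[i]). Qed.

Lemma normc_N z : nrm (- z) = nrm z.
Proof. by case: z => a b /=; rewrite !sqrrN. Qed.

Lemma normc_M z w : nrm (z * w) = nrm z * nrm w.
Proof. exact: ComplexField.Normc.normcM. Qed.

Lemma normc_real (a : R) : nrm a%:C = `|a|.
Proof. by rewrite /= expr0n /= addr0 sqrtr_sqr. Qed.

Lemma Re_le_normc z : `|complex.Re z| <= nrm z.
Proof.
by case: z => a b /=; rewrite -sqrtr_sqr ler_wsqrtr// lerDl sqr_ge0.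
Qed.

Lemma Im_le_normc z : `|complex.Im z| <= nrm z.
Proof.
by case: z => a b /=; rewrite -sqrtr_sqr ler_wsqrtr// lerDr sqr_ge0.
Qed.

Lemma normc_le_ReIm z : nrm z <= `|complex.Re z| + `|complex.Im z|.
Proof.
case: z => a b /=; rewrite -[leRHS]ger0_norm ?addr_ge0// -sqrtr_sqr ler_wsqrtr//.
rewrite -(real_normK (num_real a)) -(real_normK (num_real b)) sqrrD.
by rewrite addrAC lerDl mulrn_wge0// mulr_ge0.
Qed.

Lemma normrE_normc z : `|z| = (nrm z)%:C.
Proof. by case: z => a b; rewrite normc_def. Qed.

End complex_modulus.

Section measurable_complex.
Variables (R : realType) (n : nat).
Local Notation Rn := 'rV[R]_n.
Local Notation mu := (lebesgue_rV R n).
Local Notation L1 f := (mu.-integrable setT (EFin \o f)).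
Local Notation nrm := (@ComplexField.Normc.normc R).
Implicit Types (f g : Rn -> R[i]).

Lemma measurable_cabs f : cmeasurable f -> measurable_fun setT (cabs f).
Proof.
move=> [mr mi]; rewrite (_ : cabs f =
    (fun x => (complex.Re (f x) ^+ 2 + complex.Im (f x) ^+ 2) `^ 2^-1)).
  apply: (measurableT_comp (@measurable_powR R 2^-1)).
  by apply: measurable_funD; exact: measurable_funX.
apply/funext => x; rewrite /cabs; case: (f x) => a b /=.
by rewrite powR12_sqrt// addr_ge0// sqr_ge0.
Qed.

Lemma cabs_ge0 f x : 0 <= cabs f x.
Proof. exact: normc_ge0. Qed.

Lemma cmeasurableD f g : cmeasurable f -> cmeasurable g ->
  cmeasurable (fun x => f x + g x).
Proof.
move=> [fr fi] [gr gi]; split.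
  rewrite (_ : (fun _ => _) = (fun x => complex.Re (f x) + complex.Re (g x))).
    exact: measurable_funD.
  by apply/funext => x; rewrite raddfD.
rewrite (_ : (fun _ => _) = (fun x => complex.Im (f x) + complex.Im (g x))).
  exact: measurable_funD.
by apply/funext => x; rewrite raddfD.
Qed.

Lemma cmeasurableZ k f : cmeasurable f -> cmeasurable (fun x => k * f x).
Proof.
move=> [fr fi]; case: k => a b; split.
  rewrite (_ : (fun _ => _) =
      (fun x => a * complex.Re (f x) - b * complex.Im (f x))).
    by apply: measurable_funB; apply: measurable_funM.
  by apply/funext => x; case: (f x).
rewrite (_ : (fun _ => _) =
    (fun x => a * complex.Im (f x) + b * complex.Re (f x))).
  by apply: measurable_funD; apply: measurable_funM.
by apply/funext => x; case: (f x).
Qed.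

Lemma cmeasurableB f g : cmeasurable f -> cmeasurable g ->
  cmeasurable (fun x => f x - g x).
Proof.
move=> mf mg; rewrite (_ : (fun x => _) = (fun x => f x + (-1) * g x)).
  exact/cmeasurableD/cmeasurableZ.
by apply/funext => x; rewrite mulN1r.
Qed.

Lemma cmeasurable0 : cmeasurable (fun _ : Rn => 0 : R[i]).
Proof. by split; exact: measurable_cst. Qed.

Lemma cLnorm1 f : cLnorm 1 f = (\int[mu]_x (cabs f x)%:E)%E.
Proof.
by rewrite /cLnorm Lnorm1; apply: eq_integral => x _ /=; rewrite ger0_norm// cabs_ge0.
Qed.

Definition cintegrable f := cmeasurable f /\ L1 (cabs f).

Lemma cLspace1P f : cLspace 1 f <-> cintegrable f.
Proof.
rewrite /cLspace /= cLnorm1; split=> -[mf h]; split => //.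
  apply/integrableP; split; first by apply/measurable_EFinP; apply: measurable_cabs.
  by under eq_integral do rewrite /= ger0_norm ?cabs_ge0//.
move/integrableP : h => [_]; under eq_integral do rewrite /= ger0_norm ?cabs_ge0//.
by [].
Qed.

Lemma cintegrableP f : cintegrable f <->
  L1 (fun x => complex.Re (f x)) /\ L1 (fun x => complex.Im (f x)).
Proof.
split=> [[[mr mi] h]|[hr hi]].
  split.
    by apply: (le_L1 _ h) => // x; exact: Re_le_normc.
  by apply: (le_L1 _ h) => // x; exact: Im_le_normc.
have mf : cmeasurable f by split; [exact: (integrable_measurable hr)|exact: (integrable_measurable hi)].
split => //; apply: (@le_L1 _ _ _ _ _ (fun x => `|complex.Re (f x)| + `|complex.Im (f x)|)).
- exact: measurable_cabs.
- by apply: integrable_EFinD; exact: integrable_norm.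
- by move=> x; rewrite ger0_norm ?cabs_ge0// normc_le_ReIm.
Qed.

Lemma cintegrableD f g : cintegrable f -> cintegrable g ->
  cintegrable (fun x => f x + g x).
Proof.
move=> [mf f1] [mg g1]; split; first exact: cmeasurableD.
apply: (le_L1 _ (integrable_EFinD f1 g1)); first by apply: measurable_cabs; exact: cmeasurableD.
by move=> x; rewrite ger0_norm ?cabs_ge0// normc_D.
Qed.

Lemma cintegrableZ k f : cintegrable f -> cintegrable (fun x => k * f x).
Proof.
move=> [mf f1]; split; first exact: cmeasurableZ.
apply: (le_L1 _ (integrable_EFinZ (nrm k) f1)); first by apply: measurable_cabs; exact: cmeasurableZ.
by move=> x; rewrite ger0_norm ?cabs_ge0// /cabs normc_M.
Qed.

Lemma cintegrable_lincomb N (lam : 'I_N -> R[i]) (a : 'I_N -> Rn -> R[i]) :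
  (forall j, cintegrable (a j)) -> cintegrable (lincomb lam a).
Proof.
move=> ma; rewrite /lincomb; elim: N lam a ma => [|N IH] lam a ma.
  rewrite (_ : (fun _ => _) = (fun=> 0)).
    split; first exact: cmeasurable0.
    rewrite /cabs normc_0; exact: integrable0.
  by apply/funext => x; rewrite big_ord0.
rewrite (_ : (fun _ => _) = (fun x => lam ord0 * a ord0 x +
    \sum_(j < N) lam (lift ord0 j) * a (lift ord0 j) x)).
  by apply: cintegrableD; [exact: cintegrableZ|exact: IH].
by apply/funext => x; rewrite big_ord_recl.
Qed.

Lemma cintegralD f g : cintegrable f -> cintegrable g ->
  cintegral (fun x => f x + g x) = cintegral f + cintegral g.
Proof.
move=> /cintegrableP[fr fi] /cintegrableP[gr gi].
rewrite /cintegral /=.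
under eq_Rintegral do rewrite raddfD /=.
under [X in _ +i* X]eq_Rintegral do rewrite raddfD /=.
by rewrite !RintegralD.
Qed.

Lemma cintegralZ k f : cintegrable f -> cintegral (fun x => k * f x) = k * cintegral f.
Proof.
move=> /cintegrableP[fr fi]; case: k => a b; rewrite /cintegral.
have -> : \int[mu]_x complex.Re ((a +i* b) * f x) =
    \int[mu]_x (a * complex.Re (f x) - b * complex.Im (f x)).
  by apply: eq_Rintegral => x _; case: (f x).
have -> : \int[mu]_x complex.Im ((a +i* b) * f x) =
    \int[mu]_x (a * complex.Im (f x) + b * complex.Re (f x)).
  by apply: eq_Rintegral => x _; case: (f x).
rewrite RintegralB ?RintegralD ?RintegralZl//; exact: integrable_EFinZ.
Qed.

Lemma cintegral0 : cintegral (fun _ : Rn => 0 : R[i]) = 0.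
Proof. by rewrite /cintegral !Rintegral_cst// mul0r. Qed.

Lemma cintegral_lincomb0 N (lam : 'I_N -> R[i]) (a : 'I_N -> Rn -> R[i]) :
  (forall j, cintegrable (a j)) -> (forall j, cintegral (a j) = 0) ->
  cintegral (lincomb lam a) = 0.
Proof.
move=> ma; rewrite /lincomb; elim: N lam a ma => [|N IH] lam a ma a0.
  rewrite (_ : (fun _ => _) = (fun=> 0)); first exact: cintegral0.
  by apply/funext => x; rewrite big_ord0.
rewrite (_ : (fun _ => _) = (fun x => lam ord0 * a ord0 x +
    lincomb (lam \o lift ord0) (a \o lift ord0) x)).
  rewrite cintegralD; [|exact: cintegrableZ|]; last first.
    by apply: cintegrable_lincomb => j; exact: ma.
  by rewrite cintegralZ// a0 mulr0 add0r; apply: IH => j; [exact: ma|exact: a0].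
by apply/funext => x; rewrite big_ord_recl.
Qed.

End measurable_complex.

Lemma powR_inv (R : realType) (a q : R) : 0 <= a -> a^-1 `^ q = a `^ (- q).
Proof. by move=> a0; rewrite -[a^-1]powR_inv1// -powRrM mulN1r. Qed.

Section balls_and_atoms.
Variables (R : realType) (n : nat).
Local Notation Rn := 'rV[R]_n.
Local Notation mu := (lebesgue_rV R n).
Local Notation L1 f := (mu.-integrable setT (EFin \o f)).
Local Notation ball := (@euclidean_closed_ball R n).
Implicit Types (c x : Rn) (r : R) (a h : Rn -> R[i]).

Lemma measurable_cube c r : measurable (cube c r : set Rn).
Proof.
rewrite (_ : cube c r = [set x | forall i, `[c ord0 i - r, c ord0 i + r]%classic (x ord0 i)]).
  by apply: (@measurable_rV_box R n (fun i => `[c ord0 i - r, c ord0 i + r]%classic)) => i;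
    exact: measurable_itv.
by apply/seteqP; split => x /= h i; have := h i; rewrite /= in_itv/= ler_distl.
Qed.

Lemma lebesgue_cube c r : 0 <= r -> mu (cube c r) = ((2 * r) ^+ n)%:E.
Proof.
move=> r0.
rewrite (_ : cube c r = [set x | forall i, `[c ord0 i - r, c ord0 i + r]%classic (x ord0 i)]).
  rewrite (@lebesgue_rV_box R n (fun i => `[c ord0 i - r, c ord0 i + r]%classic) (fun=> 2 * r)).
  - by rewrite prodr_const card_ord.
  - by move=> i; exact: measurable_itv.
  move=> i; rewrite lebesgue_measure_itv /= lte_fin.
  case: ltP => [_|h]; first by rewrite -EFinD; congr EFin; ring.
  by congr EFin; lra.
by apply/seteqP; split => x /= h i; have := h i; rewrite /= in_itv/= ler_distl.
Qed.

Lemma ball_sub_cube c r : ball c r `<=` cube c r.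
Proof.
move=> x /= h i; apply: le_trans h; rewrite -sqrtr_sqr ler_wsqrtr//.
by rewrite (bigD1 i)//= lerDl sumr_ge0// => j _; exact: sqr_ge0.
Qed.

(** The factor [n] instead of its square root is not sharp, but it keeps the constants free of
    roots. *)
Lemma cube_sub_ball c r : 0 <= r -> cube c r `<=` ball c (n%:R * r).
Proof.
move=> r0 x h; rewrite /euclidean_closed_ball /=.
rewrite -[leRHS]ger0_norm ?mulr_ge0// -sqrtr_sqr ler_wsqrtr//.
apply: (@le_trans _ _ (\sum_(i < n) r ^+ 2)).
  apply: ler_sum => i _; rewrite -(real_normK (num_real _)) lerXn2r ?nnegrE//.
rewrite sumr_const card_ord -[leLHS]mulr_natl exprMn ler_wpM2r ?sqr_ge0//.
by rewrite -natrX ler_nat; case: (n) => // m; rewrite expnS expn1 leq_pmulr.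
Qed.

Lemma measurable_euclidean_ball c r : measurable (ball c r).
Proof.
rewrite (_ : ball c r = setT `&` (fun x : Rn => \sum_(i < n) (x ord0 i - c ord0 i) ^+ 2) @^-1`
    [set u | Num.sqrt u <= r]); last by rewrite setTI.
have mf : measurable_fun [set: Rn] (fun x : Rn => \sum_(i < n) (x ord0 i - c ord0 i) ^+ 2).
  apply: measurable_sum => i; apply: measurable_funX; apply: measurable_funB => //.
  exact: measurable_coord.
apply: (mf measurableT).
have ms : measurable_fun [set: R] (@Num.sqrt R).
  by apply: continuous_measurable_fun; exact: sqrt_continuous.
have := ms measurableT `]-oo, r]%classic (measurable_itv _).
rewrite setTI; congr measurable.
Qed.

Definition vol c r : R := fine (mu (ball c r)).

Lemma lebesgue_ball_fin c r : 0 <= r -> mu (ball c r) = (vol c r)%:E.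
Proof.
move=> r0; rewrite /vol fineK// ge0_fin_numE//.
apply: (@le_lt_trans _ _ (mu (cube c r))); last by rewrite lebesgue_cube// ltry.
by apply: le_measure; rewrite ?inE; [exact: measurable_euclidean_ball|exact: measurable_cube|exact: ball_sub_cube].
Qed.

Lemma lebesgue_ball_lty c r : 0 < r -> (mu (ball c r) < +oo)%E.
Proof. by move=> r0; rewrite lebesgue_ball_fin ?ltry// ltW. Qed.

Lemma integral_indic_ball c r : 0 <= r ->
  (\int[mu]_x (\1_(ball c r) x)%:E = (vol c r)%:E)%E.
Proof.
move=> r0; rewrite integral_indic ?setIT//; last exact: measurable_euclidean_ball.
exact: lebesgue_ball_fin.
Qed.

Lemma vol_le c r : 0 <= r -> vol c r <= (2 * r) ^+ n.
Proof.
move=> r0; rewrite -lee_fin -lebesgue_ball_fin// -(lebesgue_cube c)//.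
by apply: le_measure; rewrite ?inE; [exact: measurable_euclidean_ball|exact: measurable_cube|exact: ball_sub_cube].
Qed.

Lemma vol_ge c r : (0 < n)%N -> 0 <= r -> (2 * (r / n%:R)) ^+ n <= vol c r.
Proof.
move=> n0 r0; have rn0 : 0 <= r / n%:R by exact: divr_ge0.
rewrite -lee_fin -lebesgue_ball_fin// -(lebesgue_cube c)//.
apply: le_measure; rewrite ?inE; [exact: measurable_cube|exact: measurable_euclidean_ball|].
have := @cube_sub_ball c _ rn0; rewrite mulrCA divff ?mulr1// pnatr_eq0.
by rewrite -lt0n.
Qed.

Lemma vol_gt0 c r : (0 < n)%N -> 0 < r -> 0 < vol c r.
Proof.
move=> n0 r0; apply: lt_le_trans (vol_ge c n0 (ltW r0)).
by rewrite exprn_gt0// mulr_gt0// divr_gt0// ltr0n.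
Qed.

Lemma vol_ge0 c r : 0 <= vol c r.
Proof. by rewrite fine_ge0. Qed.

(** The L^oo norm unfolds to the essential supremum only if the whole space has positive measure. *)
Lemma lebesgue_setT_gt0 : (0 < mu setT)%E.
Proof.
apply: (@lt_le_trans _ _ (mu (cube 0 1))).
  by rewrite lebesgue_cube// lte_fin exprn_gt0// mulr_gt0.
by apply: le_measure; rewrite ?inE//; exact: measurable_cube.
Qed.

Lemma cLnorm_oo_le a (M : R) : 0 <= M ->
  (cLnorm +oo a <= M%:E)%E <-> {ae mu, forall x, cabs a x <= M}.
Proof.
move=> M0; rewrite /cLnorm unlock lebesgue_setT_gt0.
split=> [/ess_supP|] h; last first.
  apply/ess_supP; apply: filterS h => x /=.
  by rewrite lee_fin ger0_norm ?cabs_ge0.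
by apply: filterS h => x /=; rewrite lee_fin ger0_norm ?cabs_ge0.
Qed.

Lemma cLnorm_qE (q : R) a : 0 < q ->
  cLnorm q%:E a = ((\int[mu]_x (cabs a x `^ q)%:E) `^ q^-1)%E.
Proof.
move=> q0; rewrite /cLnorm unlock; congr (_ `^ _)%E; apply: eq_integral => x _ /=.
by rewrite ger0_norm ?cabs_ge0.
Qed.

Lemma atom_oo_ae a : (0 < n)%N -> atom +oo%E a -> exists c r,
  [/\ 0 < r, cintegrable a, cintegral a = 0,
      {ae mu, forall x, ~ ball c r x -> a x = 0} &
      {ae mu, forall x, cabs a x <= (vol c r)^-1}].
Proof.
move=> n0 [c [r /= [r0 [ma _] a0 ia sa]]].
have v0 := vol_gt0 c n0 r0.
have {}sa : {ae mu, forall x, cabs a x <= (vol c r)^-1}.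
  by apply/cLnorm_oo_le => //; rewrite invr_ge0 ltW.
exists c, r; split => //; split => //.
apply: (@ae_le_integrable _ _ _ _ _ (fun x => (vol c r)^-1 * \1_(ball c r) x)).
- exact: measurable_cabs.
- apply: integrable_EFinZ; apply: integrable_indic_lty; first exact: measurable_euclidean_ball.
  exact: lebesgue_ball_lty.
apply: filterS2 a0 sa => x a0 sa; rewrite ger0_norm ?cabs_ge0// indicE.
case: (boolP (x \in ball c r)) => [_|/negP xB]; first by rewrite mulr1.
by rewrite mulr0 /cabs a0 ?normc_0// => xb; apply: xB; exact: mem_set.
Qed.

Lemma atom_oo_cLnorm1 a : (0 < n)%N -> atom +oo%E a -> (cLnorm 1 a <= 1)%E.
Proof.
move=> n0 /(atom_oo_ae n0)[c [r [r0 [ma a1] _ a0 sa]]].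
have v0 := vol_gt0 c n0 r0; rewrite cLnorm1.
apply: (@le_trans _ _ (\int[mu]_x ((vol c r)^-1 * \1_(ball c r) x)%:E)%E).
  apply: ae_ge0_le_integral => //.
  - by move=> x _; rewrite lee_fin cabs_ge0.
  - by apply/measurable_EFinP; apply: measurable_cabs.
  - by move=> x _; rewrite lee_fin mulr_ge0// invr_ge0 ltW.
  - apply/measurable_EFinP; apply: measurable_funM => //.
    by apply: measurable_indic; exact: measurable_euclidean_ball.
  apply: filterS2 a0 sa => x a0 sa _; rewrite lee_fin indicE.
  case: (boolP (x \in ball c r)) => [_|/negP xB]; first by rewrite mulr1.
  by rewrite mulr0 /cabs a0 ?normc_0// => xb; apply: xB; exact: mem_set.
under eq_integral do rewrite EFinM.
rewrite ge0_integralZl//; last 2 first.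
- by apply/measurable_EFinP; apply: measurable_indic; exact: measurable_euclidean_ball.
- by rewrite lee_fin invr_ge0 ltW.
rewrite integral_indic_ball; last exact: ltW.
by rewrite -EFinM mulVf// gt_eqF.
Qed.

Lemma atom_oo_scale h c r (N : R) : (0 < n)%N -> 0 < r -> 0 < N ->
  cmeasurable h -> {ae mu, forall x, ~ ball c r x -> h x = 0} ->
  cintegral h = 0 -> cintegrable h ->
  {ae mu, forall x, cabs h x <= N / vol c r} ->
  atom +oo%E (fun x => (N^-1)%:C * h x).
Proof.
move=> n0 r0 N0 mh h0 ih h1 sh; have v0 := vol_gt0 c n0 r0.
have [Nge0 vge0] : 0 <= N /\ 0 <= vol c r by split; exact: ltW.
have [Ni0 vi0] : 0 <= N^-1 /\ 0 <= (vol c r)^-1 by rewrite !invr_ge0.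
have sh' : {ae mu, forall x, cabs (fun x => (N^-1)%:C * h x) x <= (vol c r)^-1}.
  apply: filterS sh => x; rewrite /cabs normc_M normc_real ger0_norm//.
  by rewrite ler_pdivrMl// mulrC.
have sN : (cLnorm +oo (fun x => (N^-1)%:C * h x)%R <= (vol c r)^-1%:E)%E.
  by apply/cLnorm_oo_le => //; rewrite invr_ge0 ltW.
exists c, r; split => //=.
- by split; [exact: cmeasurableZ|exact: le_lt_trans sN (ltry _)].
- by apply: filterS h0 => x hx /hx ->; rewrite mulr0.
- by rewrite cintegralZ// ih mulr0.
Qed.

(** The hypothesis on the integral is the size condition for [h / N] raised to the power [q]: with v
    the volume of the ball, (v^-1 * int |h|^q)^(1/q) <= N / v means int |h|^q <= N^q * v^(1 - q). *)
Lemma atom_q_scale (q : R) h c r (N : R) : (0 < n)%N -> 1 < q -> 0 < r -> 0 < N ->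
  cmeasurable h -> {ae mu, forall x, ~ ball c r x -> h x = 0} ->
  cintegral h = 0 -> cintegrable h ->
  (\int[mu]_x (cabs h x `^ q)%:E <= (N `^ q * vol c r `^ (1 - q))%:E)%E ->
  atom q%:E (fun x => (N^-1)%:C * h x).
Proof.
move=> n0 q1 r0 N0 mh h0 ih h1 sh; have v0 := vol_gt0 c n0 r0.
have [Nge0 vge0] : 0 <= N /\ 0 <= vol c r by split; exact: ltW.
have [Ni0 vi0] : 0 <= N^-1 /\ 0 <= (vol c r)^-1 by rewrite !invr_ge0.
have q0 : 0 < q by exact: lt_trans q1.
have mhN : cmeasurable (fun x => (N^-1)%:C * h x) by exact: cmeasurableZ.
have cE x : cabs (fun x => (N^-1)%:C * h x) x `^ q = N `^ (- q) * cabs h x `^ q.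
  rewrite /cabs normc_M normc_real ger0_norm//.
  by rewrite powRM ?normc_ge0// powR_inv.
have mq : measurable_fun setT (fun x => (cabs h x `^ q)%:E).
  apply/measurable_EFinP; apply: (measurableT_comp (@measurable_powR R q)).
  exact: measurable_cabs.
have iN : (\int[mu]_x (cabs (fun x => (N^-1)%:C * h x)%R x `^ q)%:E
    <= (vol c r `^ (1 - q))%:E)%E.
  under eq_integral do rewrite cE EFinM.
  rewrite ge0_integralZl//; last 2 first.
  - by move=> x _; rewrite lee_fin powR_ge0.
  - by rewrite lee_fin powR_ge0.
  apply: (le_trans (lee_wpmul2l _ sh)); first by rewrite lee_fin powR_ge0.
  rewrite -EFinM lee_fin mulrA -powRD ?addNr ?powRr0 ?mul1r//.
  by apply/implyP => _; rewrite gt_eqF.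
exists c, r; split => //=.
- split => //; rewrite cLnorm_qE//; apply: poweR_lty.
  exact: le_lt_trans iN (ltry _).
- by apply: filterS h0 => x hx /hx ->; rewrite mulr0.
- by rewrite cintegralZ// ih mulr0.
rewrite -/(vol c r).
rewrite [leRHS](_ : _ = ((vol c r)^-1 `^ q)%:E `^ q^-1)%E; last first.
  by rewrite poweR_EFin -powRrM mulfV ?gt_eqF// powRr1// invr_ge0 ltW.
apply: gt0_ler_poweR.
- by rewrite invr_ge0 ltW.
- rewrite in_itv/= leey andbT; apply: mule_ge0; first by rewrite lee_fin.
  by apply: integral_ge0 => x _; rewrite lee_fin powR_ge0.
- by rewrite in_itv/= leey andbT lee_fin powR_ge0.
have -> : (vol c r)^-1 `^ q = (vol c r)^-1 * vol c r `^ (1 - q).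
  rewrite powR_inv// -[(vol c r)^-1]powR_inv1// -powRD.
    by congr (_ `^ _); ring.
  by apply/implyP => _; rewrite gt_eqF.
rewrite EFinM lee_wpmul2l ?lee_fin//; apply: le_trans iN.
apply: ge0_subset_integral => //.
- exact: measurable_euclidean_ball.
- apply/measurable_EFinP; apply: (measurableT_comp (@measurable_powR R q)).
  exact: measurable_cabs.
- by move=> x _; rewrite lee_fin powR_ge0.
Qed.

Lemma atom_q_data (q : R) a : (0 < n)%N -> 1 < q -> atom q%:E a -> exists c r,
  [/\ 0 < r, cintegrable a, cintegral a = 0,
      {ae mu, forall x, ~ ball c r x -> a x = 0} &
      (\int[mu]_x (cabs a x `^ q)%:E < +oo)%E].
Proof.
move=> n0 q1 [c [r /= [r0 [ma a_q] a0 ia _]]].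
have q0 : 0 < q by exact: lt_trans q1.
have aq : (\int[mu]_x (cabs a x `^ q)%:E < +oo)%E.
  rewrite cLnorm_qE// in a_q; apply: (lty_poweRy _ a_q).
  by rewrite invr_neq0// gt_eqF.
exists c, r; split => //; split => //.
(* On the ball |a| <= 1 + |a|^q, because q > 1. *)
apply: (@ae_le_integrable _ _ _ _ _ (fun x => \1_(ball c r) x + cabs a x `^ q)).
- exact: measurable_cabs.
- apply: integrable_EFinD.
    apply: integrable_indic_lty; first exact: measurable_euclidean_ball.
    exact: lebesgue_ball_lty.
  apply/integrableP; split.
    apply/measurable_EFinP; apply: (measurableT_comp (@measurable_powR R q)).
    exact: measurable_cabs.
  by under eq_integral do rewrite /= ger0_norm ?powR_ge0//.
apply: filterS a0 => x a0; rewrite ger0_norm ?cabs_ge0// indicE.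
case: (boolP (x \in ball c r)) => [_|/negP xB]; last first.
  rewrite /cabs a0 ?normc_0 ?add0r ?powR_ge0// => xb; apply: xB; exact: mem_set.
have [h|h] := leP (cabs a x) 1; first by rewrite ler_wpDr ?powR_ge0.
by apply: ler_wpDl => //; apply: le1r_powR; exact: ltW.
Qed.

(* [(2 * n * r) ^+ n] bounds the volume of a ball containing the cube. *)
Lemma cube_atom h c r M : (0 < n)%N -> 0 < r -> 0 < M ->
  cmeasurable h -> (forall x, ~ cube c r x -> h x = 0) -> cintegral h = 0 ->
  (forall x, cabs h x <= M) ->
  let N := M * (2 * (n%:R * r)) ^+ n in
  [/\ 0 < N, cintegrable h, atom +oo%E (fun x => (N^-1)%:C * h x)
    & forall q, 1 < q -> atom q%:E (fun x => (N^-1)%:C * h x)].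
Proof.
move=> n0 r0 M0 mh h0 ih hM N.
have nr0 : 0 < n%:R * r by rewrite mulr_gt0// ltr0n.
have N0 : 0 < N by rewrite /N mulr_gt0// exprn_gt0// mulr_gt0.
have v0 := vol_gt0 c n0 nr0; have M0' := ltW M0; have N0' := ltW N0.
have h0' x : ~ ball c (n%:R * r) x -> h x = 0.
  by move=> xB; apply: h0 => /(cube_sub_ball (ltW r0)).
have MN : M <= N / vol c (n%:R * r).
  by rewrite ler_pdivlMr// /N ler_wpM2l ?vol_le// ltW.
have bound x : cabs h x <= M * \1_(ball c (n%:R * r)) x.
  rewrite indicE; case: (boolP (x \in _)) => [_|/negP xB]; first by rewrite mulr1.
  by rewrite mulr0 /cabs h0' ?normc_0// => xb; apply: xB; exact: mem_set.
have h1 : cintegrable h.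
  split => //; apply: (@le_L1 _ _ _ _ _ (fun x => M * \1_(ball c (n%:R * r)) x)).
  - exact: measurable_cabs.
  - apply: integrable_EFinZ; apply: integrable_indic_lty; first exact: measurable_euclidean_ball.
    exact: lebesgue_ball_lty.
  - by move=> x; rewrite ger0_norm ?cabs_ge0.
split => //.
  apply: (@atom_oo_scale h c (n%:R * r)) => //; first exact: aeW.
  by apply: aeW => x; exact: le_trans (hM x) MN.
move=> q q1; have q0 : 0 < q by exact: lt_trans q1.
apply: (@atom_q_scale q h c (n%:R * r)) => //; first exact: aeW.
apply: (@le_trans _ _ (\int[mu]_x (M `^ q * \1_(ball c (n%:R * r)) x)%:E)%E).
  apply: ge0_le_integral => //.
  - by move=> x _; rewrite lee_fin powR_ge0.
  - apply/measurable_EFinP; apply: (measurableT_comp (@measurable_powR R q)).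
    exact: measurable_cabs.
  - apply/measurable_EFinP; apply: measurable_funM => //.
    by apply: measurable_indic; exact: measurable_euclidean_ball.
  move=> x _; rewrite lee_fin; have := bound x; rewrite !indicE.
  case: (x \in _) => /=; last first.
    rewrite !mulr0 => h2; have -> : cabs h x = 0 by apply/le_anti; rewrite h2 cabs_ge0.
    by rewrite powR0// gt_eqF.
  rewrite !mulr1 => h2; apply: ge0_ler_powR; rewrite ?nnegrE ?cabs_ge0//; exact: ltW.
under eq_integral do rewrite EFinM.
rewrite ge0_integralZl//; last 2 first.
- by apply/measurable_EFinP; apply: measurable_indic; exact: measurable_euclidean_ball.
- by rewrite lee_fin powR_ge0.
rewrite integral_indic_ball; last exact: ltW.
rewrite -EFinM lee_fin powRD; last by apply/implyP => _; rewrite gt_eqF.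
rewrite powRr1 ?vol_ge0// mulrA mulrAC ler_wpM2r ?vol_ge0//.
rewrite -powR_inv ?vol_ge0// -powRM ?invr_ge0 ?vol_ge0//.
apply: ge0_ler_powR; rewrite ?nnegrE//; [exact: ltW|].
by rewrite divr_ge0 ?vol_ge0.
Qed.

End balls_and_atoms.

Lemma ecvg0_lt (R : realType) (u : (\bar R)^nat) (d : R) :
  u @ \oo --> (0 : \bar R) -> 0 < d -> \forall N \near \oo, (u N < d%:E)%E.
Proof. by move=> u0 d0; apply: (u0 _ (open_ereal_lt' _)); rewrite lte_fin. Qed.

(** * The norm of [Y] and linear maps on spaces of functions *)

Section real_norm.
Variables (R : realType) (Y : completeNormedModType R[i]).
Local Notation nrm := (@ComplexField.Normc.normc R).
Implicit Types y z : Y.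

Lemma norm_YnormE y : `|y| = (Ynorm y)%:C.
Proof. by rewrite /Ynorm RRe_real// ger0_real. Qed.

Lemma Ynorm_ge0 y : 0 <= Ynorm y.
Proof. by rewrite -lecR -norm_YnormE normr_ge0. Qed.

Lemma Ynorm_D y z : Ynorm (y + z) <= Ynorm y + Ynorm z.
Proof. by rewrite -lecR rmorphD /= -!norm_YnormE ler_normD. Qed.

Lemma Ynorm_Z k y : Ynorm (k *: y) = nrm k * Ynorm y.
Proof.
apply/eqP; rewrite -(inj_eq (@complexI R)) rmorphM /= -!norm_YnormE normrZ.
by rewrite normrE_normc.
Qed.

Lemma Ynorm_0 : Ynorm (0 : Y) = 0.
Proof. by rewrite /Ynorm normr0. Qed.

Lemma Ynorm_N y : Ynorm (- y) = Ynorm y.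
Proof. by rewrite /Ynorm normrN. Qed.

Lemma Ynorm_le0 y : Ynorm y <= 0 -> y = 0.
Proof.
move=> y0; apply: normr0_eq0; rewrite norm_YnormE.
by have -> : Ynorm y = 0 by apply/le_anti; rewrite y0 Ynorm_ge0.
Qed.

Lemma Ynorm_B y z : Ynorm (y - z) <= Ynorm y + Ynorm z.
Proof. by rewrite -(Ynorm_N z) Ynorm_D. Qed.

Lemma Ynorm_sum (I : Type) (r : seq I) (P : pred I) (F : I -> Y) :
  Ynorm (\sum_(i <- r | P i) F i) <= \sum_(i <- r | P i) Ynorm (F i).
Proof.
elim/big_rec2 : _ => [|i x y _ h]; first by rewrite Ynorm_0.
by apply: (le_trans (Ynorm_D _ _)); rewrite lerD2l.
Qed.

End real_norm.

Section linear_on_subspace.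
Variables (R : realType) (n : nat) (Y : completeNormedModType R[i]).
Local Notation Rn := 'rV[R]_n.
Variables (D : set (Rn -> R[i])) (T : (Rn -> R[i]) -> Y).

Definition csubspace : Prop :=
  D (fun=> 0) /\ forall k f g, D f -> D g -> D (fun x => k * f x + g x).

Hypotheses (hD : csubspace) (hT : linear_on D T).

Lemma linear_on0 : T (fun=> 0) = 0.
Proof.
have := hT 1 hD.1 hD.1; rewrite scale1r.
rewrite (_ : (fun _ => _) = (fun _ : Rn => 0 : R[i])); last first.
  by apply/funext => x; rewrite mulr0 addr0.
by move=> /(congr1 (fun y => y - T (fun=> 0))); rewrite subrr addrK.
Qed.

Lemma csubspaceZ k f : D f -> D (fun x => k * f x).
Proof.
move=> Df; have := hD.2 k _ _ Df hD.1; congr D.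
by apply/funext => x; rewrite addr0.
Qed.

Lemma csubspaceB f g : D f -> D g -> D (fun x => f x - g x).
Proof.
move=> Df Dg; have := hD.2 (-1) _ _ Dg Df; congr D.
by apply/funext => x; rewrite mulN1r addrC.
Qed.

Lemma linear_onZ k f : D f -> T (fun x => k * f x) = k *: T f.
Proof.
move=> Df; have := hT k Df hD.1; rewrite linear_on0 addr0 => <-.
by congr T; apply/funext => x; rewrite addr0.
Qed.

Lemma linear_onB f g : D f -> D g -> T (fun x => f x - g x) = T f - T g.
Proof.
move=> Df Dg; have := hT (-1) Dg Df; rewrite scaleN1r addrC => <-.
by congr T; apply/funext => x; rewrite mulN1r addrC.
Qed.

Lemma linear_on_lincomb N (lam : 'I_N -> R[i]) (a : 'I_N -> Rn -> R[i]) :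
  (forall j, D (a j)) ->
  D (lincomb lam a) /\ T (lincomb lam a) = \sum_(j < N) lam j *: T (a j).
Proof.
rewrite /lincomb; elim: N lam a => [|N IH] lam a Da.
  rewrite (_ : (fun _ => _) = (fun=> 0)).
    by rewrite big_ord0 linear_on0; split => //; exact: hD.1.
  by apply/funext => x; rewrite big_ord0.
have [D' T'] := IH (lam \o lift ord0) (a \o lift ord0) (fun j => Da _).
rewrite (_ : (fun _ => _) = (fun x => lam ord0 * a ord0 x +
    \sum_(j < N) (lam \o lift ord0) j * (a \o lift ord0) j x)).
  by split; [exact: hD.2|rewrite hT// big_ord_recl T'].
by apply/funext => x; rewrite big_ord_recl.
Qed.

End linear_on_subspace.

(** * Folding and mollifying an atomic decomposition *)

Section fold_mollified_decomposition.
Variables (R : realType) (n : nat) (Y : completeNormedModType R[i]).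
Local Notation Rn := 'rV[R]_n.
Local Notation mu := (lebesgue_rV R n).
Local Notation nrm := (@ComplexField.Normc.normc R).
Hypothesis n0 : (0 < n)%N.
Variables (s t : R) (k1 : R -> R -> R).
Hypotheses (s0 : 0 < s) (t0 : 0 < t) (ts : t <= s) (hk : mollifier t k1).
Implicit Types f g a h : Rn -> R[i].

Definition cfold_mollify g : Rn -> R[i] := fun x =>
  fold_mollify s k1 (fun y => complex.Re (g y)) x +i*
  fold_mollify s k1 (fun y => complex.Im (g y)) x.
Local Notation K := cfold_mollify.

Lemma cintegrable_cfold_mollify g : cintegrable g -> cintegrable (K g).
Proof.
move=> /cintegrableP[gr gi]; apply/cintegrableP; split => /=.
  exact: (integrable_fold_mollify s0 hk gr).
exact: (integrable_fold_mollify s0 hk gi).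
Qed.

Lemma cintegral_cfold_mollify g : cintegrable g -> cintegral (K g) = cintegral g.
Proof.
move=> /cintegrableP[gr gi]; rewrite /cintegral /=; congr (_ +i* _).
  exact: (Rintegral_fold_mollify s0 hk gr).
exact: (Rintegral_fold_mollify s0 hk gi).
Qed.

Lemma cfold_mollifyD (k : R[i]) f g : cintegrable f -> cintegrable g ->
  K (fun x => k * f x + g x) = (fun x => k * K f x + K g x).
Proof.
move=> /cintegrableP[fr fi] /cintegrableP[gr gi]; apply/funext => x.
case: k => a b; rewrite /K /=.
rewrite (_ : (fun y => complex.Re _) = (fun y => a * complex.Re (f y) +
  (- b * complex.Im (f y) + complex.Re (g y)))); last first.
  by apply/funext => y; case: (f y) => u v; case: (g y) => u' v' /=; ring.
rewrite (_ : (fun y => complex.Im (_ + _)) = (fun y => a * complex.Im (f y) +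
  (b * complex.Re (f y) + complex.Im (g y)))); last first.
  by apply/funext => y; case: (f y) => u v; case: (g y) => u' v' /=; ring.
rewrite !(fold_mollify_linear s0 hk)//; try (apply: integrable_EFinD => //; exact: integrable_EFinZ).
by congr (_ +i* _); ring.
Qed.

Lemma cfold_mollify0 : K (fun=> 0) = (fun=> 0).
Proof.
apply/funext => x; rewrite /K /fold_mollify /=.
under eq_Rintegral do rewrite mulr0.
by rewrite !Rintegral_cst// mul0r.
Qed.

Lemma cfold_mollify_lincomb N (lam : 'I_N -> R[i]) (a : 'I_N -> Rn -> R[i]) :
  (forall j, cintegrable (a j)) ->
  K (lincomb lam a) = lincomb lam (fun j => K (a j)).
Proof.
rewrite /lincomb; elim: N lam a => [|N IH] lam a ha.
  rewrite (_ : (fun x => _) = (fun=> 0)).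
    by rewrite cfold_mollify0; apply/funext => x; rewrite big_ord0.
  by apply/funext => x; rewrite big_ord0.
rewrite (_ : (fun x => _) = (fun x => lam ord0 * a ord0 x +
    lincomb (lam \o lift ord0) (a \o lift ord0) x)).
  rewrite cfold_mollifyD//; last by apply: cintegrable_lincomb => j; exact: ha.
  rewrite /lincomb (IH (lam \o lift ord0) (a \o lift ord0)) => [|j]; last exact: ha.
  by apply/funext => x; rewrite big_ord_recl.
by apply/funext => x; rewrite big_ord_recl.
Qed.

Let cmeasurable_cfold_mollify g : cintegrable g -> cmeasurable (K g).
Proof. by move=> /cintegrable_cfold_mollify[]. Qed.

Lemma cfold_mollify_support g x : cmeasurable g -> ~ cube 0 (s + t) x -> K g x = 0.
Proof.
move=> [gr gi] xc; have [j] := notin_cube xc; rewrite mxE subr0 => xi.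
by rewrite /K !(fold_mollify_support s0 hk _ xi).
Qed.

Lemma cfold_mollify_le g x : cintegrable g ->
  cabs (K g) x <= 2 * (t^-1 ^+ n * \int[mu]_y cabs g y).
Proof.
move=> ig; have /cintegrableP[gr gi] := ig; case: (ig) => mg g1.
apply: (le_trans (normc_le_ReIm _)).
have tn0 : 0 <= t^-1 ^+ n by rewrite exprn_ge0// invr_ge0 ltW.
rewrite mulrDl mul1r; apply: lerD => /=.
  apply: (le_trans (norm_fold_mollify_le s0 hk _ gr)); rewrite ler_wpM2l//.
  apply: le_Rintegral => //; first exact: integrable_norm.
  by move=> y _; exact: Re_le_normc.
apply: (le_trans (norm_fold_mollify_le s0 hk _ gi)); rewrite ler_wpM2l//.
apply: le_Rintegral => //; first exact: integrable_norm.
by move=> y _; exact: Im_le_normc.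
Qed.

(* [32 * n^2] comes from the worst case, an atom of radius [r >= t]: in each
   coordinate at most [16 * t * max(1, r/s)] of the measure of the ball folds
   into a window of width [2t], and balls are compared with cubes. *)
Definition fold_atom_const : R := 2 * (32 * n%:R ^+ 2) ^+ n.

Lemma cfold_mollify_atom a : atom +oo%E a -> exists c r M,
  [/\ 0 < r, 0 < M, forall x, ~ cube c r x -> K a x = 0,
      forall x, cabs (K a) x <= M & M * (2 * (n%:R * r)) ^+ n <= fold_atom_const].
Proof.
move=> /(atom_oo_ae n0)[c [r [r0 ia _ a0 sa]]].
have /cintegrableP[ar ai] := ia; have [[mr mi] _] := ia.
have v0 := vol_gt0 c n0 r0; have nR0 : 0 < n%:R :> R by rewrite ltr0n.
have [ts' s1 t1] := And3 ts s0 t0.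
have [r0' t0' s0' nR0'] : [/\ 0 <= r, 0 <= t, 0 <= s & 0 <= n%:R :> R] by split; exact: ltW.
have vi0 : 0 <= (vol c r)^-1 by rewrite invr_ge0 ltW.
have ac : {ae mu, forall y, ~ cube c r y -> a y = 0}.
  by apply: filterS a0 => y h yc; apply: h => /ball_sub_cube.
have acr : {ae mu, forall y, ~ cube c r y -> complex.Re (a y) = 0}.
  by apply: filterS ac => y h /h ->.
have aci : {ae mu, forall y, ~ cube c r y -> complex.Im (a y) = 0}.
  by apply: filterS ac => y h /h ->.
have sar : {ae mu, forall y, `|complex.Re (a y)| <= (vol c r)^-1}.
  by apply: filterS sa => y; apply: le_trans; exact: Re_le_normc.
have sai : {ae mu, forall y, `|complex.Im (a y)| <= (vol c r)^-1}.
  by apply: filterS sa => y; apply: le_trans; exact: Im_le_normc.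
have bound b (x : Rn) : (forall i, (lebesgue_measure [set u : R | `|u - c ord0 i| <= r /\
     `|fold s u - x ord0 i| <= t]%R <= b%:E)%E) ->
    cabs (K a) x <= 2 * ((vol c r)^-1 * (t^-1 * b) ^+ n).
  move=> hb; apply: (le_trans (normc_le_ReIm _)).
  rewrite mulrDl mul1r; apply: lerD => /=.
    exact: (fold_mollify_bound s0 t0 hk ar vi0 sar acr hb).
  exact: (fold_mollify_bound s0 t0 hk ai vi0 sai aci hb).
(* A ball of radius [r] contains a cube of radius [r / n]. *)
have Vr : (vol c r)^-1 <= (n%:R / (2 * r)) ^+ n.
  rewrite -[X in _ <= X]invrK lef_pV2 ?posrE ?invr_gt0 ?exprn_gt0 ?divr_gt0 ?mulr_gt0//.
  by rewrite -exprVn invf_div -mulrA; apply: vol_ge => //; exact: ltW.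
have supp x : ~ cube (\row_i fold s (c ord0 i)) (r + t) x -> K a x = 0.
  move=> xc; have [j] := notin_cube xc; rewrite mxE => xi.
  by rewrite /K !(fold_mollify_support_cube s0 hk _ _ xi).
have supp0 x : ~ cube 0 (s + t) x -> K a x = 0 by exact: cfold_mollify_support.
have sub_cube c' (r1 r2 : R) (x : Rn) : r1 <= r2 -> cube c' r1 x -> cube c' r2 x.
  by move=> r12 h i; exact: le_trans (h i) r12.
(* If [r <= t], the kernel spreads the mass over the scale [t]; the trivial bound [2 * r] for the
   measure in each coordinate is enough. *)
have [rt|tr] := leP r t.
  exists (\row_i fold s (c ord0 i)), (2 * t), (2 * (n%:R / t) ^+ n).
  split.
  - by rewrite mulr_gt0.
  - by rewrite mulr_gt0// exprn_gt0// divr_gt0.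
  - by move=> x nx; apply: supp => xc; apply: nx; apply: sub_cube xc; lra.
  - move=> x; apply: le_trans (bound (2 * r) x _) _ => [i|].
      apply: (@le_trans _ _ (lebesgue_measure `[(c ord0 i - r)%R, (c ord0 i + r)%R]%classic)).
        apply: le_measure; rewrite ?inE; first exact: measurable_fold_ball.
          exact: measurable_itv.
        by move=> u /= [h _]; rewrite in_itv/= -ler_distl.
      rewrite lebesgue_measure_itv /= lte_fin ifT; last lra.
      by rewrite -EFinD lee_fin; lra.
    rewrite ler_wpM2l//; apply: (@le_trans _ _ ((n%:R / (2 * r)) ^+ n * (t^-1 * (2 * r)) ^+ n)).
      by rewrite ler_wpM2r// exprn_ge0// !mulr_ge0 ?invr_ge0.
    by rewrite -exprMn le_eqVlt; apply/orP; left; apply/eqP; congr (_ ^+ _); field; rewrite !gt_eqF.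
  rewrite /fold_atom_const -[leLHS]mulrA ler_wpM2l// -exprMn lerXn2r ?nnegrE//.
    by rewrite !mulr_ge0 ?invr_ge0.
  rewrite (_ : _ * _ = 4 * n%:R ^+ 2); last by field; rewrite ?gt_eqF.
  by rewrite ler_wpM2r ?exprn_ge0//; lra.
have fold_meas (x : Rn) i : (lebesgue_measure [set u : R | `|u - c ord0 i| <= r /\
     `|fold s u - x ord0 i| <= t]%R <= ((r / s + 3) * (4 * t))%:E)%E.
  by apply: lebesgue_fold_le => //; exact: ltW.
(* If [r <= s], then [r / s + 3 <= 4]: the height of [K a] is that of [a] up to a constant, and the
   radius of the support at most doubles. *)
have [rs|sr] := leP r s.
  exists (\row_i fold s (c ord0 i)), (2 * r), (2 * (8 * n%:R / r) ^+ n).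
  split.
  - by rewrite mulr_gt0.
  - by rewrite mulr_gt0// exprn_gt0// divr_gt0// mulr_gt0.
  - by move=> x nx; apply: supp => xc; apply: nx; apply: sub_cube xc; lra.
  - move=> x; apply: le_trans (bound (16 * t) x _) _ => [i|].
      apply: (le_trans (fold_meas x i)); rewrite lee_fin.
      have : r / s <= 1 by rewrite ler_pdivrMr// mul1r.
      by move=> h; rewrite (_ : 16 * t = 4 * (4 * t)); [rewrite ler_wpM2r; lra|ring].
    rewrite ler_wpM2l//; apply: (@le_trans _ _ ((n%:R / (2 * r)) ^+ n * (t^-1 * (16 * t)) ^+ n)).
      by rewrite ler_wpM2r// exprn_ge0// !mulr_ge0 ?invr_ge0.
    by rewrite -exprMn le_eqVlt; apply/orP; left; apply/eqP; congr (_ ^+ _); field; rewrite !gt_eqF.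
  rewrite /fold_atom_const -[leLHS]mulrA ler_wpM2l// -exprMn lerXn2r ?nnegrE//.
    by rewrite !mulr_ge0 ?invr_ge0.
  by rewrite (_ : _ * _ = 32 * n%:R ^+ 2)//; field; rewrite ?gt_eqF.
(* A ball with [r > s] is wrapped around the cube about [r / s] times in each coordinate, so that a
   height of order [r^-1 ^+ n] becomes one of order [s^-1 ^+ n]. The support lies in the fixed cube
   of radius [s + t <= 2 * s]. *)
exists 0, (2 * s), (2 * (8 * n%:R / s) ^+ n).
split.
- by rewrite mulr_gt0.
- by rewrite mulr_gt0// exprn_gt0// divr_gt0// mulr_gt0.
- by move=> x nx; apply: supp0 => xc; apply: nx; apply: sub_cube xc; lra.
- move=> x; apply: le_trans (bound (16 * t * (r / s)) x _) _ => [i|].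
    apply: (le_trans (fold_meas x i)); rewrite lee_fin.
    have : 1 <= r / s by rewrite ler_pdivlMr// mul1r ltW.
    move=> h; rewrite (_ : 16 * t * (r / s) = 4 * (r / s) * (4 * t)); last by field; rewrite ?gt_eqF.
    by rewrite ler_wpM2r; lra.
  rewrite ler_wpM2l//; apply: (@le_trans _ _ ((n%:R / (2 * r)) ^+ n * (t^-1 * (16 * t * (r / s))) ^+ n)).
    by rewrite ler_wpM2r// exprn_ge0// mulr_ge0 ?invr_ge0 ?mulr_ge0 ?invr_ge0.
  rewrite -exprMn le_eqVlt; apply/orP; left; apply/eqP; congr (_ ^+ _); field.
  by rewrite !gt_eqF.
rewrite /fold_atom_const -[leLHS]mulrA ler_wpM2l// -exprMn lerXn2r ?nnegrE//.
  by rewrite !mulr_ge0 ?invr_ge0.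
by rewrite (_ : _ * _ = 32 * n%:R ^+ 2)//; field; rewrite ?gt_eqF.
Qed.

Section operator_bound.
Variables (D : set (Rn -> R[i])) (T : (Rn -> R[i]) -> Y) (A : R).
Hypotheses (hD : csubspace D) (hT : linear_on D T) (A0 : 0 <= A).
(** [M * (2 * (n%:R * r)) ^+ n] is the factor from [cube_atom]; the hypothesis says that [T] is
    bounded by [A] on atoms, in a form shared by (1,q)-atoms and continuous atoms. *)
Hypothesis bound_T : forall h c r M, D h -> 0 < r -> 0 < M ->
  cmeasurable h -> cintegral h = 0 -> (forall x, ~ cube c r x -> h x = 0) ->
  (forall x, cabs h x <= M) -> Ynorm (T h) <= A * (M * (2 * (n%:R * r)) ^+ n).
Hypothesis D_mollify : forall g, cintegrable g -> cintegral g = 0 -> D (K g).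

(* Folding puts all atoms into one cube, and mollifying turns the convergence
   in L^1 of the series into uniform convergence on that cube. *)
Lemma bound_cfold_mollify f lam (a : nat -> Rn -> R[i]) (m : R) : cintegrable f -> cintegral f = 0 ->
  atomic_decomposition +oo%E f lam a -> (atomic_mass lam <= m%:E)%E ->
  Ynorm (T (K f)) <= A * fold_atom_const * m.
Proof.
move=> f1 f0 [ha _ cvg_f] lam_m.
have ia j : cintegrable (a j) by have [c [r []]] := atom_oo_ae n0 (ha j).
have a0 j : cintegral (a j) = 0 by have [c [r []]] := atom_oo_ae n0 (ha j).
have C0 : 0 <= fold_atom_const by rewrite mulr_ge0// exprn_ge0// mulr_ge0// exprn_ge0.
have TKa j : Ynorm (T (K (a j))) <= A * fold_atom_const.
  have [c [r [M [r0 M0 supp hM hC]]]] := cfold_mollify_atom (ha j).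
  apply: le_trans (bound_T (D_mollify (ia j) (a0 j)) r0 M0 _ _ supp hM) _.
  - exact: cmeasurable_cfold_mollify.
  - by rewrite cintegral_cfold_mollify.
  - by rewrite ler_wpM2l.
(* This bound for the remainder blows up as [t] tends to 0, but [t] stays fixed while the number [N]
   of terms grows. *)
pose B := A * (2 * t^-1 ^+ n * (2 * (n%:R * (s + t))) ^+ n).
have B0 : 0 <= B.
  by rewrite /B !mulr_ge0// exprn_ge0// ?invr_ge0 ?mulr_ge0 ?addr_ge0// ltW.
apply/ler_addgt0Pr => e e0.
pose d := e / (B + 1).
have d0 : 0 < d by rewrite divr_gt0// ltr_wpDl.
have : \forall N \near \oo,
    (cLnorm 1 (fun x => f x - \sum_(j < N) lam j * a j x)%R < d%:E)%E.
  exact: (ecvg0_lt cvg_f d0).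
move=> [N _ /(_ N (leqnn _)) /= hN].
pose S := lincomb (fun j : 'I_N => lam j) (fun j : 'I_N => a j).
have S1 : cintegrable S by apply: cintegrable_lincomb => j; exact: ia.
have S0 : cintegral S = 0.
  by apply: cintegral_lincomb0 => j; [exact: ia|exact: a0].
pose g x := f x - S x.
have g_E : g = (fun x => (-1) * S x + f x).
  by apply/funext => x; rewrite mulN1r addrC.
have g1 : cintegrable g.
  by rewrite g_E; apply: cintegrableD => //; exact: cintegrableZ.
have g0 : cintegral g = 0.
  by rewrite g_E cintegralD ?cintegralZ ?S0 ?f0 ?mulr0 ?addr0//; exact: cintegrableZ.
have KfE : K f = (fun x => 1 * K S x + K g x).
  rewrite -cfold_mollifyD//; congr K; apply/funext => x.
  by rewrite /g mul1r addrC subrK.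
have [DS TS] := linear_on_lincomb hD hT (fun j : 'I_N => lam j)
  (fun j : 'I_N => D_mollify (ia j) (a0 j)).
have KS : K S = lincomb (fun j : 'I_N => lam j) (fun j : 'I_N => K (a j)).
  by apply: cfold_mollify_lincomb => j; exact: ia.
rewrite KfE hT ?KS//; last exact: D_mollify.
(* The partial sum is estimated atom by atom. The remainder [K g] is one multiple of an atom on the
   fixed cube, with a factor proportional to the L^1 norm of [g]. *)
rewrite scale1r TS; apply: (le_trans (Ynorm_D _ _)); apply: lerD.
  apply: (le_trans (Ynorm_sum _ _ _)).
  apply: (@le_trans _ _ (\sum_(j < N) nrm (lam j) * (A * fold_atom_const))).
    by apply: ler_sum => j _; rewrite Ynorm_Z ler_wpM2l ?normc_ge0.
  rewrite -mulr_suml mulrC ler_wpM2l ?mulr_ge0//.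
  rewrite -lee_fin; apply: le_trans lam_m; rewrite -sumEFin.
  rewrite -(big_mkord xpredT (fun j => (nrm (lam j))%:E)).
  by apply: nneseries_lim_ge => k _ _; rewrite lee_fin normc_ge0.
have gd : \int[mu]_y cabs g y <= d.
  rewrite -lee_fin /Rintegral fineK; last by apply: integrable_fin_num => //; case: g1.
  by rewrite -cLnorm1; exact: ltW.
apply: (@le_trans _ _ (A * ((2 * (t^-1 ^+ n * d)) * (2 * (n%:R * (s + t))) ^+ n))).
  apply: (@bound_T _ 0) => //.
  - exact: D_mollify.
  - exact: addr_gt0.
  - by do 2 apply: mulr_gt0 => //; rewrite exprn_gt0// invr_gt0.
  - exact: cmeasurable_cfold_mollify.
  - by rewrite cintegral_cfold_mollify.
  - by move=> x; apply: cfold_mollify_support; case: g1.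
  - move=> x; apply: (le_trans (cfold_mollify_le _ g1)).
    rewrite ler_wpM2l// ler_wpM2l// exprn_ge0// invr_ge0; exact: ltW.
rewrite (_ : A * _ = B * d); last by rewrite /B; ring.
rewrite /d mulrA ler_pdivrMr ?ltr_wpDl// mulrC ler_wpM2l ?ltW//.
lra.
Qed.

End operator_bound.

End fold_mollified_decomposition.

(** * The grid kernel and the hat kernel *)

Section kernels.
Variable R : realType.
Implicit Types (s t w u v : R) (m : nat).

Lemma floor_cell s w u (k : int) : 0 < w ->
  (Num.floor ((u + s) / w) == k) = (k%:~R * w - s <= u < k%:~R * w + w - s).
Proof.
move=> w0; rewrite floor_eq intrD ler_pdivlMr// ltr_pdivrMr//.
by rewrite lerBlDr mulrDl mul1r ltrBrDr.
Qed.

(** Averaging against it is the conditional expectation with respect to the intervals [[k * w - s, k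
    * w + w - s[], the grid of width [w] with a node at [- s]. *)
Definition grid_kernel s w u v : R :=
  w^-1 * (Num.floor ((u + s) / w) == Num.floor ((v + s) / w))%:R.

Lemma measurable_floor_cell s w : 0 < w -> measurable_fun setT
  (fun u : R => (Num.floor ((u + s) / w))%:~R : R).
Proof.
move=> w0; apply: nondecreasing_measurable => // u v uv.
by rewrite ler_int le_floor// ler_pM2r ?invr_gt0// lerD2r.
Qed.

Lemma lebesgue_floor_cell s w (k : int) : 0 < w ->
  (lebesgue_measure [set u | Num.floor ((u + s) / w) == k]%R = w%:E)%E.
Proof.
move=> w0; rewrite (_ : mkset _ = `[k%:~R * w - s, k%:~R * w + w - s[%classic)%R.
  rewrite lebesgue_measure_itv /= lte_fin ifT; last lra.
  by rewrite -EFinD; congr EFin; ring.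
by apply/seteqP; split => u; rewrite /= floor_cell// in_itv.
Qed.

Lemma mollifier_grid s w : 0 < w -> mollifier w (grid_kernel s w).
Proof.
move=> w0; have wi0 : 0 <= w^-1 by rewrite invr_ge0 ltW.
have mfl := measurable_floor_cell s w0.
split.
- apply: measurable_funM => //.
  apply: (@measurableT_comp _ _ _ _ _ _ (fun b : bool => b%:R : R)) => //.
  under eq_fun do rewrite -(eqr_int R).
  apply: measurable_fun_eqr.
    exact: (measurableT_comp mfl measurable_fst).
  exact: (measurableT_comp mfl measurable_snd).
- move=> u v; rewrite /grid_kernel; case: eqP => _; last by rewrite mulr0 lexx.
  by rewrite mulr1 lexx andbT.
- move=> u v uv; rewrite /grid_kernel; case: eqP => [e|_]; last by rewrite mulr0.
  exfalso; move: uv; apply/negP; rewrite -leNgt.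
  have := eqxx (Num.floor ((u + s) / w)); have /eqP := e; rewrite eq_sym.
  rewrite !floor_cell// => /andP[a b] /andP[c d].
  by rewrite ler_norml; apply/andP; split; lra.
move=> v; set k := Num.floor ((v + s) / w).
have mk : measurable [set u : measurableTypeR R | Num.floor ((u + s) / w) == k].
  rewrite (_ : mkset _ = `[k%:~R * w - s, k%:~R * w + w - s[%classic).
    exact: measurable_itv.
  by apply/seteqP; split => u; rewrite /= floor_cell// in_itv.
transitivity (w^-1%:E * \int[lebesgue_measure]_u
    (\1_[set u : measurableTypeR R | Num.floor ((u + s) / w) == k] u)%:E)%E.
  rewrite -ge0_integralZl//; last by apply/measurable_EFinP; exact: measurable_indic.
  by apply: eq_integral => u _; rewrite /grid_kernel indicE mem_setE EFinM.
rewrite integral_indic// setIT [X in (_ * X)%E]lebesgue_floor_cell//.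
by rewrite -EFinM mulVf// gt_eqF.
Qed.

(** Unlike [grid_kernel] it is Lipschitz, so that its averages are continuous; it is also symmetric
    in [u] and [v]. *)
Definition hat_kernel t u v : R := t^-1 ^+ 2 * Num.max 0 (t - `|u - v|).

Lemma hat_kernel_lipschitz t u u' v : 0 < t ->
  `|hat_kernel t u v - hat_kernel t u' v| <= t^-1 ^+ 2 * `|u - u'|.
Proof.
move=> t0; rewrite /hat_kernel -mulrBr normrM.
have ti0 : 0 <= t^-1 ^+ 2 by rewrite exprn_ge0// invr_ge0 ltW.
rewrite (ger0_norm ti0) ler_wpM2l//.
have h a b c : `|Num.max 0 (t - `|a - c|) - Num.max 0 (t - `|b - c|)| <= `|a - b|.
  have h1 : `|a - c| <= `|a - b| + `|b - c| by exact: ler_distD.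
  have h2 : `|b - c| <= `|a - b| + `|a - c| by rewrite (distrC a b) ler_distD.
  have := normr_ge0 (a - b).
  rewrite ler_norml !maxEle; case: ifP => c1; case: ifP => c2 abs; apply/andP; split; lra.
exact: h.
Qed.

(** For the unit mass, Tonelli is applied to the overlap of two intervals of length [t]: integrated
    over all positions of one of them it gives t^2. *)
Lemma mollifier_hat t : 0 < t -> mollifier t (hat_kernel t).
Proof.
move=> t0; have ti0 : 0 <= t^-1 ^+ 2 by rewrite exprn_ge0// invr_ge0 ltW.
split.
- apply: measurable_funM => //; apply: measurable_maxr => //.
  apply: measurable_funB => //; apply: measurableT_comp => //.
  by apply: measurable_funB; [exact: measurable_fst|exact: measurable_snd].
- move=> u v; apply/andP; split; first by rewrite mulr_ge0// le_max lexx.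
  rewrite /hat_kernel expr2 -mulrA -[leRHS]mulr1 ler_wpM2l ?invr_ge0 ?(ltW t0)//.
  rewrite mulrC ler_pdivrMr// mul1r ge_max (ltW t0)/=.
  by rewrite gerBl.
- by move=> u v uv; rewrite /hat_kernel max_l ?mulr0// subr_le0 ltW.
(* [t - |u - v|] is the length of the intersection of [u, u + t] and [v, v + t] *)
move=> v.
pose F (p : measurableTypeR R * measurableTypeR R) : R :=
  (v <= p.2 <= v + t)%R%:R * (p.1 <= p.2 <= p.1 + t)%R%:R.
have mF : measurable_fun setT (EFin \o F).
  apply/measurable_EFinP; apply: measurable_funM;
    apply: (@measurableT_comp _ _ _ _ _ _ (fun b : bool => b%:R : R)) => //.
    by apply: measurable_and; apply: measurable_fun_ler => //; exact: measurable_snd.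
  apply: measurable_and; apply: measurable_fun_ler.
  - exact: measurable_fst.
  - exact: measurable_snd.
  - exact: measurable_snd.
  - by apply: measurable_funD => //; exact: measurable_fst.
have F0 p : (0 <= (EFin \o F) p)%E by rewrite lee_fin mulr_ge0.
have lI (a b : R) : a <= b -> (\int[lebesgue_measure]_u (a <= u <= b)%R%:R%:E = (b - a)%:E)%E.
  move=> ab; have mI : measurable (`[a, b]%classic : set (measurableTypeR R)).
    exact: measurable_itv.
  transitivity (\int[lebesgue_measure]_u
      (\1_(`[a, b]%classic : set (measurableTypeR R)) u)%:E)%E.
    by apply: eq_integral => u _; rewrite indicE mem_setE in_itv.
  rewrite integral_indic// setIT.
  apply: (etrans (lebesgue_measure_itv `[a, b])).
  rewrite /= lte_fin; case: ltP => // ba.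
  by rewrite (le_anti (_ : a <= b <= a)) ?subrr// ab.
have FE1 (u : R) : (\int[lebesgue_measure]_z (EFin \o F) (u, z) = (Num.max 0 (t - `|u - v|))%:E)%E.
  (* The intersection is the interval from max u v to min u v + t; where it is empty, both sides
     vanish. *)
  wlog uv : / Num.max u v <= Num.min u v + t.
    move=> h; have [/h//|uv] := leP (Num.max u v) (Num.min u v + t).
    rewrite max_l; last first.
      by move: uv; rewrite maxEle minEle; case: (leP u v) => c h1; [rewrite ler0_norm|rewrite ger0_norm]; lra.
    rewrite integral0_eq// => z _; rewrite /F /=.
    case: andP => [[h1 h2]|]; case: andP => [[h3 h4]|] //; rewrite ?mul0r ?mulr0//.
    by exfalso; move: uv; rewrite maxEle minEle; case: (leP u v) => c h5; lra.
  transitivity (\int[lebesgue_measure]_z (Num.max u v <= z <= Num.min u v + t)%R%:R%:E)%E.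
    apply: eq_integral => z _; rewrite /F /= -natrM mulnb.
    congr ((nat_of_bool _)%:R%:E); rewrite ge_max addr_minl le_min.
    by case: (v <= z); case: (u <= z); case: (z <= v + t); case: (z <= u + t).
  rewrite lI//; congr EFin; rewrite [RHS]max_r.
    by move: uv; rewrite maxEle minEle; case: (leP u v) => c h1; [rewrite ler0_norm|rewrite ger0_norm]; lra.
  by move: uv; rewrite maxEle minEle; case: (leP u v) => c h1; [rewrite ler0_norm|rewrite ger0_norm]; lra.
have FE2 (z : R) : (\int[lebesgue_measure]_u (EFin \o F) (u, z) = ((v <= z <= v + t)%R%:R * t)%:E)%E.
  rewrite /F /=; under eq_integral do rewrite EFinM.
  rewrite ge0_integralZl//; last first.
    apply/measurable_EFinP.
    apply: (@measurableT_comp _ _ _ _ _ _ (fun b : bool => b%:R : R)) => //.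
    apply: measurable_and; apply: measurable_fun_ler => //.
    by apply: measurable_funD.
  rewrite EFinM; congr (_ * _)%E.
  transitivity (\int[lebesgue_measure]_u (z - t <= u <= z)%R%:R%:E)%E.
    apply: eq_integral => u _; congr ((nat_of_bool _)%:R%:E).
    by rewrite andbC lerBlDr.
  rewrite lI//; last lra.
  by congr EFin; ring.
transitivity (\int[lebesgue_measure]_u ((t^-1 ^+ 2)%:E * (Num.max 0 (t - `|u - v|))%:E))%E.
  by apply: eq_integral => u _; rewrite -EFinM.
rewrite ge0_integralZl//; last 2 first.
- apply/measurable_EFinP; apply: measurable_maxr => //.
  apply: measurable_funB => //; apply: measurableT_comp => //.
  exact: measurable_funB.
- by move=> u _; rewrite lee_fin le_max lexx.
under eq_integral do rewrite -FE1.
have := @fubini_tonelli _ _ _ _ R (lebesgue_measure : {sigma_finite_measure set (measurableTypeR R) -> \bar R})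
   (lebesgue_measure : {sigma_finite_measure set (measurableTypeR R) -> \bar R}) (EFin \o F) mF F0.
rewrite /fubini_F /fubini_G => ->.
under eq_integral do rewrite FE2 EFinM.
rewrite ge0_integralZr//; last 2 first.
- apply/measurable_EFinP.
  apply: (@measurableT_comp _ _ _ _ _ _ (fun b : bool => b%:R : R)) => //.
  by apply: measurable_and; apply: measurable_fun_ler.
- by rewrite lee_fin ltW.
rewrite lI; last lra.
by rewrite -!EFinM; congr EFin; field; rewrite gt_eqF.
Qed.

End kernels.

(** * The atomic norm *)

Section concatenation.
Variables (U : Type) (x0 : U) (L : nat -> seq U).
Hypothesis L_ne : forall k, (0 < size (L k))%N.

Let G K := flatten [seq L k | k <- iota 0 K].

Let G_rec K : G K.+1 = G K ++ L K.
Proof. by rewrite /G -addn1 iotaD map_cat flatten_cat /= cats0. Qed.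

Let size_G K : (K <= size (G K))%N.
Proof.
elim: K => // K IH; rewrite G_rec size_cat -addn1; exact: leq_add.
Qed.

Let nth_G j K K' : (K <= K')%N -> (j < size (G K))%N ->
  nth x0 (G K') j = nth x0 (G K) j.
Proof.
move=> /subnKC <- jK; elim: (K' - K)%N => [|d IH]; first by rewrite addn0.
rewrite addnS G_rec nth_cat ifT//; apply: (leq_trans jK).
rewrite -{1}(addn0 K); elim: (d) => // d' IHd.
by rewrite addnS G_rec size_cat (leq_trans IHd)// leq_addr.
Qed.

(** No block is empty, so the first [j + 1] blocks have more than [j] entries, and the entry at
    position [j] does not change when further blocks are appended. *)
Definition concat_seq j := nth x0 (G j.+1) j.

Lemma concat_seqE K :
  mkseq concat_seq (size (flatten [seq L k | k <- iota 0 K])) =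
  flatten [seq L k | k <- iota 0 K].
Proof.
apply: (@eq_from_nth _ x0); rewrite size_mkseq// => j jK.
rewrite nth_mkseq// /concat_seq -/(G K).
have [h|h] := leqP K j.+1; first exact: nth_G.
by rewrite -(@nth_G _ j.+1 K)// ltnW.
Qed.

Lemma size_concat_seq K : (K <= size (flatten [seq L k | k <- iota 0 K]))%N.
Proof. exact: size_G. Qed.

Lemma concat_seq_prop (P : U -> Prop) : P x0 ->
  (forall k j, P (nth x0 (L k) j)) -> forall j, P (concat_seq j).
Proof.
move=> P0 PL j; rewrite /concat_seq; elim: j.+1 {2}j => [|K IH] j'; first by rewrite nth_nil.
by rewrite G_rec nth_cat; case: ifP.
Qed.

End concatenation.

Section atomic_sums.
Variables (R : realType) (n : nat).
Local Notation Rn := 'rV[R]_n.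
Local Notation mu := (lebesgue_rV R n).
Local Notation L1 f := (mu.-integrable setT (EFin \o f)).
Local Notation nrm := (@ComplexField.Normc.normc R).
Hypothesis n0 : (0 < n)%N.
Implicit Types f g h : Rn -> R[i].

Lemma cLnorm1_D f g : cintegrable f -> cintegrable g ->
  (cLnorm 1 (fun x => f x + g x)%R <= cLnorm 1 f + cLnorm 1 g)%E.
Proof.
move=> [mf f1] [mg g1]; rewrite !cLnorm1 -ge0_integralD//; last 4 first.
- by move=> x _; rewrite lee_fin cabs_ge0.
- by apply/measurable_EFinP; exact: measurable_cabs.
- by move=> x _; rewrite lee_fin cabs_ge0.
- by apply/measurable_EFinP; exact: measurable_cabs.
apply: ge0_le_integral => //.
- by move=> x _; rewrite lee_fin cabs_ge0.
- by apply/measurable_EFinP; apply: measurable_cabs; exact: cmeasurableD.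
- apply: emeasurable_funD; apply/measurable_EFinP; exact: measurable_cabs.
- by move=> x _; rewrite -EFinD lee_fin normc_D.
Qed.

Lemma cLnorm1_Z k f : cmeasurable f ->
  cLnorm 1 (fun x => k * f x) = ((nrm k)%:E * cLnorm 1 f)%E.
Proof.
move=> mf; rewrite !cLnorm1 -ge0_integralZl//.
- by apply: eq_integral => x _; rewrite -EFinM /cabs normc_M.
- by apply/measurable_EFinP; exact: measurable_cabs.
- by move=> x _; rewrite lee_fin cabs_ge0.
- by rewrite lee_fin normc_ge0.
Qed.

Lemma cLnorm1_ge0 f : (0 <= cLnorm 1 f)%E.
Proof. by rewrite cLnorm1; apply: integral_ge0 => x _; rewrite lee_fin cabs_ge0. Qed.

Lemma eq_cLnorm1 f g : cmeasurable f -> cmeasurable g -> cae_eq f g ->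
  cLnorm 1 f = cLnorm 1 g.
Proof.
move=> mf mg fg; rewrite !cLnorm1; apply: ae_eq_integral => //.
- by apply/measurable_EFinP; exact: measurable_cabs.
- by apply/measurable_EFinP; exact: measurable_cabs.
- by apply: filterS fg => x fgx _; rewrite /cabs fgx.
Qed.

Lemma atom_cintegrable a : atom +oo%E a -> cintegrable (a : Rn -> R[i]).
Proof. by move=> /(atom_oo_ae n0)[c [r []]]. Qed.

Lemma atom0 : atom +oo%E (fun _ : Rn => 0 : R[i]).
Proof.
have c1 (x : Rn) : cabs (fun _ : Rn => 0 : R[i]) x <= 1 by rewrite /cabs normc_0.
have [_ _ h _] := @cube_atom R n (fun=> 0) 0 1 1 n0 ltr01 ltr01
  (@cmeasurable0 R n) (fun _ _ => erefl) (@cintegral0 R n) c1.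
by move: h; congr atom; apply/funext => x; rewrite mulr0.
Qed.

(** The families are indexed by [nat], so that two sums are concatenated by a shift of indices. *)
Definition fin_mass (s : R) f : Prop := exists N (lam : nat -> R[i]) (a : nat -> Rn -> R[i]),
  [/\ forall j, atom +oo%E (a j), f = (fun x => \sum_(j < N) lam j * a j x)
    & \sum_(j < N) nrm (lam j) <= s].

Lemma fin_mass_cintegrable s f : fin_mass s f -> cintegrable f.
Proof.
move=> [N [lam [a [ha -> _]]]].
apply: (@cintegrable_lincomb R n N (fun j => lam j) (fun j => a j)) => j.
exact: atom_cintegrable.
Qed.

Lemma fin_mass_le s s' f : s <= s' -> fin_mass s f -> fin_mass s' f.
Proof.
move=> ss' [N [lam [a [ha fE m]]]]; exists N, lam, a; split => //.
exact: le_trans ss'.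
Qed.

Lemma fin_mass0 : fin_mass 0 (fun=> 0).
Proof.
exists 0%N, (fun=> 0), (fun=> (fun=> 0)); split.
- by move=> _; exact: atom0.
- by apply/funext => x; rewrite big_ord0.
- by rewrite big_ord0.
Qed.

Lemma fin_mass_atom k a : atom +oo%E a -> fin_mass (nrm k) (fun x => k * a x).
Proof.
move=> ha; exists 1%N, (fun=> k), (fun=> a); split => //.
- by apply/funext => x; rewrite big_ord1.
- by rewrite big_ord1.
Qed.

Lemma fin_massD s s' f g : fin_mass s f -> fin_mass s' g ->
  fin_mass (s + s') (fun x => f x + g x).
Proof.
move=> [N [lam [a [ha -> m]]]] [N' [lam' [a' [ha' -> m']]]].
pose c T (u v : nat -> T) j := if (j < N)%N then u j else v (j - N)%N.
have cl T (u v : nat -> T) (j : 'I_N) : c T u v (lshift N' j) = u j.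
  by rewrite /c /= ltn_ord.
have cr T (u v : nat -> T) (j : 'I_N') : c T u v (rshift N j) = v j.
  by rewrite /c /= ltnNge leq_addr /= addKn.
exists (N + N')%N, (c _ lam lam'), (c _ a a'); split.
- by move=> j; rewrite /c; case: ifP.
- apply/funext => x; rewrite big_split_ord /=; congr (_ + _).
    by apply: eq_bigr => j _; rewrite !cl.
  by apply: eq_bigr => j _; rewrite !cr.
rewrite big_split_ord /=; apply: lerD; [apply: le_trans m|apply: le_trans m'].
  by apply: ler_sum => j _; rewrite cl.
by apply: ler_sum => j _; rewrite cr.
Qed.

Lemma fin_mass_sum (I : Type) (r : seq I) (s : I -> R) (f : I -> Rn -> R[i]) :
  (forall i, fin_mass (s i) (f i)) ->
  fin_mass (\sum_(i <- r) s i) (fun x => \sum_(i <- r) f i x).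
Proof.
move=> h; elim: r => [|i r IH].
  rewrite big_nil (_ : (fun _ => _) = (fun=> 0)); first exact: fin_mass0.
  by apply/funext => x; rewrite big_nil.
rewrite big_cons (_ : (fun _ => _) = (fun x => f i x + \sum_(j <- r) f j x)).
  exact: fin_massD.
by apply/funext => x; rewrite big_cons.
Qed.

(* Slightly stronger than [H1_norm g <= M], whose infimum need not be attained. *)
Definition mass_le (M : R) g : Prop := cintegrable g /\
  exists lam (a : nat -> Rn -> R[i]),
    atomic_decomposition +oo%E g lam a /\ (atomic_mass lam <= M%:E)%E.

Lemma sum_le_atomic_mass (lam : nat -> R[i]) N :
  (\sum_(j < N) (nrm (lam j))%:E <= atomic_mass lam)%E.
Proof.
rewrite -(big_mkord xpredT (fun j => (nrm (lam j))%:E)).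
by apply: nneseries_lim_ge => k _ _; rewrite lee_fin normc_ge0.
Qed.

Lemma atomic_mass_le (lam : nat -> R[i]) (M : R) : (forall N, \sum_(j < N) nrm (lam j) <= M) ->
  (atomic_mass lam <= M%:E)%E.
Proof.
move=> h; apply: lime_le.
  by apply: is_cvg_nneseries => k _ _; rewrite lee_fin normc_ge0.
by apply: nearW => N; rewrite sumEFin lee_fin big_mkord.
Qed.

Lemma bounded_sum_tail (c : nat -> R) (M e : R) : (forall j, 0 <= c j) ->
  (forall N, \sum_(j < N) c j <= M) -> 0 < e ->
  exists J, forall N P, (J <= P)%N -> (P <= N)%N -> \sum_(P <= j < N) c j < e.
Proof.
move=> c0 cM e0; pose p N := \sum_(0 <= j < N) c j.
have p_nd : nondecreasing_seq p.
  move=> a b ab; rewrite /p (big_cat_nat (leq0n a) ab)//= lerDl.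
  by apply: sumr_ge0.
have p_cvg : cvgn p.
  apply: nondecreasing_is_cvgn => //; exists M => _ [N _ <-].
  by rewrite /p big_mkord.
have /cvgrPdist_lt /(_ e e0) [J _ hJ] := p_cvg.
exists J => N P JP PN.
have := hJ P JP; rewrite /= ltr_norml => /andP[_ hP].
apply: le_lt_trans hP.
rewrite lerBrDl -(big_cat_nat (leq0n P) PN)//=.
exact: nondecreasing_cvgn_le.
Qed.

(** Atoms have L^1 norm at most 1, so the mass of a finite sum controls its L^1 norm. *)
Lemma cLnorm1_lincomb (lam : nat -> R[i]) (a : nat -> Rn -> R[i]) P N : (forall j, atom +oo%E (a j)) ->
  (P <= N)%N ->
  (cLnorm 1 (fun x => \sum_(P <= j < N) lam j * a j x)%R
    <= (\sum_(P <= j < N) nrm (lam j))%:E)%E /\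
  cintegrable (fun x => \sum_(P <= j < N) lam j * a j x).
Proof.
move=> ha /subnKC <-; elim: (N - P)%N => [|d [IH1 IH2]].
  rewrite addn0 big_geq//; under eq_fun do rewrite big_geq//.
  split; last by have := fin_mass_cintegrable fin_mass0.
  rewrite cLnorm1 /cabs; under eq_integral do rewrite normc_0.
  by rewrite integral0.
rewrite addnS big_nat_recr ?leq_addr//=.
under eq_fun do rewrite big_nat_recr ?leq_addr//=.
have i2 : cintegrable (fun x => lam (P + d)%N * a (P + d)%N x).
  by apply: cintegrableZ; exact: atom_cintegrable.
split; last exact: cintegrableD.
apply: (le_trans (cLnorm1_D IH2 i2)); rewrite EFinD leeD//.
rewrite cLnorm1_Z; last by case: (atom_cintegrable (ha (P + d)%N)).
by rewrite -[leRHS]mule1 lee_wpmul2l ?lee_fin ?normc_ge0// atom_oo_cLnorm1.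
Qed.

(* A rearranged series of finite blocks converges because atoms are bounded in
   L^1, so that it suffices to look at partial sums ending with a block. *)
Lemma mass_le_series (f : nat -> Rn -> R[i]) (s : nat -> R) g (M : R) :
  cintegrable g -> (forall k, fin_mass (s k) (f k)) ->
  (forall K, \sum_(k < K) s k <= M) ->
  (forall e, 0 < e -> exists K0, forall K, (K0 <= K)%N ->
    (cLnorm 1 (fun x => g x - \sum_(k < K) f k x)%R < e%:E)%E) ->
  mass_le M g.
Proof.
move=> g1 fs sM cvg_g.
have /choice[N /choice[lam /choice[a h]]] := fs.
pose U := (R[i] * (Rn -> R[i]))%type.
pose x0 : U := (0, fun=> 0).
(* The leading zero term makes every block nonempty and contributes nothing to the sums. *)
pose L k : seq U := x0 :: mkseq (fun j => (lam k j, a k j)) (N k).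
have L_ne k : (0 < size (L k))%N by [].
pose u := concat_seq x0 L.
have sum_u (V : zmodType) (F : U -> V) K : F x0 = 0 ->
    \sum_(0 <= j < size (flatten [seq L k | k <- iota 0 K])) F (u j) =
    \sum_(k < K) \sum_(j < N k) F (lam k j, a k j).
  move=> F0.
  rewrite /index_iota subn0 -(big_map u xpredT F).
  have := concat_seqE x0 L_ne K; rewrite /mkseq => ->.
  rewrite big_flatten /= big_map.
  rewrite -(big_mkord xpredT (fun k => \sum_(j < N k) F (lam k j, a k j))).
  rewrite /index_iota subn0; apply: eq_bigr => k _.
  rewrite /L big_cons F0 add0r /mkseq big_map.
  by rewrite -(big_mkord xpredT (fun j => F (lam k j, a k j))) /index_iota subn0.
have atom_u j : atom +oo%E (u j).2.
  apply: (concat_seq_prop (P := fun p : U => atom +oo%E p.2)) => //=; first exact: atom0.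
  move=> k [|j'] /=; first exact: atom0.
  have [hj|hj] := ltnP j' (N k).
    by rewrite nth_mkseq//=; have [ha _ _] := h k; exact: ha.
  by rewrite nth_default ?size_mkseq//; exact: atom0.
have mass_block K : \sum_(0 <= j < size (flatten [seq L k | k <- iota 0 K]))
    nrm (u j).1 <= M.
  rewrite (sum_u _ (fun p => nrm p.1)) ?normc_0//.
  apply: le_trans (sM K); apply: ler_sum => k _.
  by case: (h k).
have mass_u P : \sum_(j < P) nrm (u j).1 <= M.
  apply: le_trans (mass_block P).
  rewrite -(big_mkord xpredT (fun j => nrm (u j).1)).
  rewrite [leRHS](big_cat_nat (leq0n P) (size_concat_seq L_ne P))//= lerDl.
  by apply: sumr_ge0 => j _; exact: normc_ge0.
split => //; exists (fun j => (u j).1), (fun j => (u j).2); split; last exact: atomic_mass_le.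
split => //; first exact: le_lt_trans (atomic_mass_le mass_u) (ltry _).
have cint P : cintegrable (fun x => g x - \sum_(j < P) (u j).1 * (u j).2 x).
  rewrite (_ : (fun _ => _) = (fun x => (-1) * (\sum_(0 <= j < P) (u j).1 * (u j).2 x) + g x)).
    apply: cintegrableD => //; apply: cintegrableZ.
    by have [] := cLnorm1_lincomb (fun j => (u j).1) atom_u (leq0n P).
  by apply/funext => x; rewrite mulN1r addrC big_mkord.
suff key (e : R) : 0 < e -> \forall P \near \oo,
    (cLnorm 1 (fun x => g x - \sum_(j < P) (u j).1 * (u j).2 x)%R < e%:E)%E.
  apply/fine_cvgP; split.
    apply: filterS (key 1 ltr01) => P hP.
    by rewrite ge0_fin_numE ?cLnorm1_ge0//; exact: lt_trans hP (ltry _).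
  apply/cvgrPdist_lt => e e0; apply: filterS (key e e0) => P hP.
  rewrite sub0r normrN ger0_norm ?fine_ge0 ?cLnorm1_ge0//.
  rewrite -lte_fin fineK// ge0_fin_numE ?cLnorm1_ge0//.
  exact: lt_trans hP (ltry _).
move=> e0; have e2 : 0 < e / 2 by rewrite divr_gt0.
have [K0 hK0] := cvg_g _ e2.
have [J hJ] := bounded_sum_tail (fun j => normc_ge0 (u j).1) mass_u e2.
(* [P] is the end of a block: up to there the partial sum is one of the given series, and what
   follows has mass, hence L^1 norm, below [e / 2]. *)
pose K := maxn K0 J; pose P := size (flatten [seq L k | k <- iota 0 K]).
exists P => // Q /= PQ.
have [t1 t2] := cLnorm1_lincomb (fun j => (u j).1) atom_u PQ.
rewrite (_ : (fun x => _) = (fun x => (g x - \sum_(j < P) (u j).1 * (u j).2 x) +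
    (-1) * \sum_(P <= j < Q) (u j).1 * (u j).2 x)); last first.
  apply/funext => x; rewrite -(big_mkord xpredT (fun j => (u j).1 * (u j).2 x)).
  rewrite (big_cat_nat (leq0n P) PQ)//= big_mkord; ring.
apply: (le_lt_trans (cLnorm1_D (cint P) (cintegrableZ (-1) t2))).
rewrite (splitr e) EFinD; apply: lte_leD.
- by rewrite ge0_fin_numE ?cLnorm1_ge0// cLnorm1_Z ?normc_N; [rewrite (le_lt_trans (lee_wpmul2l _ t1)) ?lee_fin ?normc_ge0// -EFinM ltry|case: t2].
- have := hK0 K (leq_maxl _ _); congr (cLnorm 1 _ < _)%E.
  apply/funext => x; congr (_ - _).
  rewrite -(big_mkord xpredT (fun j => (u j).1 * (u j).2 x)).
  rewrite (sum_u _ (fun p => p.1 * p.2 x)) ?mul0r//.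
  by apply: eq_bigr => k _; case: (h k) => _ -> _.
rewrite cLnorm1_Z; last by case: t2.
rewrite normc_N (_ : nrm 1 = 1) ?mul1e; last by rewrite (normc_real 1) normr1.
apply: le_trans t1 _; rewrite lee_fin ltW// hJ//.
by apply: leq_trans (size_concat_seq L_ne K); exact: leq_maxr.
Qed.

End atomic_sums.

Section atomic_norm.
Variables (R : realType) (n : nat).
Local Notation Rn := 'rV[R]_n.
Local Notation mu := (lebesgue_rV R n).
Local Notation nrm := (@ComplexField.Normc.normc R).
Hypothesis n0 : (0 < n)%N.
Implicit Types f g h : Rn -> R[i].

Lemma mass_le_H1 M g : mass_le M g -> H1 g.
Proof.
move=> [g1 [lam [a [ha _]]]]; split; first exact/cLspace1P.
by exists lam, a.
Qed.

Lemma H1_mass_le g : H1 g -> exists M, mass_le M g.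
Proof.
move=> [/cLspace1P g1 [lam [a ha]]]; have [_ m _] := ha.
have m0 : (0 <= atomic_mass lam)%E.
  by apply: nneseries_ge0 => k _ _; rewrite lee_fin normc_ge0.
exists (fine (atomic_mass lam)); split => //; exists lam, a; split => //.
by rewrite fineK// ge0_fin_numE.
Qed.

Lemma H1_norm_le M g : mass_le M g -> (H1_norm g <= M%:E)%E.
Proof.
move=> [_ [lam [a [ha m]]]]; apply: ereal_inf_le; exists (atomic_mass lam) => //.
by exists lam, a.
Qed.

Lemma H1_norm_lt M g : cintegrable g -> (H1_norm g < M%:E)%E -> mass_le M g.
Proof.
move=> g1 /ereal_inf_lt[_ [lam [a [ha ->]]] m]; split => //.
by exists lam, a; split => //; exact: ltW.
Qed.

Lemma mass_leW M M' g : M <= M' -> mass_le M g -> mass_le M' g.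
Proof.
move=> MM' [g1 [lam [a [ha m]]]]; split => //; exists lam, a; split => //.
by apply: le_trans m _; rewrite lee_fin.
Qed.

Lemma cLnorm1_zero : cLnorm 1 (fun _ : Rn => 0 : R[i]) = 0%E.
Proof.
by rewrite cLnorm1 /cabs; under eq_integral do rewrite normc_0; rewrite integral0.
Qed.

Lemma fin_mass_mass_le s f : fin_mass s f -> mass_le s f.
Proof.
move=> fs; have s0 : 0 <= s.
  move: fs => [N [lam [a [_ _ h]]]]; apply: le_trans h.
  by apply: sumr_ge0 => j _; exact: normc_ge0.
apply: (mass_le_series n0 (f := fun k => if k is 0%N then f else fun=> 0)
  (s := fun k => if k is 0%N then s else 0)).
- exact: fin_mass_cintegrable fs.
- by case=> // k; exact: fin_mass0.
- by case=> [|K]; rewrite ?big_ord0// big_ord_recl big1// addr0.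
- move=> e e0; exists 1%N => -[//|K] _.
  rewrite (_ : (fun x => _) = (fun=> 0)) ?cLnorm1_zero ?lte_fin//.
  by apply/funext => x; rewrite big_ord_recl big1// addr0 subrr.
Qed.

(** A null function is the sum of the zero series; adding it changes the representative at no
    cost. *)
Lemma mass_le0 f : cmeasurable f -> cae_eq f (fun=> 0) -> mass_le 0 f.
Proof.
move=> mf f0; have f1 : cintegrable f.
  split => //; apply: (ae_le_integrable _ (integrable0 _ _)); first exact: measurable_cabs.
  by apply: filterS f0 => x fx; rewrite /cabs fx normc_0 normr0.
apply: (mass_le_series n0 (f := fun _ => fun=> 0) (s := fun=> 0)) => //.
- by move=> k; exact: fin_mass0.
- by move=> K; rewrite big1.
- move=> e e0; exists 0%N => K _.
  under eq_fun do rewrite big1// subr0.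
  by rewrite (@eq_cLnorm1 _ _ _ (fun=> 0)) ?cLnorm1_zero ?lte_fin//.
Qed.

Lemma atomic_decomposition_lt f lam (a : nat -> Rn -> R[i]) (e : R) :
  atomic_decomposition +oo%E f lam a -> 0 < e -> exists K0, forall K, (K0 <= K)%N ->
    (cLnorm 1 (fun x => f x - \sum_(k < K) lam k * a k x)%R < e%:E)%E.
Proof. by move=> [_ _ h] e0; have [K0 _ hK] := ecvg0_lt h e0; exists K0. Qed.

Lemma sum_le_of_atomic_mass (lam : nat -> R[i]) (M : R) K :
  (atomic_mass lam <= M%:E)%E -> \sum_(k < K) nrm (lam k) <= M.
Proof.
by move=> h; rewrite -lee_fin -sumEFin; apply: le_trans h; exact: sum_le_atomic_mass.
Qed.

(** The two decompositions are merged in blocks that hold one term of each. *)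
Lemma mass_le_lin k M M' f g : mass_le M f -> mass_le M' g ->
  mass_le (nrm k * M + M') (fun x => k * f x + g x).
Proof.
move=> [f1 [lam [a [ha m]]]] [g1 [lam' [a' [ha' m']]]].
have k0 := normc_ge0 k.
have [[aa _ _] [aa' _ _]] := (ha, ha').
have ia (l : nat -> R[i]) (b : nat -> Rn -> R[i]) K : (forall j, atom +oo%E (b j)) ->
    cintegrable (fun x : Rn => \sum_(j < K) l j * b j x).
  move=> hb; apply: (@cintegrable_lincomb R n K (fun j => l j) (fun j => b j)) => j.
  exact: atom_cintegrable.
have sub1 (u v : Rn -> R[i]) : cintegrable u -> cintegrable v ->
    cintegrable (fun x => u x - v x).
  move=> iu iv; rewrite (_ : (fun _ => _) = (fun x => (-1) * v x + u x)).
    by apply: cintegrableD => //; exact: cintegrableZ.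
  by apply/funext => x; rewrite mulN1r addrC.
apply: (mass_le_series n0 (f := fun j x => k * lam j * a j x + lam' j * a' j x)
  (s := fun j => nrm (k * lam j) + nrm (lam' j))).
- by apply: cintegrableD => //; exact: cintegrableZ.
- by move=> j; apply: fin_massD; exact: fin_mass_atom.
- move=> K; rewrite big_split /=; apply: lerD; last exact: sum_le_of_atomic_mass.
  under eq_bigr do rewrite normc_M; rewrite -mulr_sumr ler_wpM2l//.
  exact: sum_le_of_atomic_mass.
- have kk0 : 0 < nrm k + 1 + 1 by rewrite ltr_wpDl// addr_ge0.
  move=> e e0; have d0 : 0 < e / (nrm k + 1 + 1) by rewrite divr_gt0.
  have [K0 h0] := atomic_decomposition_lt ha d0.
  have [K1 h1] := atomic_decomposition_lt ha' d0.
  exists (maxn K0 K1) => K; rewrite geq_max => /andP[/h0 {}h0 /h1 {}h1].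
  rewrite (_ : (fun x => _) = (fun x => k * (f x - \sum_(j < K) lam j * a j x) +
      (g x - \sum_(j < K) lam' j * a' j x))); last first.
    apply/funext => x; rewrite big_split /= mulrBr mulr_sumr opprD addrACA.
    by congr (_ - _ + _); apply: eq_bigr => j _; rewrite mulrA.
  have i1 := sub1 _ _ f1 (ia lam a K aa).
  have i2 := sub1 _ _ g1 (ia lam' a' K aa').
  apply: (le_lt_trans (cLnorm1_D (cintegrableZ k i1) i2)).
  rewrite cLnorm1_Z; last by case: i1.
  apply: (@le_lt_trans _ _ ((nrm k)%:E * (e / (nrm k + 1 + 1))%:E + (e / (nrm k + 1 + 1))%:E)%E).
    by apply: leeD; [rewrite lee_wpmul2l ?lee_fin// ltW|exact: ltW].
  rewrite -EFinM -EFinD lte_fin -[X in _ + X]mul1r -mulrDl mulrA ltr_pdivrMr//.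
  by rewrite mulrC ltr_pM2l// ltrDl.
Qed.

Lemma mass_leD M M' f g : mass_le M f -> mass_le M' g ->
  mass_le (M + M') (fun x => f x + g x).
Proof.
move=> hf hg; have := mass_le_lin 1 hf hg.
rewrite (_ : nrm 1 = 1) ?mul1r; last by rewrite (normc_real 1) normr1.
by congr mass_le; apply/funext => x; rewrite mul1r.
Qed.

Lemma mass_leB M M' f g : mass_le M f -> mass_le M' g ->
  mass_le (M + M') (fun x => f x - g x).
Proof.
move=> hf hg; have := mass_le_lin (-1) hg hf.
rewrite normc_N (_ : nrm 1 = 1) ?mul1r; last by rewrite (normc_real 1) normr1.
by rewrite addrC; congr mass_le; apply/funext => x; rewrite mulN1r addrC.
Qed.

Lemma H1_lin k f g : H1 f -> H1 g -> H1 (fun x => k * f x + g x).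
Proof.
move=> /H1_mass_le[M hf] /H1_mass_le[M' hg].
exact: mass_le_H1 (mass_le_lin k hf hg).
Qed.

(** The remaining terms decompose the remainder. Hence finite sums of (1,oo)-atoms are dense in H^1
    for the atomic norm and not only for that of L^1. *)
Lemma mass_le_tail M g e : mass_le M g -> 0 < e -> exists N lam (a : nat -> Rn -> R[i]),
  (forall j, atom +oo%E (a j)) /\ mass_le e (fun x => g x - \sum_(j < N) lam j * a j x).
Proof.
move=> [g1 [lam [a [ha m]]]] e0; have [aa _ _] := ha.
have [J hJ] := bounded_sum_tail (fun j => normc_ge0 (lam j))
  (fun N => sum_le_of_atomic_mass N m) e0.
exists J, lam, a; split => //.
have shift K (F : nat -> R[i]) :
    \sum_(k < K) F (J + k)%N = \sum_(k < J + K) F k - \sum_(k < J) F k.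
  by rewrite big_split_ord /= addrAC subrr add0r.
have ia K : cintegrable (fun x => \sum_(j < K) lam j * a j x).
  apply: (@cintegrable_lincomb R n K (fun j => lam j) (fun j => a j)) => j.
  exact: atom_cintegrable.
apply: (mass_le_series n0 (f := fun j x => lam (J + j)%N * a (J + j)%N x)
  (s := fun j => nrm (lam (J + j)%N))).
- rewrite (_ : (fun _ => _) = (fun x => (-1) * (\sum_(j < J) lam j * a j x) + g x)).
    by apply: cintegrableD => //; exact: cintegrableZ.
  by apply/funext => x; rewrite mulN1r addrC.
- by move=> k; exact: fin_mass_atom.
- move=> K; apply: ltW; have := hJ (J + K)%N J (leqnn _) (leq_addr _ _).
  rewrite -[J in \sum_(J <= _ < _) _]add0n big_addn addKn big_mkord.
  by under eq_bigr do rewrite addnC.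
- move=> d d0; have [K0 h0] := atomic_decomposition_lt ha d0.
  exists K0 => K K0K; have := h0 (J + K)%N (leq_trans K0K (leq_addl _ _)).
  congr (cLnorm 1 _ < _)%E; apply/funext => x.
  rewrite (shift K (fun k => lam k * a k x)); ring.
Qed.

End atomic_norm.

(** * Extension of operators by density *)

Section extension.
Variables (R : realType) (n : nat) (Y : completeNormedModType R[i]).
Local Notation Rn := 'rV[R]_n.
Local Notation nrm := (@ComplexField.Normc.normc R).
Hypothesis n0 : (0 < n)%N.
Implicit Types f g : Rn -> R[i].

(** Completeness of [Y], stated for the rate at which [H1_extension] approximates. *)
Lemma Ynorm_cauchy_cvg (u : nat -> Y) (C : R) :
  (forall k l, Ynorm (u k - u l) <= C * (k.+1%:R^-1 + l.+1%:R^-1)) ->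
  exists y, forall e : R, 0 < e -> exists N, forall k, (N <= k)%N ->
    Ynorm (y - u k) <= e.
Proof.
move=> hu.
have C0 : 0 <= C.
  by have := hu 0%N 0%N; rewrite subrr Ynorm_0 pmulr_lge0// addr_gt0// invr_gt0.
have small (e : R) : 0 < e -> exists N, forall k, (N <= k)%N -> C * (k.+1%:R^-1 + N.+1%:R^-1) < e.
  move=> e0; pose N := Num.trunc ((2 * C) / e).
  exists N => k Nk.
  have NE : 2 * C / e < N.+1%:R.
    have h : 0 <= 2 * C / e by rewrite divr_ge0 ?mulr_ge0// ltW.
    by have /andP[] := truncn_itv h.
  apply: (@le_lt_trans _ _ (C * (N.+1%:R^-1 + N.+1%:R^-1))).
    by rewrite ler_wpM2l// lerD2r lef_pV2 ?posrE// ler_nat.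
  rewrite -mulr2n -[_ *+ 2]mulr_natl mulrA (mulrC C) ltr_pdivrMr//.
  by rewrite [ltRHS]mulrC; move: NE; rewrite ltr_pdivrMr.
have u_cauchy : cauchy (u @ \oo).
  apply: cauchy_exP => e e0.
  have eE : e = (complex.Re e)%:C by rewrite RRe_real// ger0_real// ltW.
  have e0' : 0 < complex.Re e by rewrite -ltcR -eE.
  have [N hN] := small _ e0'; exists (u N); exists N => // k /= Nk.
  rewrite -ball_normE /= norm_YnormE eE ltcR.
  apply: le_lt_trans (hN k Nk); rewrite [X in C * X]addrC; exact: hu.
have u_cvg : cvg (u @ \oo) by exact: cauchy_cvg.
have /cvg_ex[y /cvgrPdist_lt u_y] := u_cvg.
exists y => e e0; have e0C : 0 < e%:C by rewrite ltcR.
have [N _ hN] := u_y _ e0C; exists N => k Nk.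
by have := hN k Nk; rewrite norm_YnormE ltcR => /ltW.
Qed.

Lemma H1_bound (T : (Rn -> R[i]) -> Y) (C : R) g : 0 <= C -> H1 g ->
  (forall M, mass_le M g -> Ynorm (T g) <= C * M) ->
  ((Ynorm (T g))%:E <= C%:E * H1_norm g)%E.
Proof.
move=> C0 hg bT; have [M hM] := H1_mass_le hg; have [g1 _] := hM.
have N0 : (0 <= H1_norm g)%E.
  apply: le_ereal_inf_tmp => _ [lam [a [_ ->]]].
  by apply: nneseries_ge0 => k _ _; rewrite lee_fin normc_ge0.
have fN : H1_norm g \is a fin_num.
  by rewrite ge0_fin_numE//; exact: le_lt_trans (H1_norm_le hM) (ltry _).
rewrite -(fineK fN) -EFinM lee_fin; apply/ler_addgt0Pr => e e0.
have d0 : 0 < e / (C + 1) by rewrite divr_gt0// ltr_wpDl.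
apply: (le_trans (bT (fine (H1_norm g) + e / (C + 1)) _)).
  by apply: H1_norm_lt => //; rewrite EFinD fineK// lteDl// lte_fin.
rewrite mulrDr lerD2l mulrA ler_pdivrMr ?ltr_wpDl//.
by rewrite mulrC ler_wpM2l ?lerDl// ltW.
Qed.

(** The constant [M0] of a bounded operator comes without a sign, hence the absolute value. *)
Lemma H1_bound_mass (T : (Rn -> R[i]) -> Y) (M0 : R) g M :
  ((Ynorm (T g))%:E <= M0%:E * H1_norm g)%E -> mass_le M g ->
  Ynorm (T g) <= `|M0| * M.
Proof.
move=> hT hM; rewrite -lee_fin; apply: (le_trans hT).
have N0 : (0 <= H1_norm g)%E.
  apply: le_ereal_inf_tmp => _ [lam [a [_ ->]]].
  by apply: nneseries_ge0 => k _ _; rewrite lee_fin normc_ge0.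
apply: (@le_trans _ _ (`|M0|%:E * H1_norm g)%E).
  by rewrite lee_wpmul2r// lee_fin ler_norm.
by rewrite EFinM lee_wpmul2l ?lee_fin//; exact: H1_norm_le.
Qed.

(** The value y of the extension at [g] is characterised by [Ynorm (y - T f) <= C * M] for all [f]
    in [D] such that [g - f] has mass at most [M]. Linearity, independence of the representative,
    boundedness, agreement with [T] and uniqueness are all read off from this inequality, with [f]
    close to [g], [f = 0] or [f = g]. *)
Theorem H1_extension (D : set (Rn -> R[i])) (T : (Rn -> R[i]) -> Y) (C : R) :
  csubspace D -> linear_on D T -> 0 <= C -> D `<=` @H1 R n ->
  (forall f M, D f -> mass_le M f -> Ynorm (T f) <= C * M) ->
  (forall g e, H1 g -> 0 < e -> exists2 f, D f & mass_le e (fun x => g x - f x)) ->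
  has_unique_H1_extension D T.
Proof.
move=> hD hT C0 DH bT dense.
have approx g : exists y, H1 g -> forall f M, D f ->
    mass_le M (fun x => g x - f x) -> Ynorm (y - T f) <= C * M.
  have [hg|nhg] := pselect (H1 g); last by exists 0 => /nhg.
  have /choice[phi hphi] : forall k : nat, exists f, D f /\
      mass_le k.+1%:R^-1 (fun x => g x - f x).
    move=> k; have k0 : 0 < k.+1%:R^-1 :> R by rewrite invr_gt0.
    by have [f Df hf] := dense g _ hg k0; exists f.
  have hu f M k : D f -> mass_le M (fun x => g x - f x) ->
      Ynorm (T (phi k) - T f) <= C * (k.+1%:R^-1 + M).
    have [Dk hk] := hphi k; move=> Df hf.
    rewrite -(linear_onB hT)//; apply: bT; first exact: csubspaceB.
    have := mass_leB n0 hf hk; rewrite addrC; congr mass_le.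
    by apply/funext => x; ring.
  have [y hy] := @Ynorm_cauchy_cvg (T \o phi) C (fun k l =>
    hu _ _ k (hphi l).1 (hphi l).2).
  exists y => _ f M Df hf; apply/ler_addgt0Pr => e e0.
  have d0 : 0 < e / (C + 1 + 1) by rewrite divr_gt0// !ltr_wpDl// addr_ge0.
  have [N hN] := hy _ d0.
  have [K [NK hK]] : exists K, (N <= K)%N /\ K.+1%:R^-1 <= e / (C + 1 + 1).
    exists (maxn N (Num.trunc (e / (C + 1 + 1))^-1)); split; first exact: leq_maxl.
    have i0 : 0 <= (e / (C + 1 + 1))^-1 by rewrite invr_ge0 ltW.
    have /andP[_ h] := truncn_itv i0.
    rewrite -[leRHS]invrK lef_pV2 ?posrE ?invr_gt0//.
    by apply: (le_trans (ltW h)); rewrite ler_nat ltnS leq_maxr.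
  have := hu f M K Df hf; have := hN K NK.
  have := Ynorm_D (y - T (phi K)) (T (phi K) - T f).
  rewrite addrA subrK => h1 h2 h3.
  apply: (le_trans h1); apply: (le_trans (lerD h2 h3)).
  rewrite mulrDr [X in _ + X]addrC addrCA lerD2l.
  apply: (@le_trans _ _ (e / (C + 1 + 1) + C * (e / (C + 1 + 1)))).
    by rewrite lerD2l ler_wpM2l.
  rewrite -[X in X + _]mul1r -mulrDl mulrA ler_pdivrMr ?ltr_wpDl ?addr_ge0//.
  by rewrite mulrC ler_pM2l//; lra.
have /choice[T' hT'] := approx.
have H1D f : D f -> H1 f by exact: DH.
have T'E f : D f -> T' f = T f.
  move=> Df; apply/eqP; rewrite -subr_eq0; apply/eqP; apply: Ynorm_le0.
  rewrite -(mulr0 C); apply: (hT' _ (H1D _ Df)) => //.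
  have := mass_le0 n0 (@cmeasurable0 R n) (aeW _ (fun _ => erefl)).
  by congr mass_le; apply/funext => x; rewrite subrr.
have eps (y : Y) (B : R) : 0 <= B -> (forall e, 0 < e -> Ynorm y <= B * e) -> y = 0.
  move=> B0 h; apply: Ynorm_le0; apply/ler_addgt0Pr => e e0; rewrite add0r.
  have d0 : 0 < e / (B + 1) by rewrite divr_gt0// ltr_wpDl.
  apply: (le_trans (h _ d0)); rewrite mulrA ler_pdivrMr ?ltr_wpDl//.
  by rewrite mulrC ler_wpM2l ?lerDl// ltW.
have T'lin : linear_on (@H1 R n) T'.
  move=> k f g hf hg; apply/eqP; rewrite -subr_eq0; apply/eqP.
  apply: (@eps _ (C * (nrm k + 1) + nrm k * C + C)).
    by rewrite !addr_ge0// ?mulr_ge0 ?addr_ge0 ?normc_ge0.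
  move=> e e0.
  have [f' Df' hf'] := dense f e hf e0; have [g' Dg' hg'] := dense g e hg e0.
  have h1 := hT' _ hf _ _ Df' hf'; have h2 := hT' _ hg _ _ Dg' hg'.
  have hlin := mass_le_lin n0 k hf' hg'.
  have h3 : Ynorm (T' (fun x => k * f x + g x) - T (fun x => k * f' x + g' x)) <=
      C * (nrm k * e + e).
    apply: (hT' _ (H1_lin n0 k hf hg)); first exact: hD.2.
    by move: hlin; congr mass_le; apply/funext => x; ring.
  rewrite hT// in h3.
  rewrite (_ : _ - _ = (T' (fun x => k * f x + g x) - (k *: T f' + T g')) -
    (k *: (T' f - T f') + (T' g - T g'))); last first.
    by rewrite scalerBr (addrACA (k *: T' f)) -opprD opprB addrA subrK.
  apply: (le_trans (Ynorm_B _ _)); rewrite !mulrDl.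
  rewrite -addrA; apply: lerD; first by rewrite -mulrA mulrDl mul1r; exact: h3.
  apply: (le_trans (Ynorm_D _ _)); apply: lerD => //.
  by rewrite Ynorm_Z -mulrA ler_wpM2l ?normc_ge0.
exists T'; split.
- split => //.
  + move=> f g hf hg fg; apply/eqP; rewrite -subr_eq0; apply/eqP.
    apply: (@eps _ (C + C)); first exact: addr_ge0.
    move=> e e0; have [f' Df' hf'] := dense f e hf e0.
    have hg' : mass_le e (fun x => g x - f' x).
      have [_ [[mf _] _]] := H1_mass_le hf; have [_ [[mg _] _]] := H1_mass_le hg.
      (* Functions that are equal almost everywhere have the same approximants, since their
         difference has mass 0. *)
      have z : mass_le 0 (fun x => g x - f x).
        apply: mass_le0 => //; first exact: cmeasurableB.
        by apply: filterS fg => x ->; rewrite subrr.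
      have := mass_leD n0 z hf'; rewrite add0r; congr mass_le.
      by apply/funext => x; ring.
    have h1 := hT' _ hf _ _ Df' hf'; have h2 := hT' _ hg _ _ Df' hg'.
    have := Ynorm_B (T' f - T f') (T' g - T f').
    rewrite opprB addrA subrK => h; apply: (le_trans h).
    by rewrite mulrDl lerD.
  + exists C => g hg; apply: H1_bound => // M hM.
    (* The characterisation with [f = 0]. *)
    rewrite -[T' g]subr0 -(linear_on0 hD hT); apply: hT' => //; first exact: hD.1.
    by move: hM; congr mass_le; apply/funext => x; rewrite subr0.
- by move=> f Df; split; [exact: H1D|exact: T'E].
- move=> T'' [T''lin _ [M0 T''b]] ext g hg.
  have H1sub : csubspace (@H1 R n).
    split; last by move=> k f h; exact: H1_lin.
    exact: mass_le_H1 (fin_mass_mass_le n0 (@fin_mass0 R n n0)).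
  apply/eqP; rewrite -subr_eq0; apply/eqP.
  apply: (@eps _ (`|M0| + C)); first exact: addr_ge0.
  move=> e e0; have [f Df hf] := dense g e hg e0.
  have h1 := hT' _ hg _ _ Df hf.
  have h2 : Ynorm (T'' g - T f) <= `|M0| * e.
    have [hf1 <-] := ext f Df; rewrite -(linear_onB T''lin)//.
    apply: (H1_bound_mass _ hf); apply: T''b; exact: mass_le_H1 hf.
  have := Ynorm_B (T'' g - T f) (T' g - T f).
  rewrite opprB addrA subrK => h; apply: (le_trans h).
  by rewrite mulrDl lerD.
Qed.

End extension.

(** If v > a, then v = v^(1 - q) * v^q with a negative exponent 1 - q. The inequality stands in for
    that of Hoelder: integrated over a set of known measure, with a suitable height [a], it compares
    an L^1 norm with an L^q norm. *)
Lemma powR_young (R : realType) (q a v : R) : 1 < q -> 0 < a -> 0 <= v ->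
  v <= a + a `^ (1 - q) * v `^ q.
Proof.
move=> q1 a0 v0; have [va|av] := leP v a.
  by apply: (le_trans va); rewrite lerDl mulr_ge0// powR_ge0.
have qq : 0 <= q - 1 by rewrite subr_ge0 ltW.
apply: (@le_trans _ _ (a `^ (1 - q) * v `^ q)); last by rewrite lerDr ltW.
rewrite -(mulr_powRB1 v0) ?(lt_trans _ q1)// mulrCA ler_peMr//.
rewrite -opprB powRN mulrC ler_pdivlMr ?powR_gt0// mul1r.
by apply: ge0_ler_powR; rewrite ?nnegrE// ltW.
Qed.

(** * Dyadic cubes and the Calderon-Zygmund decomposition *)

Section grid.
Variables (R : realType) (n : nat) (s : R).
Local Notation Rn := 'rV[R]_n.
Local Notation mu := (lebesgue_rV R n).
Local Notation L1 f := (mu.-integrable setT (EFin \o f)).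
Implicit Types (m : nat) (k : 'I_n -> int) (x : Rn).

Definition child k (e : {ffun 'I_n -> bool}) : 'I_n -> int := fun i => 2 * k i + (e i)%:Z.

Lemma child_inj k : injective (child k).
Proof.
move=> e e' ee; apply/ffunP => i; have := congr1 (@^~ i) ee.
by rewrite /child; case: (e i); case: (e' i) => //=; lia.
Qed.

Hypothesis s0 : 0 < s.

(* The cells of generation 0 are translates of [-s, s[^n, which is [cell 0 (fun=> 0)]. *)
Definition side m : R := 2 * s / 2 ^+ m.
Definition grid_index m (u : R) : int := Num.floor ((u + s) / side m).
Definition cell m k : set Rn := [set x | forall i, grid_index m (x ord0 i) = k i].

Lemma side_gt0 m : 0 < side m.
Proof. by rewrite divr_gt0 ?mulr_gt0// exprn_gt0. Qed.

Lemma sideS m : side m = 2 * side m.+1.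
Proof. by rewrite /side exprS; field; rewrite expf_neq0. Qed.

Lemma measurable_cell m k : measurable (cell m k).
Proof.
apply: (@measurable_rV_box R n (fun i => [set u | grid_index m u = k i])) => i.
rewrite (_ : mkset _ = `[(k i)%:~R * side m - s, (k i)%:~R * side m + side m - s[%classic).
  exact: measurable_itv.
apply/seteqP; split => u; rewrite /= in_itv/= -floor_cell ?side_gt0//.
  by move=> /eqP.
by move=> /eqP.
Qed.

Lemma lebesgue_cell m k : mu (cell m k) = (side m ^+ n)%:E.
Proof.
rewrite (@lebesgue_rV_box R n (fun i => [set u | grid_index m u = k i]) (fun=> side m)).
- by rewrite prodr_const card_ord.
- move=> i; rewrite (_ : mkset _ = `[(k i)%:~R * side m - s, (k i)%:~R * side m + side m - s[%classic).
    exact: measurable_itv.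
  apply/seteqP; split => u; rewrite /= in_itv/= -floor_cell ?side_gt0//.
    by move=> /eqP.
  by move=> /eqP.
- move=> i; rewrite -(lebesgue_floor_cell s (k i) (side_gt0 m)).
  by congr lebesgue_measure; apply/seteqP; split => u /= /eqP.
Qed.

Lemma grid_indexS m u : grid_index m.+1 u = 2 * grid_index m u \/ grid_index m.+1 u = 2 * grid_index m u + 1.
Proof.
have w0 := side_gt0 m; have w1 := side_gt0 m.+1; have wS := sideS m.
have : grid_index m u == grid_index m u by [].
rewrite {1}/grid_index floor_cell// => /andP[h1 h2].
have : grid_index m.+1 u == grid_index m.+1 u by [].
rewrite {1}/grid_index floor_cell// => /andP[h3 h4].
set a := grid_index m u in h1 h2 *; set b := grid_index m.+1 u in h3 h4 *.
rewrite wS in h1 h2.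
have l1 : (2 * a)%:~R * side m.+1 < (b + 1)%:~R * side m.+1 by rewrite intrM intrD; lra.
have l2 : b%:~R * side m.+1 < (2 * a + 2)%:~R * side m.+1 by rewrite intrD intrM; lra.
move: l1 l2; rewrite !ltr_pM2r// !ltr_int; lia.
Qed.

Lemma cell_child m k e : cell m.+1 (child k e) `<=` cell m k.
Proof.
move=> x h i; have := h i; rewrite /child.
by case: (grid_indexS m (x ord0 i)) => ->; case: (e i) => /=; lia.
Qed.

Lemma cell_split m k x : cell m k x -> exists e, cell m.+1 (child k e) x.
Proof.
move=> h; exists [ffun i => grid_index m.+1 (x ord0 i) == 2 * k i + 1] => i.
rewrite /child ffunE -(h i); case: eqP => [->//|].
by case: (grid_indexS m (x ord0 i)) => [->|->//]; rewrite addr0.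
Qed.

Lemma indic_child m k x :
  \1_(cell m k) x = \sum_e \1_(cell m.+1 (child k e)) x :> R.
Proof.
have [xk|nxk] := pselect (cell m k x).
  have [e xe] := cell_split xk.
  rewrite (bigD1 e)//= !indicE !mem_set// big1 ?addr0// => e' e'e.
  rewrite indicE memNset// => xe'; move/eqP: e'e; apply.
  by apply: (@child_inj k); apply/funext => i; rewrite -xe -xe'.
rewrite indicE memNset// big1// => e _; rewrite indicE memNset// => xe.
by apply: nxk; exact: cell_child xe.
Qed.

(** The cube is centred at a corner of the cell, which doubles the radius. *)
Lemma cell_sub_cube m k : cell m k `<=` cube (\row_i ((k i)%:~R * side m - s)) (side m).
Proof.
move=> x h i; have := h i; rewrite mxE => /eqP.
rewrite floor_cell ?side_gt0// => /andP[h1 h2].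
by rewrite ger0_norm; lra.
Qed.

Lemma integrable_cell (f : Rn -> R) (B : R) m k : measurable_fun setT f ->
  (forall x, `|f x| <= B) -> L1 (fun x => f x * \1_(cell m k) x).
Proof.
move=> mf fB; apply: (integrable_bounded_mul mf fB).
apply: integrable_indic_lty; first exact: measurable_cell.
by rewrite [X in (X < _)%E]lebesgue_cell ltry.
Qed.

Lemma Rintegral_cell m k : \int[mu]_x \1_(cell m k) x = side m ^+ n :> R.
Proof. by rewrite Rintegral_indic; [exact: (congr1 fine (lebesgue_cell m k))|exact: measurable_cell]. Qed.

Lemma integrable_indic_cell m k : L1 (\1_(cell m k) : Rn -> R).
Proof.
apply: integrable_indic_lty; first exact: measurable_cell.
by rewrite [X in (X < _)%E]lebesgue_cell ltry.
Qed.

End grid.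

Lemma Rintegral_sum d (T : measurableType d) (R : realType)
    (mu : {measure set T -> \bar R}) (I : Type) (r : seq I) (f : I -> T -> R) :
  (forall i, mu.-integrable setT (EFin \o f i)) ->
  \int[mu]_x (\sum_(i <- r) f i x) = \sum_(i <- r) \int[mu]_x f i x.
Proof.
move=> fi; suff [] : mu.-integrable setT (EFin \o (fun x => \sum_(i <- r) f i x)) /\
    \int[mu]_x (\sum_(i <- r) f i x) = \sum_(i <- r) \int[mu]_x f i x by [].
elim: r => [|i r [IH1 IH2]].
  rewrite big_nil (_ : (fun x => _) = cst 0); last by apply/funext => x; rewrite big_nil.
  by split; [exact: integrable0|rewrite Rintegral_cst// mul0r].
rewrite big_cons (_ : (fun x => _) = (fun x => f i x + \sum_(j <- r) f j x)).
  by split; [exact: integrable_EFinD|rewrite RintegralD// IH2].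
by apply/funext => x; rewrite big_cons.
Qed.

Section calderon_zygmund.
Variables (R : realType) (n : nat) (s : R).
Local Notation Rn := 'rV[R]_n.
Local Notation mu := (lebesgue_rV R n).
Local Notation L1 f := (mu.-integrable setT (EFin \o f)).
Local Notation nrm := (@ComplexField.Normc.normc R).
Hypotheses (n0 : (0 < n)%N) (s0 : 0 < s).
Implicit Types (m : nat) (k : 'I_n -> int) (x : Rn) (f g b : Rn -> R).
Local Notation side := (side s).
Local Notation cell := (@cell R n s).

Definition toC f : Rn -> R[i] := fun x => (f x)%:C.

Lemma cmeasurable_toC f : measurable_fun setT f -> cmeasurable (toC f).
Proof. by move=> mf; split => //=; exact: measurable_cst. Qed.

Lemma cintegral_toC f : cintegral (toC f) = (\int[mu]_x f x)%:C.
Proof. by rewrite /cintegral /= Rintegral_cst// mul0r. Qed.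

Lemma cabs_toC f x : cabs (toC f) x = `|f x|.
Proof. by rewrite /cabs normc_real. Qed.

Lemma fin_mass_cube (h : Rn -> R[i]) c r M : 0 < r -> 0 < M -> cmeasurable h ->
  (forall x, ~ cube c r x -> h x = 0) -> cintegral h = 0 ->
  (forall x, cabs h x <= M) -> fin_mass (M * (2 * (n%:R * r)) ^+ n) h.
Proof.
move=> r0 M0 mh h0 ih hM; have [N0 _ ha _] := cube_atom n0 r0 M0 mh h0 ih hM.
set N := M * _ in N0 ha *.
have := fin_mass_atom N%:C ha; rewrite normc_real ger0_norm ?(ltW N0)//.
congr fin_mass; apply/funext => x; rewrite mulrA -rmorphM /= divff ?mul1r//.
by rewrite gt_eqF.
Qed.

Lemma fin_mass_cell f m k M : 0 < M -> measurable_fun setT f ->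
  (forall x, ~ cell m k x -> f x = 0) -> \int[mu]_x f x = 0 ->
  (forall x, `|f x| <= M) -> fin_mass (M * (2 * (n%:R * side m)) ^+ n) (toC f).
Proof.
move=> M0 mf f0 if0 fM.
apply: (@fin_mass_cube _ (\row_i ((k i)%:~R * side m - s))) => //.
- exact: side_gt0.
- move=> x nx; rewrite /toC f0// => xc; apply: nx; exact: cell_sub_cube xc.
- by rewrite cintegral_toC if0.
- by move=> x; rewrite cabs_toC.
Qed.

Lemma fin_mass_Rintegral0 S b : fin_mass S (toC b) -> \int[mu]_x b x = 0.
Proof.
move=> [N [lam [a [ha hb _]]]].
have : cintegral (toC b) = 0.
  rewrite hb; apply: (@cintegral_lincomb0 _ _ N (fun j => lam j) (fun j => a j)) => j.
    exact: atom_cintegrable.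
  by have [c [r []]] := atom_oo_ae n0 (ha j).
by rewrite cintegral_toC => -[].
Qed.

Variables (q : R) (f : Rn -> R) (B : R) (M : nat).
Hypotheses (q1 : 1 < q) (mf : measurable_fun setT f) (fB : forall x, `|f x| <= B).
(** This stops the recursion on generations at [M], so that the decomposition is a finite sum of
    atoms. *)
Hypothesis f_step : forall k x y, cell M k x -> cell M k y -> f x = f y.

Definition qmass m k : R := \int[mu]_x (`|f x| `^ q * \1_(cell m k) x).

Let q0 : 0 < q. Proof. exact: lt_trans q1. Qed.

Let mfq : measurable_fun setT (fun x => `|f x| `^ q).
Proof.
by apply: (measurableT_comp (@measurable_powR R q)); exact: measurableT_comp.
Qed.

Let fqB x : `| `|f x| `^ q| <= B `^ q.
Proof.
rewrite ger0_norm ?powR_ge0//; apply: ge0_ler_powR; rewrite ?nnegrE// ?(ltW q0)//.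
exact: le_trans (fB x).
Qed.

Let iq m k : L1 (fun x => `|f x| `^ q * \1_(cell m k) x).
Proof. exact: (integrable_cell s0 m k mfq fqB). Qed.

Lemma qmass_ge0 m k : 0 <= qmass m k.
Proof. by apply: Rintegral_ge0 => x _; rewrite mulr_ge0// powR_ge0. Qed.

Lemma qmass_child m k : qmass m k = \sum_e qmass m.+1 (child k e).
Proof.
rewrite /qmass -Rintegral_sum//; apply: eq_Rintegral => x _.
by rewrite (indic_child s0) mulr_sumr.
Qed.

Let integrable_stepf m k : L1 (fun x => f x * \1_(cell m k) x).
Proof. exact: (integrable_cell s0 m k mf fB). Qed.

(** [powR_young] at height [a], integrated over the cell: each of its two terms contributes at most
    [a] times the volume. *)
Let norm_mean m k a : 0 < a -> qmass m k <= a `^ q * side m ^+ n ->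
  `|\int[mu]_x (f x * \1_(cell m k) x)| <= 2 * a * side m ^+ n.
Proof.
move=> a0 hm.
have icell := integrable_indic_cell s0 m k.
apply: (@le_trans _ _ (\int[mu]_x (a * \1_(cell m k) x +
    a `^ (1 - q) * (`|f x| `^ q * \1_(cell m k) x)))).
  apply: norm_Rintegral_le.
  - exact: (integrable_measurable (integrable_stepf m k)).
  - by apply: integrable_EFinD; exact: integrable_EFinZ.
  - apply: aeW => x; rewrite normrM (ger0_norm (_ : 0 <= \1_(cell m k) x))//.
    by rewrite mulrA -mulrDl ler_wpM2r// powR_young.
rewrite RintegralD//; [|exact: integrable_EFinZ|exact: integrable_EFinZ].
rewrite !RintegralZl// Rintegral_cell//.
have : a `^ (1 - q) * qmass m k <= a * side m ^+ n.
  apply: (@le_trans _ _ (a `^ (1 - q) * (a `^ q * side m ^+ n))).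
    by rewrite ler_wpM2l// powR_ge0.
  rewrite mulrA -powRD; last by apply/implyP => _; rewrite gt_eqF.
  by rewrite subrK powRr1// ltW.
rewrite /qmass; lra.
Qed.

(** The ratio of the volumes of a cell and a child. Raising the height by this factor lets the bound
    on the integral of |f|^q over a cell pass to each child, since q > 1. *)
Definition cz_growth : R := 2 ^+ n.
(** The solution C of C = C * G^(1 - q) + 4 * G^2 * (2 * n)^n with G = [cz_growth], that is, the sum
    of the geometric series of the costs at successive heights; it converges because q > 1. *)
Definition cz_const : R :=
  (cz_growth ^+ 2 * 4 * (2 * n%:R) ^+ n) / (1 - cz_growth `^ (1 - q)).

Let growth1 : 1 < cz_growth.
Proof. by rewrite /cz_growth exprn_egt1 ?ltr1n// -lt0n. Qed.

Let growth0 : 0 < cz_growth. Proof. exact: lt_trans growth1. Qed.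

Let growth_q : cz_growth `^ (1 - q) < 1.
Proof.
rewrite -opprB powRN invf_lt1 ?powR_gt0//.
apply: (@le_lt_trans _ _ (1 `^ (q - 1))); first by rewrite powR1.
apply: gt0_ltr_powR; rewrite ?nnegrE ?subr_gt0//; exact: ltW.
Qed.

Lemma cz_const_gt0 : 0 < cz_const.
Proof.
rewrite divr_gt0 ?subr_gt0// !mulr_gt0 ?exprn_gt0//.
by rewrite mulr_gt0// ltr0n.
Qed.

Let measurable_indic_cell m k : measurable_fun setT (\1_(cell m k) : Rn -> R).
Proof. by apply: measurable_indic; exact: measurable_cell. Qed.

(* Induction on the number of generations below the cell. If a child carries
   too much of |f|^q, decompose it at the height multiplied by [cz_growth] and
   trade the bounded part for its mean: the difference is an atom whose mass
   [cz_growth ^+ 2 * 4 * (2 * n) ^+ n * a * |child|] is paid by the child. *)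
Lemma calderon_zygmund_cell j m k a : (m + j)%N = M -> 0 < a ->
  qmass m k <= a `^ q * side m ^+ n ->
  exists g b, [/\ measurable_fun setT g /\ measurable_fun setT b,
    forall x, f x * \1_(cell m k) x = g x + b x,
    forall x, ~ cell m k x -> g x = 0,
    forall x, `|g x| <= 2 * cz_growth * a
    & fin_mass (cz_const * a `^ (1 - q) * qmass m k) (toC b)].
Proof.
elim: j m k a => [|j IH] m k a.
  (* On a cell of the last generation [f] is constant, so the bound on the integral of |f|^q is a
     pointwise one and nothing has to be split off. *)
  rewrite addn0 => -> a0 hm.
  exists (fun x => f x * \1_(cell M k) x), (fun=> 0); split.
  - split; last exact: measurable_cst.
    exact: (integrable_measurable (integrable_stepf M k)).
  - by move=> x; rewrite addr0.
  - by move=> x nx; rewrite indicE memNset// mulr0.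
  - move=> x; rewrite indicE; have [xk|nxk] := pselect (cell M k x); last first.
      by rewrite memNset// mulr0 normr0 !mulr_ge0// ltW.
    rewrite mem_set// mulr1; apply: (@le_trans _ _ a); last first.
      by rewrite ler_peMl ?(ltW a0)//; have := growth1; lra.
    have : `|f x| `^ q * side M ^+ n <= a `^ q * side M ^+ n.
      apply: le_trans hm; rewrite -(Rintegral_cell s0 M k) -RintegralZl//; last first.
        exact: integrable_indic_cell.
      apply: le_Rintegral => //; first by apply: integrable_EFinZ; exact: integrable_indic_cell.
      move=> y _; rewrite !indicE; have [yk|nyk] := pselect (cell M k y).
        by rewrite (f_step xk yk).
      by rewrite memNset// !mulr0.
    rewrite ler_pM2r ?exprn_gt0 ?side_gt0// => h.
    rewrite leNgt; apply/negP => h'; move: h; apply/negP; rewrite -ltNge.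
    by apply: gt0_ltr_powR; rewrite ?nnegrE// ltW.
  - apply: (@fin_mass_le _ _ 0); last exact: (@fin_mass0 R n n0).
    by rewrite mulr_ge0 ?qmass_ge0// mulr_ge0 ?powR_ge0// (ltW cz_const_gt0).
move=> mjM a0 hm.
have mjM' : (m.+1 + j)%N = M by rewrite -mjM addSnnS.
have sS : side m ^+ n = cz_growth * side m.+1 ^+ n by rewrite sideS exprMn.
have child_case (e : {ffun 'I_n -> bool}) : exists g b,
  [/\ measurable_fun setT g /\ measurable_fun setT b,
    forall x, f x * \1_(cell m.+1 (child k e)) x = g x + b x,
    forall x, ~ cell m.+1 (child k e) x -> g x = 0,
    forall x, `|g x| <= 2 * cz_growth * a
    & fin_mass (cz_const * a `^ (1 - q) * qmass m.+1 (child k e)) (toC b)].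
  set k' := child k e; set I := qmass m.+1 k'.
  (* A light child is decomposed at the same height. A heavy one satisfies the hypothesis at height
     [cz_growth * a]: the volume drops by the factor [cz_growth], which is at most its own q-th
     power. *)
  have [small|big] := leP I (a `^ q * side m.+1 ^+ n); first exact: IH.
  have Im : I <= qmass m k.
    rewrite qmass_child (bigD1 e)//= lerDl sumr_ge0// => *; exact: qmass_ge0.
  pose a' := cz_growth * a.
  have a'0 : 0 < a' by rewrite mulr_gt0.
  have Ia' : I <= a' `^ q * side m.+1 ^+ n.
    apply: (le_trans Im); apply: (le_trans hm).
    rewrite sS mulrA ler_wpM2r ?exprn_ge0 ?(ltW (side_gt0 s0 _))//.
    rewrite powRM ?(ltW growth0) ?(ltW a0)// mulrC ler_wpM2r ?powR_ge0//.
    by apply: le1r_powR; exact: ltW.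
  have [g [b [[mg mb] fgb g0 gB hb]]] := IH _ k' _ mjM' a'0 Ia'.
  have b1 : L1 b.
    by have /fin_mass_cintegrable-/(_ n0)/cintegrableP[] := hb.
  have f1 := integrable_stepf m.+1 k'.
  have g1 : L1 g.
    have := integrable_EFinB f1 b1; apply: eq_integrable => // x _ /=.
    by rewrite fgb addrK.
  pose w := side m.+1 ^+ n.
  have w0 : 0 < w by rewrite exprn_gt0// side_gt0.
  pose c := (\int[mu]_x g x) / w.
  have ig : \int[mu]_x g x = \int[mu]_x (f x * \1_(cell m.+1 k') x).
    under [RHS]eq_Rintegral do rewrite fgb.
    by rewrite RintegralD// (fin_mass_Rintegral0 hb) addr0.
  (* [b] has mean zero, so [c] is the mean of [f] over the child. The resulting [2 * cz_growth * a]
     is the bound required at the original height: passing to the mean resets the height, which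
     would otherwise grow with the depth. *)
  have cB : `|c| <= 2 * a'.
    rewrite normrM normfV (gtr0_norm w0) ler_pdivrMr// ig.
    exact: norm_mean.
  exists (fun x => c * \1_(cell m.+1 k') x).
  exists (fun x => b x + (g x - c * \1_(cell m.+1 k') x)); split.
  - split; first exact: measurable_funM.
    by apply: measurable_funD => //; apply: measurable_funB => //; exact: measurable_funM.
  - by move=> x; rewrite fgb; ring.
  - by move=> x nx; rewrite indicE memNset// mulr0.
  - move=> x; rewrite normrM indicE -[leRHS]mulr1 -[in leRHS](mulrA 2).
    by apply: ler_pM => //; case: (_ \in _); rewrite ?normr1 ?normr0.
  have h2 : fin_mass ((2 * cz_growth * a' + 2 * a') * (2 * (n%:R * side m.+1)) ^+ n)
      (toC (fun x => g x - c * \1_(cell m.+1 k') x)).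
    apply: (@fin_mass_cell _ _ k').
    - by rewrite addr_gt0// !mulr_gt0.
    - by apply: measurable_funB => //; exact: measurable_funM.
    - by move=> x nx; rewrite g0// indicE memNset// mulr0 subrr.
    - rewrite RintegralB//; last by apply: integrable_EFinZ; exact: integrable_indic_cell.
      rewrite RintegralZl//; last exact: integrable_indic_cell.
      by rewrite Rintegral_cell// /c divfK ?subrr// gt_eqF.
    - move=> x; apply: (le_trans (ler_normB _ _)); apply: lerD; first exact: gB.
      rewrite normrM indicE -[leRHS]mulr1; apply: ler_pM => //.
      by case: (_ \in _); rewrite ?normr1 ?normr0.
  have := fin_massD hb h2.
  rewrite (_ : (fun x => toC b x + _) = toC (fun x => b x + (g x - c * \1_(cell m.+1 k') x))); last first.
    by apply/funext => x; rewrite /toC [RHS]rmorphD.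
  apply: fin_mass_le.
  (* With G = [cz_growth] the difference of [g] and its mean is at most 2 G a' + 2 a' <= 4 G^2 a.
     Since the child is heavy, a times its volume is at most a^(1 - q) times [I]. *)
  have K1 : (2 * cz_growth * a' + 2 * a') * (2 * (n%:R * side m.+1)) ^+ n <=
      cz_growth ^+ 2 * 4 * (2 * n%:R) ^+ n * (a `^ (1 - q) * I).
    apply: (@le_trans _ _ (cz_growth ^+ 2 * 4 * (2 * n%:R) ^+ n * (a * w))).
      have -> : (2 * (n%:R * side m.+1)) ^+ n = (2 * n%:R) ^+ n * w by rewrite mulrA exprMn.
      rewrite (_ : _ * (a * w) = cz_growth ^+ 2 * 4 * a * ((2 * n%:R) ^+ n * w)); last by ring.
      apply: ler_wpM2r; first by rewrite mulr_ge0 ?exprn_ge0 ?mulr_ge0// ltW.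
      have G1 : 1 <= cz_growth by exact: ltW.
      have : cz_growth * a <= cz_growth ^+ 2 * a.
        by rewrite ler_wpM2r ?(ltW a0)// expr2 ler_peMr ?(ltW growth0).
      rewrite /a'; lra.
    rewrite ler_wpM2l ?mulr_ge0 ?exprn_ge0 ?mulr_ge0// ?(ltW growth0)//.
    apply: (@le_trans _ _ (a `^ (1 - q) * (a `^ q * w))); last first.
      by rewrite ler_wpM2l ?powR_ge0// ltW.
    rewrite mulrA -powRD; last by apply/implyP => _; rewrite gt_eqF.
    by rewrite subrK powRr1// ltW.
  apply: (le_trans (lerD (lexx _) K1)).
  (* This is the equation that defines [cz_const]: the part obtained at height [a'] carries the
     additional factor G^(1 - q). *)
  rewrite /a' powRM ?(ltW growth0) ?(ltW a0)//.
  rewrite -/I le_eqVlt; apply/orP; left; apply/eqP; rewrite /cz_const; field.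
  by rewrite gt_eqF// subr_gt0.
have /choice[g /choice[b h]] := child_case.
exists (fun x => \sum_e g e x), (fun x => \sum_e b e x); split.
- by split; apply: measurable_sum => e; case: (h e) => -[].
- move=> x; rewrite (indic_child s0) mulr_sumr -big_split /=.
  by apply: eq_bigr => e _; case: (h e).
- move=> x nx; rewrite big1// => e _; case: (h e) => _ _ g0 _ _; apply: g0 => xe.
  by apply: nx; exact: cell_child xe.
- move=> x; have [xk|nxk] := pselect (cell m k x); last first.
    rewrite big1 ?normr0 ?mulr_ge0 ?(ltW a0) ?(ltW growth0)// => e _.
    by case: (h e) => _ _ g0 _ _; apply: g0 => xe; apply: nxk; exact: cell_child xe.
  have [e xe] := cell_split s0 xk.
  rewrite (bigD1 e)//= big1 ?addr0; first by case: (h e).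
  move=> e' e'e; case: (h e') => _ _ g0 _ _; apply: g0 => xe'.
  move/eqP: e'e; apply; apply: (@child_inj n k); apply/funext => i.
  by rewrite -xe -xe'.
(* The integrals of |f|^q over the children add up, and so do the masses. *)
- rewrite qmass_child mulr_sumr (_ : toC _ = (fun x => \sum_e toC (b e) x)).
    by apply: fin_mass_sum => // e; case: (h e).
  by apply/funext => x; rewrite /toC raddf_sum.
Qed.

End calderon_zygmund.

(** * Dyadic averages as conditional expectations *)

Section dyadic_expectation.
Variables (R : realType) (n : nat) (s q : R).
Local Notation Rn := 'rV[R]_n.
Local Notation mu := (lebesgue_rV R n).
Local Notation L1 f := (mu.-integrable setT (EFin \o f)).
Hypotheses (s0 : 0 < s) (q1 : 1 < q).
Implicit Types (m : nat) (k : 'I_n -> int) (x y : Rn) (f g h : Rn -> R).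
Local Notation side := (side s).
Local Notation cell := (@cell R n s).
Local Notation Q0 := (cell 0 (fun=> 0)).

Let q0 : 0 < q. Proof. exact: lt_trans q1. Qed.

Lemma cell0P x : Q0 x <-> forall i, - s <= x ord0 i < s.
Proof.
have w : side 0 = 2 * s by rewrite /side expr0 divr1.
have sP u : (grid_index s 0 u = 0) <-> (- s <= u < s).
  have -> : (- s <= u < s) = (grid_index s 0 u == 0).
    rewrite /grid_index floor_cell ?side_gt0// w mul0r.
    by congr (_ && _); [congr (_ <= _); ring|congr (_ < _); ring].
  by split => [->//|/eqP].
by split=> h i; apply/sP; exact: h.
Qed.

(** The q-th power of the L^q norm avoids roots of extended reals; the price is the factor 2^q in
    the triangle inequality [Iq_D]. *)
Definition Iq f : \bar R := (\int[mu]_x (`|f x| `^ q)%:E)%E.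

Lemma measurable_powRnorm f : measurable_fun setT f ->
  measurable_fun setT (fun x => `|f x| `^ q).
Proof.
move=> mf; apply: (measurableT_comp (@measurable_powR R q)).
exact: measurableT_comp.
Qed.

Lemma Iq_ge0 f : (0 <= Iq f)%E.
Proof. by apply: integral_ge0 => x _; rewrite lee_fin powR_ge0. Qed.

Lemma powR_normD (u v : R) : `|u + v| `^ q <= 2 `^ q * (`|u| `^ q + `|v| `^ q).
Proof.
wlog uv : u v / `|u| <= `|v|.
  by move=> h; have [/h//|/ltW/h] := leP `|u| `|v|; rewrite addrC (addrC (`|v| `^ q)).
apply: (@le_trans _ _ ((2 * `|v|) `^ q)).
  apply: ge0_ler_powR; rewrite ?nnegrE ?mulr_ge0// ?(ltW q0)//.
  by apply: (le_trans (ler_normD _ _)); lra.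
by rewrite powRM// ler_wpM2l ?powR_ge0// lerDr powR_ge0.
Qed.

Lemma Iq_D f g : measurable_fun setT f -> measurable_fun setT g ->
  (Iq (fun x => f x + g x)%R <= (2 `^ q)%:E * (Iq f + Iq g))%E.
Proof.
move=> mf mg; have mfq := measurable_powRnorm mf; have mgq := measurable_powRnorm mg.
rewrite /Iq -ge0_integralD//; try exact/measurable_EFinP.
rewrite -ge0_integralZl//; try (by apply: emeasurable_funD; exact/measurable_EFinP);
  try (by move=> x _; rewrite -EFinD lee_fin addr_ge0 ?powR_ge0).
apply: ge0_le_integral => //.
- by apply/measurable_EFinP; apply: measurable_powRnorm; exact: measurable_funD.
- apply/measurable_EFinP => /=; apply: measurable_funM => //.
  exact: measurable_funD.
- by move=> x _; rewrite -EFinD -EFinM lee_fin powR_normD.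
Qed.

Lemma Iq_N f : Iq (fun x => - f x) = Iq f.
Proof. by apply: eq_integral => x _; rewrite normrN. Qed.

Lemma Iq_B f g : measurable_fun setT f -> measurable_fun setT g ->
  (Iq (fun x => f x - g x)%R <= (2 `^ q)%:E * (Iq f + Iq g))%E.
Proof.
move=> mf mg; rewrite -(Iq_N g); apply: Iq_D => //.
exact: measurable_funN.
Qed.

Lemma Iq_Z (a : R) f : measurable_fun setT f ->
  Iq (fun x => a * f x) = ((`|a| `^ q)%:E * Iq f)%E.
Proof.
move=> mf; rewrite /Iq -ge0_integralZl//.
- by apply: eq_integral => x _; rewrite normrM powRM// EFinM.
- by apply/measurable_EFinP; exact: measurable_powRnorm.
Qed.

Lemma Iq_integrable f : measurable_fun setT f -> (Iq f < +oo)%E ->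
  L1 (fun x => `|f x| `^ q).
Proof.
move=> mf If; apply/integrableP; split; first by apply/measurable_EFinP; apply: measurable_powRnorm.
by under eq_integral do rewrite /= ger0_norm ?powR_ge0//.
Qed.

Definition supported f : Prop := {ae mu, forall x, ~ Q0 x -> f x = 0}.

Lemma Lq_integrable f : measurable_fun setT f -> supported f ->
  (Iq f < +oo)%E -> L1 f.
Proof.
move=> mf f0 If.
apply: (@ae_le_integrable _ _ _ _ _ (fun x => 1 * \1_Q0 x + 1 `^ (1 - q) * (`|f x| `^ q))) => //.
  apply: integrable_EFinD; apply: integrable_EFinZ.
    exact: integrable_indic_cell.
  exact: Iq_integrable.
apply: filterS f0 => x f0; rewrite indicE; have [xQ|nxQ] := pselect (Q0 x).
  by rewrite mem_set// mulr1; exact: powR_young.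
by rewrite f0// normr0 memNset// mulr0 add0r mulr_ge0// powR_ge0.
Qed.

(** Defined through folding so that the results on [fold_mollify] apply; on functions supported in
    [Q0] folding changes nothing, and [dyadicE] gives the average over a cell. *)
Definition dyadic m f : Rn -> R := fold_mollify s (grid_kernel s (side m)) f.

Let mollif m : mollifier (side m) (grid_kernel s (side m)).
Proof. by apply: mollifier_grid; exact: side_gt0. Qed.

Definition cell_of m x : 'I_n -> int := fun i => grid_index s m (x ord0 i).

Lemma dyadic_kernelE m x y : Q0 y ->
  fold_kernel s (grid_kernel s (side m)) x y =
  (side m)^-1 ^+ n * \1_(cell m (cell_of m x)) y.
Proof.
move=> /cell0P yQ; rewrite /fold_kernel /grid_kernel big_split /= prodr_const card_ord.
congr (_ * _).
have fy i : fold s (y ord0 i) = y ord0 i.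
  by apply: fold_id => //; have /andP[-> /ltW ->] := yQ i.
rewrite indicE; have [yc|nyc] := pselect (cell m (cell_of m x) y).
  rewrite mem_set// big1// => i _; rewrite fy.
  by rewrite -/(grid_index s m (x ord0 i)) -/(grid_index s m (y ord0 i)) yc eqxx.
rewrite memNset//; apply/eqP; rewrite prodf_seq_eq0; apply/hasP.
have /existsNP[j hj] := nyc.
exists j; rewrite ?mem_index_enum//= fy -/(grid_index s m (x ord0 j)) -/(grid_index s m (y ord0 j)).
have /negbTE -> : grid_index s m (x ord0 j) != grid_index s m (y ord0 j); last by [].
by apply/eqP => e; apply: hj; rewrite -e.
Qed.

Lemma dyadicE m f x : L1 f -> supported f ->
  dyadic m f x = (side m)^-1 ^+ n * \int[mu]_y (f y * \1_(cell m (cell_of m x)) y).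
Proof.
move=> f1 f0; have mf := integrable_measurable f1.
have mc : measurable_fun setT (\1_(cell m (cell_of m x)) : Rn -> R).
  by apply: measurable_indic; exact: measurable_cell.
have fc1 : L1 (fun y => f y * \1_(cell m (cell_of m x)) y).
  have : L1 (fun y => \1_(cell m (cell_of m x)) y * f y).
    apply: (@integrable_bounded_mul _ _ _ _ _ 1) => // y.
    by rewrite indicE; case: (_ \in _); rewrite ?normr1 ?normr0.
  by apply: eq_integrable => // y _ /=; rewrite mulrC.
rewrite -RintegralZl// /dyadic /fold_mollify; apply: eq_ae_Rintegral.
- by apply: integrable_measurable; exact: (integrable_kernel_mul s0 (mollif m)).
- by apply: measurable_funM => //; exact: measurable_funM.
- apply: filterS f0 => y f0; have [yQ|nyQ] := pselect (Q0 y).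
    by rewrite dyadic_kernelE// mulrAC -mulrA.
  by rewrite f0// mulr0 mul0r mulr0.
Qed.

Lemma dyadic_step m f k x y : L1 f -> supported f -> cell m k x -> cell m k y ->
  dyadic m f x = dyadic m f y.
Proof.
move=> f1 f0 xk yk; rewrite !dyadicE//; congr (_ * _).
suff -> : cell_of m x = cell_of m y by [].
by apply/funext => i; rewrite /cell_of xk yk.
Qed.

Lemma cell_nest m k x y : cell m k x -> cell m k y -> Q0 x -> Q0 y.
Proof.
suff h m' : forall k' x y, cell m' k' x -> cell m' k' y -> forall k0, cell 0 k0 x -> cell 0 k0 y.
  by move=> /h/[apply]/[apply].
elim: m' => [|m' IH] k' x' y' hx hy k0 hk0.
  by move=> i; rewrite hy -(hx i) hk0.
apply: IH hk0; first by move=> i; exact: erefl.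
move=> i; have := grid_indexS s0 m' (x' ord0 i); have := grid_indexS s0 m' (y' ord0 i).
rewrite (hx i) (hy i); clear q0 q1; lia.
Qed.

Lemma cell_nestS m m' x y : (m <= m')%N ->
  cell_of m' x =1 cell_of m' y -> cell_of m x =1 cell_of m y.
Proof.
move=> /subnKC <-; elim: (m' - m)%N => [|d IH]; first by rewrite addn0.
rewrite addnS => h; apply: IH => i; have := h i; rewrite /cell_of => hi.
have := grid_indexS s0 (m + d) (x ord0 i); have := grid_indexS s0 (m + d) (y ord0 i).
rewrite hi; clear q0 q1; lia.
Qed.

Lemma dyadic_support m f x : L1 f -> supported f -> ~ Q0 x -> dyadic m f x = 0.
Proof.
move=> f1 f0 nx; rewrite dyadicE//.
rewrite (@eq_ae_Rintegral _ _ _ _ _ (cst 0)) ?Rintegral_cst ?mul0r ?mulr0//.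
  apply: measurable_funM; first exact: (integrable_measurable f1).
  by apply: measurable_indic; exact: measurable_cell.
apply: filterS f0 => y f0; rewrite indicE; have [yQ|nyQ] := pselect (Q0 y); last first.
  by rewrite f0// mul0r.
rewrite memNset ?mulr0// => yc; apply: nx; apply: (cell_nest yc _ yQ).
by move=> i.
Qed.

Lemma integrable_dyadic m f : L1 f -> L1 (dyadic m f).
Proof. exact: (integrable_fold_mollify s0 (mollif m)). Qed.

Lemma Rintegral_dyadic m f : L1 f -> \int[mu]_x dyadic m f x = \int[mu]_x f x.
Proof. exact: (Rintegral_fold_mollify s0 (mollif m)). Qed.

Lemma dyadic_bounded m f : L1 f -> exists B, forall x, `|dyadic m f x| <= B.
Proof.
move=> f1; exists ((side m)^-1 ^+ n * \int[mu]_y `|f y|) => x.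
exact: (norm_fold_mollify_le s0 (mollif m)).
Qed.

Lemma supported_powRnorm f : supported f -> supported (fun x => `|f x| `^ q).
Proof. by apply: filterS => x h nx; rewrite h// normr0 powR0// gt_eqF. Qed.

(** Jensen's inequality up to the factor 2^q, from [powR_young] at the height A^(1/q), where its two
    terms have equal averages. *)
Lemma dyadic_powR_le m f x : measurable_fun setT f -> supported f -> (Iq f < +oo)%E ->
  `|dyadic m f x| `^ q <= 2 `^ q * dyadic m (fun x => `|f x| `^ q) x.
Proof.
move=> mf f0 If; have f1 := Lq_integrable mf f0 If.
have fq1 := Iq_integrable mf If.
have fq0 := supported_powRnorm f0.
set c := cell m (cell_of m x); set A := dyadic m (fun x => `|f x| `^ q) x.
have wn0 : 0 <= (side m)^-1 ^+ n by rewrite exprn_ge0// invr_ge0 ltW// side_gt0.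
have mc : measurable_fun setT (\1_c : Rn -> R).
  by apply: measurable_indic; exact: measurable_cell.
have fqc1 : L1 (fun y => `|f y| `^ q * \1_c y).
  have : L1 (fun y => \1_c y * `|f y| `^ q).
    apply: (@integrable_bounded_mul _ _ _ _ _ 1) => // y.
    by rewrite indicE; case: (_ \in _); rewrite ?normr1 ?normr0.
  by apply: eq_integrable => // y _ /=; rewrite mulrC.
have A0 : 0 <= A.
  rewrite /A dyadicE// mulr_ge0//; apply: Rintegral_ge0 => y _.
  by rewrite mulr_ge0// powR_ge0.
have key a : 0 < a -> `|dyadic m f x| <= a + a `^ (1 - q) * A.
  move=> a0; rewrite dyadicE// normrM (ger0_norm wn0).
  have -> : a + a `^ (1 - q) * A = (side m)^-1 ^+ n *
      \int[mu]_y (a * \1_c y + a `^ (1 - q) * (`|f y| `^ q * \1_c y)).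
    rewrite RintegralD//; last 2 first.
    - by apply: integrable_EFinZ; exact: integrable_indic_cell.
    - exact: integrable_EFinZ.
    rewrite !RintegralZl//; last exact: integrable_indic_cell.
    rewrite Rintegral_cell// mulrDr /A dyadicE// -/c; congr (_ + _); last by ring.
    by rewrite mulrCA -exprMn mulVf ?expr1n ?mulr1// gt_eqF// side_gt0.
  rewrite ler_wpM2l//; apply: norm_Rintegral_le.
  - by apply: measurable_funM => //; exact: integrable_measurable.
  - apply: integrable_EFinD; apply: integrable_EFinZ => //.
    exact: integrable_indic_cell.
  apply: aeW => y; rewrite normrM (ger0_norm (_ : 0 <= \1_c y))//.
  by rewrite mulrA -mulrDl ler_wpM2r// powR_young.
(* If [A = 0], this height is not positive, and the limit a -> 0 is taken instead. *)
move: A0; rewrite le_eqVlt => /orP[/eqP A0|A0].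
  rewrite -A0 mulr0; suff -> : dyadic m f x = 0 by rewrite normr0 powR0// gt_eqF.
  apply/eqP; rewrite -normr_le0; apply/ler_addgt0Pr => e e0; rewrite add0r.
  by have := key e e0; rewrite -A0 mulr0 addr0.
have a0 : 0 < A `^ q^-1 by exact: powR_gt0.
have := key _ a0.
rewrite -!powRrM (_ : q^-1 * (1 - q) = q^-1 - 1); last by field; rewrite gt_eqF.
rewrite -[X in _ * X](powRr1 (ltW A0)) -powRD; last by apply/implyP => _; rewrite gt_eqF.
rewrite subrK => h.
apply: (@le_trans _ _ ((2 * A `^ q^-1) `^ q)).
  apply: ge0_ler_powR; rewrite ?nnegrE ?mulr_ge0 ?powR_ge0// ?(ltW q0)//.
  by apply: (le_trans h); lra.
by rewrite powRM ?powR_ge0// -powRrM mulVf ?gt_eqF// powRr1// ltW.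
Qed.

Lemma Iq_dyadic m f : measurable_fun setT f -> supported f -> (Iq f < +oo)%E ->
  (Iq (dyadic m f) <= (2 `^ q)%:E * Iq f)%E.
Proof.
move=> mf f0 If; have fq1 := Iq_integrable mf If.
have f1 := Lq_integrable mf f0 If.
apply: (@le_trans _ _ (\int[mu]_x (2 `^ q * dyadic m (fun x => `|f x| `^ q) x)%:E)%E).
  apply: ge0_le_integral => //.
  - apply/measurable_EFinP; apply: measurable_powRnorm.
    by apply: integrable_measurable; exact: integrable_dyadic.
  - apply/measurable_EFinP; apply: measurable_funM => //.
    by apply: integrable_measurable; exact: integrable_dyadic.
  - by move=> x _; rewrite lee_fin dyadic_powR_le.
have i1 := integrable_dyadic m fq1.
under eq_integral do rewrite EFinM.
rewrite integralZl//; apply: lee_wpmul2l; first by rewrite lee_fin powR_ge0.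
have := Rintegral_dyadic m fq1; rewrite /Rintegral => h.
rewrite -(@fineK _ (\int[mu]_x (dyadic _ _ x)%:E)%E); last exact: (integrable_fin_num measurableT i1).
rewrite h fineK//; exact: (integrable_fin_num measurableT fq1).
Qed.

Lemma dyadic_id m m0 h : (m0 <= m)%N -> L1 h -> (forall x, ~ Q0 x -> h x = 0) ->
  (forall k x y, cell m0 k x -> cell m0 k y -> h x = h y) -> dyadic m h = h.
Proof.
move=> m0m h1 h0 hstep; apply/funext => x.
have hs : supported h by apply: aeW.
rewrite dyadicE//.
rewrite (@eq_Rintegral _ _ _ _ _ (fun y => h x * \1_(cell m (cell_of m x)) y)).
  rewrite RintegralZl//; last exact: integrable_indic_cell.
  rewrite Rintegral_cell// mulrCA -exprMn mulVf ?expr1n ?mulr1// gt_eqF//.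
  exact: side_gt0.
move=> y _; rewrite indicE; have [yc|nyc] := pselect (cell m (cell_of m x) y).
  rewrite mem_set//; congr (_ * _); apply: (hstep (cell_of m0 x)); last by move=> i.
  by move=> i; apply: (@cell_nestS m0 m y x m0m).
by rewrite memNset// !mulr0.
Qed.

End dyadic_expectation.

(** * Convergence of dyadic averages in L^q *)

Section dyadic_convergence.
Variables (R : realType) (n : nat) (s q : R).
Local Notation Rn := 'rV[R]_n.
Local Notation mu := (lebesgue_rV R n).
Local Notation L1 f := (mu.-integrable setT (EFin \o f)).
Hypotheses (s0 : 0 < s) (q1 : 1 < q).
Implicit Types (m : nat) (x y : Rn) (f g h : Rn -> R).
Local Notation side := (side s).
Local Notation cell := (@cell R n s).
Local Notation Q0 := (cell 0 (fun=> 0)).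
Local Notation dyadic := (@dyadic R n s).
Local Notation cell_of := (@cell_of R n s).
Local Notation Iq := (@Iq R n q).
Local Notation supported := (@supported R n s).

Let q0 : 0 < q. Proof. exact: lt_trans q1. Qed.

Let two_q : (0 <= (2 `^ q)%:E)%E. Proof. by rewrite lee_fin powR_ge0. Qed.

Lemma Iq_dominated (fk : nat -> Rn -> R) f g :
  (forall k, measurable_fun setT (fk k)) -> measurable_fun setT f ->
  measurable_fun setT g -> (Iq g < +oo)%E ->
  {ae mu, forall x, fk^~ x @ \oo --> f x} ->
  {ae mu, forall x, forall k, `|f x - fk k x| <= `|g x|} ->
  forall e : R, 0 < e -> exists k0, forall k, (k0 <= k)%N ->
    (Iq (fun x => f x - fk k x)%R < e%:E)%E.
Proof.
move=> mfk mf mg Ig cvg_f dom e e0.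
have mB k : measurable_fun setT (fun x => f x - fk k x) by exact: measurable_funB.
have c0 : {ae mu, forall x, setT x ->
    (fun k => (`|f x - fk k x| `^ q)%:E) @ \oo --> cst 0%E x}.
  apply: filterS cvg_f => x cx _ /=; apply/fine_cvgP; split; first exact: nearW.
  apply/cvgrPdist_lt => d d0 /=.
  have d'0 : 0 < d `^ q^-1 by exact: powR_gt0.
  have /cvgrPdist_lt/(_ _ d'0) := cx; apply: filterS => k hk.
  rewrite sub0r normrN ger0_norm ?powR_ge0//.
  have -> : d = (d `^ q^-1) `^ q by rewrite -powRrM mulVf ?gt_eqF// powRr1// ltW.
  by apply: gt0_ltr_powR; rewrite ?nnegrE ?powR_ge0.
have d0 : {ae mu, forall x k, setT x ->
    (`|(`|f x - fk k x| `^ q)%:E| <= (`|g x| `^ q)%:E)%E}.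
  apply: filterS dom => x dx k _; rewrite lee_fin ger0_norm ?powR_ge0//.
  by apply: ge0_ler_powR; rewrite ?nnegrE// ltW.
have mk k : measurable_fun setT (fun x => (`|f x - fk k x| `^ q)%:E).
  by apply/measurable_EFinP; exact: measurable_powRnorm.
have [_ _] := dominated_convergence measurableT mk (measurable_cst 0%E) c0
  (Iq_integrable mg Ig) d0.
rewrite integral0 => h.
by have [N _ hN] := ecvg0_lt h e0; exists N.
Qed.

(** A monotone class argument shows that this class is as large as possible: it is linear, closed
    under L^q limits and contains the indicators of unions of cells in [Q0], for which the averages
    become exact. *)
Definition dyadic_cvg f : Prop := [/\ measurable_fun setT f,
  forall x, ~ Q0 x -> f x = 0, (Iq f < +oo)%E &
  forall e : R, 0 < e -> exists m0, forall m, (m0 <= m)%N ->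
    (Iq (fun x => f x - dyadic m f x)%R < e%:E)%E].

Let supp f : (forall x, ~ Q0 x -> f x = 0) -> supported f.
Proof. by move=> h; exact: aeW. Qed.

Let measurable_dyadic m f : L1 f -> measurable_fun setT (dyadic m f).
Proof. by move=> f1; apply: integrable_measurable; exact: (integrable_dyadic s0 m f1). Qed.

Lemma dyadic_linear m a f g : L1 f -> L1 g ->
  dyadic m (fun x => a * f x + g x) = (fun x => a * dyadic m f x + dyadic m g x).
Proof.
move=> f1 g1; apply/funext => x.
have mol : mollifier (side m) (grid_kernel s (side m)).
  by apply: mollifier_grid; exact: side_gt0.
exact: (fold_mollify_linear s0 mol).
Qed.

Lemma dyadic_cvg_lin a f g : dyadic_cvg f -> dyadic_cvg g ->
  dyadic_cvg (fun x => a * f x + g x).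
Proof.
move=> [mf sf If cf] [mg sg Ig cg].
have f1 := Lq_integrable s0 q1 mf (supp sf) If.
have g1 := Lq_integrable s0 q1 mg (supp sg) Ig.
have lin_le (u v : Rn -> R) : measurable_fun setT u -> measurable_fun setT v ->
    (Iq (fun x => a * u x + v x)%R <= (2 `^ q)%:E * ((`|a| `^ q)%:E * Iq u + Iq v))%E.
  move=> mu' mv; have := Iq_D q1 (measurable_funM (measurable_cst a) mu') mv.
  by rewrite (Iq_Z q a mu').
split.
- by apply: measurable_funD => //; exact: measurable_funM.
- by move=> x nx; rewrite sf// sg// mulr0 addr0.
- apply: (le_lt_trans (lin_le _ _ mf mg)); apply: lte_mul_pinfty => //.
  apply: lte_add_pinfty; last exact: Ig.
  by apply: (lte_mul_pinfty _ _ If); rewrite ?lee_fin ?powR_ge0.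
move=> e e0.
pose D := 2 `^ q * (`|a| `^ q + 1).
have D0 : 0 < D by rewrite mulr_gt0 ?powR_gt0// ltr_wpDl// powR_ge0.
have d0 : 0 < e / 2 / D by rewrite !divr_gt0.
have [m1 h1] := cf _ d0; have [m2 h2] := cg _ d0.
exists (maxn m1 m2) => m; rewrite geq_max => /andP[/h1 {}h1 /h2 {}h2].
rewrite dyadic_linear//.
rewrite (_ : (fun x => _) = (fun x => a * (f x - dyadic m f x) + (g x - dyadic m g x))); last first.
  by apply/funext => x; ring.
apply: (le_lt_trans (lin_le _ _ _ _)).
- by apply: measurable_funB => //; exact: measurable_dyadic.
- by apply: measurable_funB => //; exact: measurable_dyadic.
apply: (@le_lt_trans _ _ ((2 `^ q)%:E * ((`|a| `^ q)%:E * (e / 2 / D)%:E + (e / 2 / D)%:E))%E).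
  have := ltW h1; have := ltW h2; set u := Iq _; set v := Iq _ => hu hv.
  apply: lee_wpmul2l => //; apply: leeD hu.
  by apply: lee_wpmul2l hv; rewrite lee_fin powR_ge0.
rewrite [X in (X < _)%E](_ : _ = (2 `^ q * (`|a| `^ q * (e / 2 / D) + e / 2 / D))%:E)//.
rewrite lte_fin (_ : _ * _ = e / 2); first by lra.
by rewrite /D; field; rewrite !gt_eqF// ?powR_gt0// ltr_wpDl// powR_ge0.
Qed.

Lemma dyadic_cvg0 : dyadic_cvg (fun=> 0).
Proof.
have I0 : Iq (fun=> 0) = 0%E.
  by rewrite /Iq normr0 powR0 ?gt_eqF// integral0.
split=> //; first by rewrite I0.
move=> e e0; exists 0%N => m _; rewrite (_ : (fun x => _) = (fun=> 0)) ?I0 ?lte_fin//.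
apply/funext => x; rewrite /dyadic /fold_mollify.
by under eq_Rintegral do rewrite mulr0; rewrite Rintegral_cst// mul0r subr0.
Qed.

(** The case [c i = 0] is for the value 0 of a simple function, whose level set need not be
    contained in [Q0]. *)
Lemma dyadic_cvg_sum (I : Type) (r : seq I) (c : I -> R) (F : I -> Rn -> R) :
  (forall i, dyadic_cvg (F i)) \/ (forall i, c i = 0 \/ dyadic_cvg (F i)) ->
  dyadic_cvg (fun x => \sum_(i <- r) c i * F i x).
Proof.
move=> hF'; have {hF'} hF i : c i = 0 \/ dyadic_cvg (F i).
  by case: hF' => // h; right.
elim: r => [|i r IH].
  rewrite (_ : (fun x => _) = (fun=> 0)); first exact: dyadic_cvg0.
  by apply/funext => x; rewrite big_nil.
case: (hF i) => [ci|Fi].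
  move: IH; congr dyadic_cvg; apply/funext => x.
  by rewrite big_cons ci mul0r add0r.
have := dyadic_cvg_lin (c i) Fi IH; congr dyadic_cvg; apply/funext => x.
by rewrite big_cons.
Qed.

(** With g = f - fk the error for [f] is the error for [g], which is small because the averages are
    bounded on L^q uniformly in [m], plus the error for [fk]. *)
Lemma dyadic_cvg_lim (fk : nat -> Rn -> R) f : (forall k, dyadic_cvg (fk k)) ->
  measurable_fun setT f -> (forall x, ~ Q0 x -> f x = 0) -> (Iq f < +oo)%E ->
  (forall e : R, 0 < e -> exists k, (Iq (fun x => f x - fk k x)%R < e%:E)%E) ->
  dyadic_cvg f.
Proof.
move=> hk mf sf If lim; split => // e e0.
pose D := 2 `^ q * (2 `^ q * (1 + 2 `^ q) + 1).
have tq : 0 < 2 `^ q :> R by exact: powR_gt0.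
have D0 : 0 < D by rewrite !(mulr_gt0, addr_gt0).
have d0 : 0 < e / 2 / D by rewrite !divr_gt0.
have [k hfk] := lim _ d0.
have [mk sk Ik ck] := hk k; have [m0 hm0] := ck _ d0.
exists m0 => m m0m.
have f1 := Lq_integrable s0 q1 mf (supp sf) If.
have k1 := Lq_integrable s0 q1 mk (supp sk) Ik.
pose g x := f x - fk k x.
have mg : measurable_fun setT g by exact: measurable_funB.
have sg x : ~ Q0 x -> g x = 0 by move=> nx; rewrite /g sf// sk// subrr.
have Ig : (Iq g < +oo)%E by exact: lt_trans hfk (ltry _).
have g1 := Lq_integrable s0 q1 mg (supp sg) Ig.
rewrite (_ : (fun x => _) = (fun x => (g x - dyadic m g x) + (fk k x - dyadic m (fk k) x))); last first.
  have fE : f = (fun x => 1 * g x + fk k x) by apply/funext => y; rewrite mul1r subrK.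
  by apply/funext => x; rewrite {2}fE dyadic_linear// /g; ring.
have mgd : measurable_fun setT (fun x => g x - dyadic m g x).
  by apply: measurable_funB => //; exact: measurable_dyadic.
have mkd : measurable_fun setT (fun x => fk k x - dyadic m (fk k) x).
  by apply: measurable_funB => //; exact: measurable_dyadic.
apply: (le_lt_trans (Iq_D q1 mgd mkd)).
have h1 : (Iq (fun x => g x - dyadic m g x)%R <=
    (2 `^ q)%:E * ((e / 2 / D)%:E + (2 `^ q)%:E * (e / 2 / D)%:E))%E.
  apply: (le_trans (Iq_B q1 mg (measurable_dyadic m g1))); apply: lee_wpmul2l => //.
  apply: leeD; first exact: ltW.
  apply: (le_trans (Iq_dyadic s0 q1 m mg (supp sg) Ig)); apply: lee_wpmul2l => //.
  exact: ltW.
apply: (@le_lt_trans _ _ ((2 `^ q)%:E * ((2 `^ q)%:E * ((e / 2 / D)%:E +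
    (2 `^ q)%:E * (e / 2 / D)%:E) + (e / 2 / D)%:E))%E).
  by apply: lee_wpmul2l => //; exact: leeD h1 (ltW (hm0 _ m0m)).
rewrite [X in (X < _)%E](_ : _ = (2 `^ q * (2 `^ q * (e / 2 / D + 2 `^ q * (e / 2 / D)) +
  e / 2 / D))%:E)//.
rewrite lte_fin (_ : _ * _ = e / 2); first by lra.
by rewrite /D; field; rewrite !gt_eqF// !(mulr_gt0, addr_gt0).
Qed.

Lemma Iq_indic (A : set Rn) : measurable A -> Iq \1_A = mu A.
Proof.
move=> mA; rewrite /Iq; under eq_integral => x _.
  rewrite indicE (_ : `|_| `^ q = \1_A x); last first.
    by rewrite indicE; case: (x \in A); rewrite ?normr1 ?powR1// normr0 powR0// gt_eqF.
  over.
by rewrite integral_indic// setIT.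
Qed.

Lemma Iq_indic_lty (A : set Rn) : measurable A -> A `<=` Q0 -> (Iq \1_A < +oo)%E.
Proof.
move=> mA AQ; rewrite Iq_indic//; apply: (@le_lt_trans _ _ (mu Q0)).
  by apply: le_measure; rewrite ?inE//; exact: measurable_cell.
by rewrite [X in (X < _)%E](lebesgue_cell s0) ltry.
Qed.

(** A pi-system that generates the measurable sets and for which the averages of the indicators,
    within [Q0], are eventually exact. *)
Definition grid_set (A : set Rn) : Prop := measurable A /\
  exists m, forall x y, cell_of m x =1 cell_of m y -> A x -> A y.

Lemma grid_set_setI : setI_closed grid_set.
Proof.
move=> A B [mA [m hA]] [mB [m' hB]]; split; first exact: measurableI.
exists (maxn m m') => x y xy [Ax Bx]; split.
  by apply: hA Ax; exact: (cell_nestS s0 (leq_maxl m m') xy).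
by apply: hB Bx; exact: (cell_nestS s0 (leq_maxr m m') xy).
Qed.

Lemma dyadic_cvg_grid_set A : grid_set A -> dyadic_cvg \1_(A `&` Q0).
Proof.
move=> [mA [m hA]].
have mAQ : measurable (A `&` Q0) by apply: measurableI => //; exact: measurable_cell.
have sAQ x : ~ Q0 x -> \1_(A `&` Q0) x = 0 :> R.
  by move=> nx; rewrite indicE memNset// => -[].
have IA : (Iq \1_(A `&` Q0) < +oo)%E by apply: Iq_indic_lty => //; exact: subIsetr.
have mi : measurable_fun setT (\1_(A `&` Q0) : Rn -> R) by exact: measurable_indic.
split => // e e0; exists m => m' mm'.
rewrite (@dyadic_id R n s s0 m' m)//.
- rewrite (_ : (fun x => _) = (fun=> 0)); last by apply/funext => x; rewrite subrr.
  by rewrite /Iq normr0 powR0 ?gt_eqF// integral0 lte_fin.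
- exact: (Lq_integrable s0 q1 mi (supp sAQ) IA).
move=> k x y xk yk; rewrite !indicE; congr (_%:R); congr nat_of_bool.
have h x' y' : cell m k x' -> cell m k y' -> (A `&` Q0) x' -> (A `&` Q0) y'.
  move=> xk' yk' [Ax Qx]; split.
    by apply: hA Ax => i; rewrite /cell_of xk' yk'.
  exact: (cell_nest s0 xk' yk' Qx).
by apply/idP/idP => /set_mem hx; apply: mem_set; [exact: (h x y)|exact: (h y x)].
Qed.

(** Differences are covered by linearity, increasing unions by dominated convergence with the
    indicator of [Q0] as majorant. *)
Lemma lambda_system_dyadic_cvg :
  lambda_system setT [set A | measurable A /\ dyadic_cvg \1_(A `&` Q0)].
Proof.
have gT : grid_set setT by split => //; exists 0%N.
split.
- by [].
- by split => //; exact: dyadic_cvg_grid_set.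
- move=> A B BA [mA hA] [mB hB]; split; first exact: measurableD.
  have := dyadic_cvg_lin (-1) hB hA; congr dyadic_cvg; apply/funext => x.
  have xD : (x \in (A `\` B) `&` Q0) = (x \in A) && (x \notin B) && (x \in Q0).
    by rewrite in_setI in_setD.
  rewrite !indicE xD !in_setI mulN1r.
  have : x \in B -> x \in A by move=> /set_mem/BA/mem_set.
  case: (x \in B); case: (x \in A); case: (x \in Q0) => //= h;
    rewrite ?subrr ?oppr0 ?addr0 ?add0r ?addNr//; by have := h isT.
- move=> F ndF hF; split; first by apply: bigcup_measurable => k _; case: (hF k).
  have mF k : measurable (F k `&` Q0).
    by apply: measurableI; [case: (hF k)|exact: measurable_cell].
  have mUF : measurable (\bigcup_k F k `&` Q0).
    apply: measurableI; last exact: measurable_cell.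
    by apply: bigcup_measurable => k _; case: (hF k).
  apply: (@dyadic_cvg_lim (fun k => \1_(F k `&` Q0))).
  + by move=> k; case: (hF k).
  + exact: measurable_indic.
  + by move=> x nx; rewrite indicE memNset// => -[].
  + by apply: Iq_indic_lty => //; exact: subIsetr.
  move=> e e0; have [||||||k0 hk0] := @Iq_dominated (fun k => \1_(F k `&` Q0))
      \1_(\bigcup_k F k `&` Q0) \1_Q0 _ _ _ _ _ _ e e0.
  + by move=> k; exact: measurable_indic.
  + exact: measurable_indic.
  + by apply: measurable_indic; exact: measurable_cell.
  + by apply: Iq_indic_lty => //; exact: measurable_cell.
  + apply: aeW => x; have [[k _ Fkx]|nF] := pselect ((\bigcup_k F k) x).
      apply: cvg_near_cst; exists k => // k' /= kk'.
      rewrite !indicE !in_setI; congr (_%:R); congr nat_of_bool; congr (_ && _).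
      rewrite !mem_set//; first by exists k.
      by move: Fkx; apply/subsetPset; exact: ndF.
    rewrite [X in _ --> X]indicE memNset; last by case.
    apply: cvg_near_cst; apply: nearW => k; rewrite indicE memNset// => -[Fkx _].
    by apply: nF; exists k.
  + apply: aeW => x k; rewrite !indicE !in_setI.
    by case: (_ \in _); case: (_ \in _); case: (_ \in _) => /=; rewrite ?subrr ?subr0 ?sub0r ?normrN ?normr1 ?normr0.
  by exists k0; exact: hk0.
Qed.

(** The complement is the union over all generations of the cells on which [x ord0 i < r]. Cells do
    not contain their right endpoint, which may therefore be equal to [r]. *)
Lemma halfspace_grid (i : 'I_n) (r : R) :
  <<s setT, grid_set >> [set x : Rn | r <= x ord0 i].
Proof.
pose E m : set Rn := [set x | (grid_index s m (x ord0 i) + 1)%:~R * side m - s <= r].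
have gE m : grid_set (E m).
  split; last first.
    exists m => x y xy; have := xy i; rewrite /cell_of /E /= => ->; exact.
  rewrite (_ : E m = setT `&` (fun x : Rn => (grid_index s m (x ord0 i))%:~R : R) @^-1`
      [set u | (u + 1) * side m - s <= r]); last first.
    by apply/seteqP; split => x; rewrite /E /= ?intrD//= => -[].
  have mfl : measurable_fun setT (fun x : Rn => (grid_index s m (x ord0 i))%:~R : R).
    by apply: (measurable_coord_comp i (measurable_floor_cell s (side_gt0 s0 m))).
  apply: mfl => //.
  rewrite (_ : mkset _ = `]-oo, ((r + s) / side m - 1)]%classic); first exact: measurable_itv.
  apply/seteqP; split => u /=; rewrite in_itv/= lerBlDr lerBrDr ler_pdivlMr ?side_gt0//.
have -> : [set x : Rn | r <= x ord0 i] = setT `\` \bigcup_m E m.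
  apply/seteqP; split => x /=.
    move=> rx; split => // -[m _]; rewrite /E /=; apply/negP; rewrite -ltNge.
    have /eqP : grid_index s m (x ord0 i) = grid_index s m (x ord0 i) by [].
    rewrite {1}/grid_index floor_cell ?side_gt0// => /andP[_ h].
    apply: (le_lt_trans rx); apply: (lt_le_trans h); rewrite intrD; lra.
  move=> [_ nE]; rewrite leNgt; apply/negP => xr; apply: nE.
  pose d := r - x ord0 i; have d0 : 0 < d by rewrite subr_gt0.
  have sd0 : 0 <= 2 * s / d by rewrite divr_ge0 ?mulr_ge0// ltW.
  (* 2^m > m > 2 * s / d, so the cells of generation [m] are not longer than the distance [d] to the
     half-space. *)
  pose m := (Num.trunc (2 * s / d)).+1.
  exists m => //; rewrite /E /=.
  have sm : side m <= d.
    rewrite /side ler_pdivrMr ?exprn_gt0// [d * _]mulrC -ler_pdivrMr//.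
    have /andP[_ h] := truncn_itv sd0.
    apply: (le_trans (ltW h)); rewrite -/m -natrX ler_nat ltnW//; exact: ltn_expl.
  have /eqP : grid_index s m (x ord0 i) = grid_index s m (x ord0 i) by [].
  rewrite {1}/grid_index floor_cell ?side_gt0// => /andP[h _].
  move: sm; rewrite intrD /d; lra.
have [_ sD sU] := smallest_sigma_algebra setT grid_set.
by apply: sD; apply: sU => m; apply: sub_sigma_algebra.
Qed.

(** Dynkin's pi-lambda theorem; in each coordinate the half-lines generate the Borel sets. *)
Lemma dyadic_cvg_indic (A : set Rn) : measurable A -> dyadic_cvg \1_(A `&` Q0).
Proof.
move=> mA.
suff : <<s setT, grid_set >> A.
  move/(lambda_system_subset grid_set_setI lambda_system_dyadic_cvg).
  by case=> // B gB; split; [case: gB|exact: dyadic_cvg_grid_set].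
have [g0 gD gU] := smallest_sigma_algebra setT grid_set.
suff : g_sigma_preimage (@rV_coord R n) `<=` <<s setT, grid_set >> by apply.
apply: smallest_sub; first by split.
rewrite -bigcup_seq => B [i _ [C mC <-]] /=; rewrite setTI.
suff h : <<s setT, @RGenCInfty.G R >> `<=` [set C | <<s setT, grid_set >> (@rV_coord R n i @^-1` C)].
  by apply: h; move: mC; rewrite [X in X C](@RGenCInfty.measurableE R).
apply: smallest_sub.
  split=> /=.
  - by rewrite preimage_set0.
  - by move=> D hD; rewrite setTD preimage_setC -setTD; exact: gD.
  - by move=> F hF; rewrite preimage_bigcup; exact: gU.
move=> D [r ->] /=.
rewrite (_ : _ @^-1` _ = [set x : Rn | r <= x ord0 i]); first exact: halfspace_grid.
by apply/seteqP; split => x; rewrite /rV_coord /= in_itv/= andbT.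
Qed.

Import HBNNSimple.

(** Simple functions increase to [f], and the errors are dominated by [f] itself. *)
Lemma dyadic_cvg_ge0 f : measurable_fun setT f -> (forall x, ~ Q0 x -> f x = 0) ->
  (Iq f < +oo)%E -> (forall x, 0 <= f x) -> dyadic_cvg f.
Proof.
move=> mf sf If f0.
have mE : measurable_fun setT (EFin \o f) by exact/measurable_EFinP.
pose fk k : Rn -> R := nnsfun_approx measurableT mE k.
have fk_le k x : fk k x <= f x.
  have cx := @cvg_nnsfun_approx _ _ _ _ measurableT _ mE (fun x _ => f0 x : (0 <= (EFin \o f) x)%E) x I.
  have nd : nondecreasing_seq (fun k => (fk k x)%:E).
    by move=> a b ab; rewrite lee_fin; have /lefP := nd_nnsfun_approx measurableT mE ab; apply.
  have := ereal_nondecreasing_cvgn nd.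
  move=> /(cvg_unique (@ereal_hausdorff R) cx) /= e; rewrite -lee_fin e.
  by apply: ereal_sup_ubound; exists k.
have cvg_fk x : fk^~ x @ \oo --> f x.
  have := @cvg_nnsfun_approx _ _ _ _ measurableT _ mE (fun x _ => f0 x : (0 <= (EFin \o f) x)%E) x I.
  by move=> /fine_cvgP[_].
apply: (dyadic_cvg_lim _ mf sf If (fk := fk)).
- move=> k; have fin_fk : finite_set (range (fk k)) by exact: fimfunP.
  rewrite (_ : fk k = (fun x => \sum_(r <- finmap.enum_fset (fset_set (range (fk k)))) r * \1_(fk k @^-1` [set r]) x));
      last first.
    by apply/funext => x; rewrite {1}/fk fimfunE fsbig_finite.
  apply: dyadic_cvg_sum; right => r.
  have [->|r0] := eqVneq r 0; first by left.
  right; rewrite (_ : _ @^-1` _ = (fk k @^-1` [set r]) `&` Q0).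
    by apply: dyadic_cvg_indic; rewrite -[X in measurable X]setTI; exact: measurable_funP.
  apply/seteqP; split => x /=; last by case.
  move=> fr; split => //; apply: contrapT => nx; move/eqP: r0; apply; rewrite -fr.
  by apply/le_anti; rewrite -{1}(sf x nx) fk_le/=.
- move=> e e0; have [|||k0 hk0] := @Iq_dominated fk f f _ mf mf If _ _ e e0.
  + by move=> k; exact: measurable_funP.
  + by apply: aeW => x; exact: cvg_fk.
  + apply: aeW => x k; rewrite ger0_norm ?subr_ge0 ?fk_le// ger0_norm// gerBl//.
  by exists k0; exact: hk0.
Qed.

(** [dyadic_cvg] asks for the support everywhere, so [f] is first multiplied by the indicator of
    [Q0], which does not change its averages, and then split into positive and negative parts. *)
Lemma cvg_dyadic f : measurable_fun setT f -> supported f -> (Iq f < +oo)%E ->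
  forall e : R, 0 < e -> exists m0, forall m, (m0 <= m)%N ->
    (Iq (fun x => f x - dyadic m f x)%R < e%:E)%E.
Proof.
move=> mf sf If e e0.
pose f' x := f x * \1_Q0 x.
have mQ : measurable_fun setT (\1_Q0 : Rn -> R).
  by apply: measurable_indic; exact: measurable_cell.
have mf' : measurable_fun setT f' by exact: measurable_funM.
have ff' : {ae mu, forall x, f x = f' x}.
  apply: filterS sf => x sx; rewrite /f' indicE.
  have [xQ|nxQ] := pselect (Q0 x); first by rewrite mem_set// mulr1.
  by rewrite memNset// mulr0 sx.
have IE g g' : measurable_fun setT g -> measurable_fun setT g' ->
    {ae mu, forall x, g x = g' x} -> Iq g = Iq g'.
  move=> mg mg' gg'; apply: ae_eq_integral => //.
  - by apply/measurable_EFinP; exact: measurable_powRnorm.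
  - by apply/measurable_EFinP; exact: measurable_powRnorm.
  - by apply: filterS gg' => x -> _.
have dE m : dyadic m f = dyadic m f'.
  apply/funext => x; rewrite /dyadic /fold_mollify.
  have mk : measurable_fun setT (fold_kernel s (grid_kernel s (side m)) x).
    have mol : mollifier (side m) (grid_kernel s (side m)).
      by apply: mollifier_grid; exact: side_gt0.
    exact: (measurableT_comp (measurable_fold_kernel s0 mol) (pair1_measurable x)).
  apply: eq_ae_Rintegral; [exact: measurable_funM|exact: measurable_funM|].
  by apply: filterS ff' => y ->.
have [pos_cvg neg_cvg] : dyadic_cvg (fun x => Num.max (f' x) 0) /\
    dyadic_cvg (fun x => Num.max (- f' x) 0).
  have half (u : Rn -> R) : (forall x, ~ Q0 x -> u x = 0) -> measurable_fun setT u ->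
      (Iq u < +oo)%E -> dyadic_cvg (fun x => Num.max (u x) 0).
    move=> su mu' Iu; apply: dyadic_cvg_ge0.
    - exact: measurable_maxr.
    - by move=> x nx; rewrite su// maxxx.
    - apply: le_lt_trans Iu; apply: ge0_le_integral => //.
      + by apply/measurable_EFinP; apply: measurable_powRnorm; exact: measurable_maxr.
      + by apply/measurable_EFinP; exact: measurable_powRnorm.
      + move=> x _; rewrite lee_fin; apply: ge0_ler_powR; rewrite ?nnegrE// ?(ltW q0)//.
        by have [h|h] := leP (u x) 0; rewrite ?normr0.
    - by move=> x; rewrite le_max lexx orbT.
  have sf' x : ~ Q0 x -> f' x = 0 by move=> nx; rewrite /f' indicE memNset// mulr0.
  have If' : (Iq f' < +oo)%E by rewrite -(IE f f').
  split; first exact: half sf' mf' If'.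
  apply: half.
  - by move=> x nx; rewrite sf'// oppr0.
  - exact: measurable_funN.
  - by rewrite Iq_N.
have [_ _ _ h] : dyadic_cvg f'.
  have := dyadic_cvg_lin (-1) neg_cvg pos_cvg; congr dyadic_cvg; apply/funext => x.
  have [h|h] := leP (f' x) 0.
    by rewrite max_l ?oppr_ge0// addr0 mulN1r opprK.
  by rewrite max_r ?oppr_le0 ?(ltW h)// mulr0 add0r.
have [m0 hm0] := h e e0; exists m0 => m m0m; rewrite (IE _ (fun x => f' x - dyadic m f' x)).
- exact: hm0.
- apply: measurable_funB => //; apply: measurable_dyadic.
  exact: (Lq_integrable s0 q1 mf sf If).
- apply: measurable_funB => //; rewrite -dE; apply: measurable_dyadic.
  exact: (Lq_integrable s0 q1 mf sf If).
- by apply: filterS ff' => x ->; rewrite dE.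
Qed.

End dyadic_convergence.

(** * The atomic norm of functions of mean zero in L^q *)

Section atomic_norm_of_Lq.
Variables (R : realType) (n : nat) (s q : R).
Local Notation Rn := 'rV[R]_n.
Local Notation mu := (lebesgue_rV R n).
Local Notation L1 f := (mu.-integrable setT (EFin \o f)).
Hypotheses (n0 : (0 < n)%N) (s0 : 0 < s) (q1 : 1 < q).
Implicit Types (m : nat) (x y : Rn) (f g h : Rn -> R).
Local Notation side := (side s).
Local Notation cell := (@cell R n s).
Local Notation Q0 := (cell 0 (fun=> 0)).
Local Notation dyadic := (@dyadic R n s).
Local Notation Iq := (@Iq R n q).
Local Notation supported := (@supported R n s).
Local Notation W := (side 0 ^+ n).

Let q0 : 0 < q. Proof. exact: lt_trans q1. Qed.

Let W0 : 0 < W. Proof. by rewrite exprn_gt0// side_gt0. Qed.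

(** Per unit of [a * W], the first term pays for the bounded part of the decomposition, the second
    for the atoms that are split off. *)
Definition cz_total : R := 2 * cz_growth R n * (2 * n%:R) ^+ n + cz_const n q.

Lemma cz_total_gt0 : 0 < cz_total.
Proof.
by rewrite ltr_wpDl ?(cz_const_gt0 n0 q1)// !mulr_ge0 ?exprn_ge0 ?mulr_ge0.
Qed.

(** The bounded part [g] has mean zero because [h] and [b] do, so it is one more multiple of an
    atom, on [Q0]. *)
Lemma fin_mass_step h (B a : R) M : measurable_fun setT h -> (forall x, `|h x| <= B) ->
  (forall k x y, cell M k x -> cell M k y -> h x = h y) ->
  (forall x, ~ Q0 x -> h x = 0) -> \int[mu]_x h x = 0 -> 0 < a ->
  (Iq h <= (a `^ q * W)%:E)%E -> fin_mass (cz_total * a * W) (toC h).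
Proof.
move=> mh hB hstep sh ih a0 Ih.
have hQ x : h x * \1_Q0 x = h x.
  rewrite indicE; have [xQ|nxQ] := pselect (Q0 x); first by rewrite mem_set// mulr1.
  by rewrite memNset// mulr0 sh.
have qm : qmass s q h 0 (fun=> 0) <= a `^ q * W.
  rewrite /qmass (@eq_Rintegral _ _ _ _ _ (fun x => `|h x| `^ q)); last first.
    move=> x _; rewrite indicE; have [xQ|nxQ] := pselect (Q0 x); first by rewrite mem_set// mulr1.
    by rewrite memNset// mulr0 sh// normr0 powR0// gt_eqF.
  rewrite -lee_fin /Rintegral fineK//.
  rewrite ge0_fin_numE; first exact: le_lt_trans Ih (ltry _).
  exact: Iq_ge0.
have [g [b [[mg mb] hgb sg gB hb]]] := calderon_zygmund_cell n0 s0 q1 mh hB hstep (add0n M) a0 qm.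
have b1 : L1 b by have := fin_mass_cintegrable n0 hb; move=> /cintegrableP[].
have h1 : L1 h.
  apply: (Lq_integrable s0 q1 mh); first exact: aeW.
  exact: le_lt_trans Ih (ltry _).
have gE : g = (fun x => h x - b x).
  by apply/funext => x; rewrite -(hQ x) hgb addrK.
have ig : \int[mu]_x g x = 0.
  by rewrite gE RintegralB// ih (fin_mass_Rintegral0 n0 hb) subrr.
have G0 : 0 < cz_growth R n by rewrite exprn_gt0.
have hg : fin_mass (2 * cz_growth R n * a * (2 * (n%:R * side 0)) ^+ n) (toC g).
  by apply: (fin_mass_cell n0 s0 (k := fun=> 0)) => //; rewrite !mulr_gt0.
have := fin_massD hg hb.
rewrite (_ : (fun x => _ + _) = toC h); last first.
  by apply/funext => x; rewrite gE /toC -rmorphD /= subrK.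
apply: fin_mass_le.
rewrite mulrA exprMn /cz_total !mulrDl; apply: lerD.
  by rewrite le_eqVlt; apply/orP; left; apply/eqP; ring.
apply: (@le_trans _ _ (cz_const n q * a `^ (1 - q) * (a `^ q * W))).
  by rewrite ler_wpM2l// mulr_ge0 ?powR_ge0// ltW// cz_const_gt0.
rewrite [leLHS](_ : _ = cz_const n q * (a `^ (1 - q) * a `^ q) * W); last by ring.
rewrite -powRD; last by apply/implyP => _; rewrite gt_eqF.
by rewrite subrK powRr1// ltW.
Qed.

Lemma sum_geometric K : \sum_(k < K) (2 ^- k : R) <= 2.
Proof.
suff : \sum_(k < K) (2 ^- k : R) = 2 - 2 * 2 ^- K.
  by move=> ->; rewrite gerBl mulr_ge0// invr_ge0 exprn_ge0.
elim: K => [|K IH]; first by rewrite big_ord0 expr0 invr1; ring.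
by rewrite big_ord_recr /= IH exprS; field; rewrite expf_neq0.
Qed.

(* The dyadic averages converge in L^q fast enough along a subsequence for the
   decompositions of their differences to be summed. *)
Lemma mass_le_Lq f (a : R) : measurable_fun setT f -> supported f ->
  \int[mu]_x f x = 0 -> 0 < a -> (Iq f <= (a `^ q * W)%:E)%E ->
  mass_le (16 * cz_total * a * W) (toC f).
Proof.
move=> mf sf if0 a0 If.
have If_oo : (Iq f < +oo)%E by exact: le_lt_trans If (ltry _).
have f1 := Lq_integrable s0 q1 mf sf If_oo.
(* The prescribed rate: the j-th average chosen below is within [b j] of [f] in the L^q norm
   normalised by the volume [W]. *)
pose b j : R := a * 2 ^- j.
have b0 j : 0 < b j by rewrite mulr_gt0// invr_gt0 exprn_gt0.
have bS j : b j = 2 * b j.+1 by rewrite /b exprS; field; rewrite expf_neq0.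
have /choice[m hm] : forall j : nat, exists m,
    (Iq (fun x => f x - dyadic m f x)%R < (b j `^ q * W)%:E)%E.
  move=> j; have e0 : 0 < b j `^ q * W by rewrite mulr_gt0// powR_gt0.
  have [m hm] := cvg_dyadic s0 q1 mf sf If_oo e0.
  by exists m; exact: hm.
pose h j := dyadic (m j) f.
have mh j : measurable_fun setT (h j).
  by apply: integrable_measurable; exact: integrable_dyadic.
have h1 j : L1 (h j) by exact: integrable_dyadic.
have ih j : \int[mu]_x h j x = 0 by rewrite Rintegral_dyadic.
have sh j x : ~ Q0 x -> h j x = 0 by exact: dyadic_support.
pose d k := if k is j.+1 then (fun x => h j.+1 x - h j x) else h 0%N.
have sumd K x : \sum_(k < K.+1) d k x = h K x.
  elim: K => [|K IH]; first by rewrite big_ord1.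
  by rewrite big_ord_recr /= IH addrC subrK.
have hstep j M k x y : (m j <= M)%N -> cell M k x -> cell M k y -> h j x = h j y.
  move=> jM xk yk.
  apply: (@dyadic_step R n s s0 (m j) f (cell_of s (m j) x)) => //.
  move=> i; rewrite -[RHS]/(cell_of s (m j) x i).
  by apply: (cell_nestS s0 jM) => i'; rewrite /cell_of xk yk.
have q2 : 2 <= 2 `^ q :> R.
  by rewrite -[leLHS](powRr1 (ler0n R 2)) ler_powR ?ler1n ?(ltW q1).
(* For k = j + 1 the integral of |d k|^q is at most 2^q * 2 * (b j)^q * W <= (4 * b j)^q * W, and
   [4 * b j = 8 * b j.+1]. The [b k] add up to at most [2 * a], whence the constant 16. *)
have d_mass k : fin_mass (cz_total * (8 * b k) * W) (toC (d k)).
  case: k => [|j].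
    have [B hB] := dyadic_bounded s0 (m 0%N) f1.
    apply: (fin_mass_step (B := B) (M := m 0%N)) => //.
    - exact: (mh 0%N).
    - by move=> k x y; exact: (hstep 0%N).
    - exact: (sh 0%N).
    - exact: (ih 0%N).
    - by rewrite mulr_gt0.
    apply: (le_trans (Iq_dyadic s0 q1 (m 0%N) mf sf If_oo)).
    apply: (@le_trans _ _ ((2 `^ q)%:E * (a `^ q * W)%:E)%E).
      by apply: lee_wpmul2l => //; rewrite lee_fin powR_ge0.
    rewrite -EFinM lee_fin mulrA ler_wpM2r ?(ltW W0)// -powRM ?(ltW a0)//.
    apply: ge0_ler_powR; rewrite ?nnegrE ?mulr_ge0// ?(ltW q0) ?(ltW a0) ?(ltW (b0 _))//.
    by rewrite /b expr0 invr1 mulr1; lra.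
  have [B hB] := dyadic_bounded s0 (m j) f1.
  have [B' hB'] := dyadic_bounded s0 (m j.+1) f1.
  apply: (fin_mass_step (B := B' + B) (M := maxn (m j) (m j.+1))).
  - exact: measurable_funB.
  - by move=> x; apply: (le_trans (ler_normB _ _)); apply: lerD; [exact: hB'|exact: hB].
  - move=> k x y xk yk /=; congr (_ - _).
      by apply: (hstep _ (maxn (m j) (m j.+1)) k) => //; exact: leq_maxr.
    by apply: (hstep _ (maxn (m j) (m j.+1)) k) => //; exact: leq_maxl.
  - by move=> x nx /=; rewrite !sh// subrr.
  - by rewrite /= RintegralB// !ih subrr.
  - by rewrite mulr_gt0.
  have mfh i : measurable_fun setT (fun x => f x - h i x) by exact: measurable_funB.
  rewrite (_ : d j.+1 = (fun x => (f x - h j x) - (f x - h j.+1 x))); last first.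
    by apply/funext => x /=; ring.
  apply: (le_trans (Iq_B q1 (mfh j) (mfh j.+1))).
  apply: (@le_trans _ _ ((2 `^ q)%:E * ((b j `^ q * W)%:E + (b j `^ q * W)%:E))%E).
    apply: lee_wpmul2l; first by rewrite lee_fin powR_ge0.
    apply: leeD; first by apply: ltW; exact: hm.
    apply: (le_trans (ltW (hm j.+1))); rewrite lee_fin ler_wpM2r ?(ltW W0)//.
    apply: ge0_ler_powR; rewrite ?nnegrE ?(ltW q0) ?(ltW (b0 _))//.
    by rewrite (bS j); have := b0 j.+1; lra.
  rewrite -EFinD -EFinM lee_fin -mulrDl mulrA ler_wpM2r ?(ltW W0)//.
  rewrite (_ : 8 * b j.+1 = 2 * (2 * b j)); last by rewrite (bS j); ring.
  have bj := ltW (b0 j); have tb : 0 <= 2 * b j by rewrite mulr_ge0.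
  rewrite (powRM q (ler0n R 2) tb) (powRM q (ler0n R 2) bj).
  rewrite ler_wpM2l ?powR_ge0// -mulr2n -[leLHS]mulr_natl.
  by rewrite ler_wpM2r ?powR_ge0.
apply: (mass_le_series n0 (f := fun k => toC (d k)) (s := fun k => cz_total * (8 * b k) * W)) => //.
- apply/cintegrableP; split => //=.
  by apply: integrable0.
- move=> K; rewrite (eq_bigr (fun k : 'I_K => (8 * cz_total * a * W) * 2 ^- k)); last first.
    by move=> k _; rewrite /b; ring.
  rewrite -mulr_sumr (_ : 16 * cz_total * a * W = (8 * cz_total * a * W) * 2); last by ring.
  rewrite ler_wpM2l ?sum_geometric// !mulr_ge0 ?(ltW W0) ?(ltW a0) ?(ltW cz_total_gt0)//.
move=> e e0.
have eW0 : 0 <= 2 * a * W / e by rewrite divr_ge0 ?mulr_ge0 ?(ltW W0) ?(ltW a0) ?(ltW e0).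
(* A partial sum of [K + 1] terms telescopes to [h K]; the choice gives K > 2 * a * W / e, and 2^K >
   K. *)
exists (Num.trunc (2 * a * W / e)).+2 => -[//|K]; rewrite ltnS => NK.
have small : 2 * b K * W < e.
  have /andP[_ h2] := truncn_itv eW0.
  rewrite /b (_ : _ * _ * W = (2 * a * W) / 2 ^+ K); last by ring.
  rewrite ltr_pdivrMr ?exprn_gt0//; move: h2; rewrite ltr_pdivrMr// => h2.
  apply: (lt_le_trans h2); rewrite mulrC ler_wpM2l ?(ltW e0)//.
  rewrite -natrX ler_nat; apply: (leq_trans NK); exact: ltnW (ltn_expl _ _).
rewrite cLnorm1.
(* [powR_young] at the height [b K]: each of the two terms then contributes at most [b K * W]. *)
apply: (@le_lt_trans _ _ (\int[mu]_x (b K * \1_Q0 x + b K `^ (1 - q) * (`|f x - h K x| `^ q))%:E)%E).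
  have mfh : measurable_fun setT (fun x => f x - h K x) by exact: measurable_funB.
  rewrite (_ : (fun x => _) = toC (fun x => f x - h K x)); last first.
    apply/funext => x; rewrite /toC -(sumd K x) rmorphB rmorph_sum //.
  apply: ae_ge0_le_integral => //.
  - by move=> x _; rewrite lee_fin cabs_ge0.
  - by apply/measurable_EFinP; apply: measurable_cabs; exact: cmeasurable_toC.
  - by move=> x _; rewrite lee_fin addr_ge0// mulr_ge0 ?powR_ge0// ltW.
  - apply/measurable_EFinP; apply: measurable_funD; apply: measurable_funM => //.
      by apply: measurable_indic; exact: measurable_cell.
    exact: measurable_powRnorm.
  apply: filterS sf => x sx _; rewrite lee_fin cabs_toC indicE.
  have [xQ|nxQ] := pselect (Q0 x); first by rewrite mem_set// mulr1 powR_young.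
  by rewrite memNset// sx// sh// subrr normr0 mulr0 add0r mulr_ge0 ?powR_ge0.
have mfh : measurable_fun setT (fun x => f x - h K x) by exact: measurable_funB.
have mi : measurable_fun setT (\1_Q0 : Rn -> R).
  by apply: measurable_indic; exact: measurable_cell.
have bK := ltW (b0 K).
under eq_integral do rewrite EFinD !EFinM.
rewrite ge0_integralD//; last 4 first.
- by move=> x _; rewrite -EFinM lee_fin mulr_ge0.
- by apply/measurable_EFinP; exact: measurable_funM.
- by move=> x _; rewrite -EFinM lee_fin mulr_ge0 ?powR_ge0.
- by apply/measurable_EFinP; apply: measurable_funM => //; exact: measurable_powRnorm.
rewrite ge0_integralZl//; last exact/measurable_EFinP.
rewrite ge0_integralZl//; first last.
- by rewrite lee_fin powR_ge0.
- by apply/measurable_EFinP; exact: measurable_powRnorm.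
rewrite integral_indic ?setIT//; last exact: measurable_cell.
apply: (@le_lt_trans _ _ ((b K)%:E * W%:E + (b K `^ (1 - q))%:E * (b K `^ q * W)%:E)%E).
  apply: leeD.
    by rewrite [X in (_ * X)%E](lebesgue_cell s0).
  by apply: lee_wpmul2l; [rewrite lee_fin powR_ge0|apply: ltW; exact: hm].
rewrite -!EFinM -EFinD lte_fin mulrA -powRD; last by apply/implyP => _; rewrite gt_eqF.
rewrite subrK powRr1//; lra.
Qed.

End atomic_norm_of_Lq.

(** * Operators bounded on (1,q)-atoms *)

Section Lq_functions.
Variables (R : realType) (n : nat).
Local Notation Rn := 'rV[R]_n.
Local Notation mu := (lebesgue_rV R n).
Local Notation nrm := (@ComplexField.Normc.normc R).
Local Notation ball := (@euclidean_closed_ball R n).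
Implicit Types (f g h a : Rn -> R[i]) (u v : Rn -> R) (q : R).

Lemma Iq_le q u v : 0 <= q -> measurable_fun setT u -> measurable_fun setT v ->
  {ae mu, forall x, `|u x| <= `|v x|} -> (Iq q u <= Iq q v)%E.
Proof.
move=> q0 mu' mv uv; apply: ae_ge0_le_integral => //.
- by apply/measurable_EFinP; exact: measurable_powRnorm.
- by apply/measurable_EFinP; exact: measurable_powRnorm.
apply: filterS uv => x uv _; rewrite lee_fin.
by apply: ge0_ler_powR; rewrite ?nnegrE.
Qed.

Lemma Iq_indicZ_lty q c (A : set Rn) : 1 < q -> measurable A -> (mu A < +oo)%E ->
  (Iq q (fun x => c * \1_A x)%R < +oo)%E.
Proof.
move=> q1 mA Aoo; have mi : measurable_fun setT (\1_A : Rn -> R) by exact: measurable_indic.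
by rewrite (Iq_Z q c mi) (Iq_indic q1 mA); exact: (lte_mul_pinfty _ _ Aoo).
Qed.

Lemma Iq_cabsE q f : Iq q (cabs f) = (\int[mu]_x (cabs f x `^ q)%:E)%E.
Proof. by apply: eq_integral => x _; rewrite ger0_norm ?cabs_ge0. Qed.

Lemma le_powRM q (v w : R) : 0 < q -> 0 <= v -> 0 < w ->
  exists2 a, 0 < a & v <= a `^ q * w.
Proof.
move=> q0 v0 w0; have vw : 0 < v / w + 1 by rewrite ltr_wpDl// divr_ge0// ltW.
exists ((v / w + 1) `^ q^-1); first exact: powR_gt0.
rewrite -powRrM mulVf ?gt_eqF// powRr1 ?(ltW vw)// mulrDl mul1r divfK ?gt_eqF//.
by rewrite lerDl ltW.
Qed.

Lemma sub_cube c (r r' : R) : r <= r' -> cube c r `<=` (cube c r' : set Rn).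
Proof. by move=> rr x h i; exact: le_trans (h i) rr. Qed.

Lemma ball_sub_cube0 c r : exists r', ball c r `<=` cube 0 r'.
Proof.
exists (r + \sum_i `|c ord0 i|) => x /ball_sub_cube h i; rewrite mxE subr0.
rewrite -[x ord0 i](subrK (c ord0 i)); apply: (le_trans (ler_normD _ _)).
by apply: lerD; rewrite ?h// (bigD1 i)//= lerDl sumr_ge0.
Qed.

(** An explicit form of [H1q_fin q], in which membership is checked without exhibiting atoms. *)
Definition Lq0 q : set (Rn -> R[i]) := [set f | [/\ cintegrable f, cintegral f = 0,
  exists r, {ae mu, forall x, ~ cube 0 r x -> f x = 0} & (Iq q (cabs f) < +oo)%E]].

Lemma cintegrable0 : cintegrable (fun _ : Rn => 0 : R[i]).
Proof. by apply/cintegrableP; split => /=; exact: integrable0. Qed.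

Lemma csubspace_Lq0 q : 1 < q -> csubspace (Lq0 q).
Proof.
move=> q1; have q0 : 0 < q by exact: lt_trans q1.
split.
  split; [exact: cintegrable0|exact: cintegral0|by exists 0; apply: aeW|].
  rewrite Iq_cabsE /cabs normc_0.
  by under eq_integral do rewrite powR0 ?gt_eqF//; rewrite integral0.
move=> k f g [f1 f0 [r hr] fq] [g1 g0 [r' hr'] gq].
have kf := cintegrableZ k f1; have fg := cintegrableD kf g1.
have [[mf _] [mg _] [mfg _]] := And3 f1 g1 fg.
have [mcf mcg mcfg] := And3 (measurable_cabs mf) (measurable_cabs mg) (measurable_cabs mfg).
have mkf : measurable_fun setT (fun x => nrm k * cabs f x) by exact: measurable_funM.
split; first exact: fg.
- by rewrite cintegralD// cintegralZ// f0 g0 mulr0 addr0.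
- exists (Num.max r r'); apply: filterS2 hr hr' => x hx hx' nx.
  rewrite hx ?hx' ?mulr0 ?addr0// => xr; apply: nx.
    by apply: sub_cube xr; rewrite le_max lexx orbT.
  by apply: sub_cube xr; rewrite le_max lexx.
apply: (@le_lt_trans _ _ (Iq q (fun x => nrm k * cabs f x + cabs g x))).
  apply: Iq_le => //; [exact: ltW|exact: measurable_funD|].
  apply: aeW => x; rewrite !ger0_norm ?cabs_ge0 ?addr_ge0 ?mulr_ge0 ?normc_ge0 ?cabs_ge0//.
  by rewrite -normc_M normc_D.
apply: (le_lt_trans (Iq_D q1 mkf mcg)); apply: lte_mul_pinfty => //.
apply: lte_add_pinfty; last exact: gq.
by rewrite (Iq_Z q (nrm k) mcf); exact: (lte_mul_pinfty _ _ fq).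
Qed.

Lemma csubspace_lincomb (D : set (Rn -> R[i])) N (lam : 'I_N -> R[i]) (a : 'I_N -> Rn -> R[i]) :
  csubspace D -> (forall j, D (a j)) -> D (lincomb lam a).
Proof.
move=> hD; rewrite /lincomb; elim: N lam a => [|N IH] lam a Da.
  rewrite (_ : (fun _ => _) = (fun=> 0)); first exact: hD.1.
  by apply/funext => x; rewrite big_ord0.
rewrite (_ : (fun _ => _) = (fun x => lam ord0 * a ord0 x +
    \sum_(j < N) (lam \o lift ord0) j * (a \o lift ord0) j x)).
  by apply: hD.2 => //; apply: IH => j; exact: Da.
by apply/funext => x; rewrite big_ord_recl.
Qed.

Hypothesis n0 : (0 < n)%N.

Lemma atom_Lq0 q a : 1 < q -> atom q%:E a -> Lq0 q a.
Proof.
move=> q1 /(atom_q_data n0 q1)[c [r [r0 a1 a0 ar aq]]]; split; [exact: a1|exact: a0| |].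
  have [r' hr'] := ball_sub_cube0 c r; exists r'.
  by apply: filterS ar => x hx nx; apply: hx => /hr'.
by rewrite Iq_cabsE.
Qed.

Lemma atom_oo_Lq0 q a : 1 < q -> atom +oo%E a -> Lq0 q a.
Proof.
move=> q1 /(atom_oo_ae n0)[c [r [r0 a1 a0 ar aM]]]; split; [exact: a1|exact: a0| |].
  have [r' hr'] := ball_sub_cube0 c r; exists r'.
  by apply: filterS ar => x hx nx; apply: hx => /hr'.
have q0 : 0 < q by exact: lt_trans q1.
have [ma _] := a1; have mca := measurable_cabs ma.
apply: (@le_lt_trans _ _ (Iq q (fun x => (vol c r)^-1 * \1_(ball c r) x))).
  apply: Iq_le => //; first exact: ltW.
    have mi : measurable_fun setT (\1_(ball c r) : Rn -> R).
      by apply: measurable_indic; exact: measurable_euclidean_ball.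
    exact: measurable_funM.
  apply: filterS2 ar aM => x ar aM; rewrite indicE.
  have [xB|nxB] := pselect (ball c r x).
    by rewrite mem_set// mulr1 !ger0_norm ?cabs_ge0// invr_ge0 vol_ge0.
  by rewrite memNset// mulr0 /cabs ar// normc_0 normr0.
by apply: Iq_indicZ_lty => //; [exact: measurable_euclidean_ball|exact: lebesgue_ball_lty].
Qed.

Lemma Lq0_atom q r f (N : R) : 1 < q -> 0 < r -> 0 < N -> cintegrable f -> cintegral f = 0 ->
  {ae mu, forall x, ~ cube 0 r x -> f x = 0} ->
  (Iq q (cabs f) <= (N `^ q * vol (0 : Rn) (n%:R * r) `^ (1 - q))%:E)%E ->
  atom q%:E (fun x => (N^-1)%:C * f x).
Proof.
move=> q1 r0 N0 f1 f0 fr fq.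
have nr0 : 0 < n%:R * r by rewrite mulr_gt0// ltr0n.
have fr' : {ae mu, forall x, ~ ball 0 (n%:R * r) x -> f x = 0}.
  by apply: filterS fr => x hx nx; apply: hx => /(cube_sub_ball (ltW r0)).
apply: (atom_q_scale n0 q1 nr0 N0 f1.1 fr' f0 f1).
by rewrite -Iq_cabsE.
Qed.

Lemma unscale (N : R) f : 0 < N -> f = (fun x => N%:C * ((N^-1)%:C * f x)).
Proof.
move=> N0; apply/funext => x; rewrite mulrA -rmorphM /= divff ?gt_eqF//.
by rewrite rmorph1 mul1r.
Qed.

Lemma Lq0_support q f : Lq0 q f -> exists2 r, 0 < r & {ae mu, forall x, ~ cube 0 r x -> f x = 0}.
Proof.
move=> [_ _ [r hr] _]; exists (Num.max r 1); first by rewrite lt_max ltr01 orbT.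
by apply: filterS hr => x hx nx; apply: hx => xr; apply: nx; apply: sub_cube xr; rewrite le_max lexx.
Qed.

(** One atom is enough: a function of mean zero in L^q with bounded support is a multiple of a
    single (1,q)-atom. *)
Lemma H1q_finE q : 1 < q -> H1q_fin q%:E = Lq0 q.
Proof.
move=> q1; have q0 : 0 < q by exact: lt_trans q1.
apply/seteqP; split => [f [N [lam [a [ha ->]]]]|f hf].
  by apply: csubspace_lincomb => [|j]; [exact: csubspace_Lq0|exact: atom_Lq0].
have [r r0 fr] := Lq0_support hf; have [f1 f0 _ fq] := hf.
have w0 : 0 < vol (0 : Rn) (n%:R * r) `^ (1 - q).
  by rewrite powR_gt0// vol_gt0// mulr_gt0// ltr0n.
have fq0 : 0 <= fine (Iq q (cabs f)) by rewrite fine_ge0// Iq_ge0.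
have [N N0 hN] := le_powRM q0 fq0 w0.
exists 1%N, (fun=> N%:C), (fun _ x => (N^-1)%:C * f x); split.
  move=> _; apply: (Lq0_atom q1 r0) => //.
  by rewrite -[leLHS]fineK ?lee_fin// ge0_fin_numE// Iq_ge0.
by rewrite /lincomb {1}(unscale f N0); apply/funext => x; rewrite big_ord1.
Qed.

Lemma mass_le_ReIm M M' f : mass_le M (toC (fun x => complex.Re (f x))) ->
  mass_le M' (toC (fun x => complex.Im (f x))) -> mass_le (M' + M) f.
Proof.
move=> hr hi; have := mass_le_lin n0 (0 +i* 1) hi hr.
rewrite (_ : nrm _ = 1); last by rewrite /= expr0n add0r expr1n sqrtr1.
rewrite mul1r; congr mass_le; apply/funext => x; rewrite /toC; case: (f x) => b c.
by apply/eqP; rewrite eq_complex /=; apply/andP; split; apply/eqP; ring.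
Qed.

(** The enlargement to [r + 1] places the closed cube of radius [r] inside the half-open cell of
    generation 0. *)
Lemma Iq_part q r f u : 1 < q -> 0 < r -> cmeasurable f ->
  {ae mu, forall x, ~ cube 0 r x -> f x = 0} -> measurable_fun setT u ->
  (forall x, `|u x| <= cabs f x) ->
  supported (r + 1) u /\ (Iq q u <= Iq q (cabs f))%E.
Proof.
move=> q1 r0 mf fr mu' uf; have s0 : 0 < r + 1 by rewrite addr_gt0.
split; last first.
  apply: Iq_le => //; first exact: ltW (lt_trans _ q1); first exact: measurable_cabs.
  by apply: aeW => x; rewrite [leRHS]ger0_norm ?cabs_ge0.
apply: filterS fr => x hx nx.
suff fx : f x = 0 by apply/normr0_eq0/le_anti; rewrite normr_ge0 andbT (le_trans (uf x))// /cabs fx normc_0.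
apply: hx => xr; apply: nx; apply/(cell0P s0) => i; have := xr i.
by rewrite mxE subr0 ler_norml => /andP[h1 h2]; apply/andP; split; lra.
Qed.

Lemma mass_le_Lq0 q r : 1 < q -> 0 < r -> exists C W, [/\ 0 < C, 0 < W &
  forall f (a : R), cintegrable f -> cintegral f = 0 ->
    {ae mu, forall x, ~ cube 0 r x -> f x = 0} -> 0 < a ->
    (Iq q (cabs f) <= (a `^ q * W)%:E)%E -> mass_le (C * a) f].
Proof.
move=> q1 r0; have q0 : 0 < q by exact: lt_trans q1.
have s0 : 0 < r + 1 by rewrite addr_gt0.
pose W := side (r + 1) 0 ^+ n; have W0 : 0 < W by rewrite exprn_gt0// side_gt0.
have cz0 := @cz_total_gt0 R n q n0 q1.
exists (2 * (16 * cz_total n q * W)), W; split => //; first by rewrite !mulr_gt0.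
move=> f a f1 f0 fr a0 fq.
have /cintegrableP[fr1 fi1] := f1; have [mf _] := f1; have [mfr mfi] := mf.
have part (u : Rn -> R) : measurable_fun setT u -> \int[mu]_x u x = 0 ->
    (forall x, `|u x| <= cabs f x) -> mass_le (16 * cz_total n q * a * W) (toC u).
  move=> mu' u0 uf; have [us uq] := Iq_part q1 r0 mf fr mu' uf.
  exact: (mass_le_Lq n0 s0 q1 mu' us u0 a0 (le_trans uq fq)).
have [fr0 fi0] : \int[mu]_x complex.Re (f x) = 0 /\ \int[mu]_x complex.Im (f x) = 0.
  by move: f0 => /eqP; rewrite eq_complex /= => /andP[/eqP -> /eqP ->].
have := mass_le_ReIm (part _ mfr fr0 (fun x => Re_le_normc (f x)))
  (part _ mfi fi0 (fun x => Im_le_normc (f x))).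
by congr mass_le; ring.
Qed.

Lemma Lq0_H1 q f : 1 < q -> Lq0 q f -> H1 f.
Proof.
move=> q1 hf; have q0 : 0 < q by exact: lt_trans q1.
have [r r0 fr] := Lq0_support hf; have [f1 f0 _ fq] := hf.
have [C [W [C0 W0 hC]]] := mass_le_Lq0 q1 r0.
have fq0 : 0 <= fine (Iq q (cabs f)) by rewrite fine_ge0// Iq_ge0.
have [a a0 ha] := le_powRM q0 fq0 W0.
apply: (mass_le_H1 (hC f a f1 f0 fr a0 _)).
by rewrite -[leLHS]fineK ?lee_fin// ge0_fin_numE// Iq_ge0.
Qed.

(** [d] is chosen before [f]: on a fixed cube, convergence in L^q of functions of mean zero implies
    convergence in the atomic norm. *)
Lemma small_Lq0_mass q r e : 1 < q -> 0 < r -> 0 < e -> exists2 d, 0 < d &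
  forall f, cintegrable f -> cintegral f = 0 ->
    {ae mu, forall x, ~ cube 0 r x -> f x = 0} ->
    (Iq q (cabs f) <= d%:E)%E -> mass_le e f.
Proof.
move=> q1 r0 e0; have [C [W [C0 W0 hC]]] := mass_le_Lq0 q1 r0.
have eC : 0 < e / C by rewrite divr_gt0.
exists ((e / C) `^ q * W); first by rewrite mulr_gt0// powR_gt0.
move=> f f1 f0 fr fq; have := hC f _ f1 f0 fr eC fq.
by congr mass_le; rewrite mulrC divfK// gt_eqF.
Qed.

End Lq_functions.

Section extension_from_Lq_atoms.
Variables (R : realType) (n : nat) (Y : completeNormedModType R[i]).
Local Notation Rn := 'rV[R]_n.
Local Notation mu := (lebesgue_rV R n).
Local Notation nrm := (@ComplexField.Normc.normc R).
Implicit Types (f g h a : Rn -> R[i]) (T : (Rn -> R[i]) -> Y).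

Lemma uniformly_bounded_onP (At : set (Rn -> R[i])) T : uniformly_bounded_on At T ->
  exists2 A, 0 <= A & forall a, At a -> Ynorm (T a) <= A.
Proof.
rewrite /uniformly_bounded_on; set S := ereal_sup _ => Soo.
exists `|fine S| => // a ha.
have aS : ((Ynorm (T a))%:E <= S)%E by apply: ereal_sup_ubound; exists a.
apply: le_trans (ler_norm _); rewrite -lee_fin fineK//.
by rewrite fin_numE -ltey Soo andbT gt_eqF// (lt_le_trans _ aS)// ltNyr.
Qed.

Lemma Ynorm_le_scaled (D At : set (Rn -> R[i])) T (A N : R) h :
  csubspace D -> linear_on D T -> (forall a, At a -> Ynorm (T a) <= A) ->
  D h -> 0 < N -> At (fun x => (N^-1)%:C * h x) -> Ynorm (T h) <= A * N.
Proof.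
move=> hD hT hA Dh N0 /hA; rewrite (linear_onZ hD hT)// Ynorm_Z normc_real.
by rewrite ger0_norm ?invr_ge0 ?(ltW N0)// ler_pdivrMl// mulrC.
Qed.

Hypothesis n0 : (0 < n)%N.
Variables (q : R) (T : (Rn -> R[i]) -> Y).
Hypotheses (q1 : 1 < q) (hT : linear_on (Lq0 q) T).
Hypothesis bT : uniformly_bounded_on (atom q%:E) T.
Local Notation D := (@Lq0 R n q).

Let hD : csubspace D. Proof. exact: csubspace_Lq0. Qed.

Let q0 : 0 < q. Proof. exact: lt_trans q1. Qed.

Lemma Lq0_of_cube h c r M : 0 < r -> 0 < M -> cmeasurable h -> cintegral h = 0 ->
  (forall x, ~ cube c r x -> h x = 0) -> (forall x, cabs h x <= M) -> D h.
Proof.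
move=> r0 M0 mh ih sh hM; have [N0 _ _ ha] := cube_atom n0 r0 M0 mh sh ih hM.
rewrite (unscale h N0); apply: csubspaceZ => //; apply: atom_Lq0 => //.
exact: ha.
Qed.

Lemma Lq0_cfold_mollify (s t : R) k1 g : 0 < s -> 0 < t -> mollifier t k1 ->
  cintegrable g -> cintegral g = 0 -> D (cfold_mollify s k1 g).
Proof.
move=> s0 t0 mol g1 g0.
have I0 : 0 <= \int[mu]_y cabs g y by apply: Rintegral_ge0 => x _; exact: cabs_ge0.
apply: (@Lq0_of_cube _ 0 (s + t) (2 * (t^-1 ^+ n * \int[mu]_y cabs g y) + 1)).
- by rewrite addr_gt0.
- by rewrite ltr_wpDl// !mulr_ge0// exprn_ge0// invr_ge0 ltW.
- by have [] := cintegrable_cfold_mollify s0 mol g1.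
- by rewrite (cintegral_cfold_mollify s0 mol).
- by move=> x; apply: (cfold_mollify_support s0 mol); case: g1.
by move=> x; apply: (le_trans (cfold_mollify_le s0 t0 mol x g1)); rewrite lerDl.
Qed.

(** [f] and its average are supported in a common cube, so their difference is one multiple of a
    (1,q)-atom, with a factor that is small when the L^q distance is. *)
Lemma Lq0_dyadic_approx f (A e : R) : 0 <= A -> (forall a, atom q%:E a -> Ynorm (T a) <= A) ->
  D f -> 0 < e -> exists s m, [/\ 0 < s, side s m <= s &
    Ynorm (T (fun x => f x - cfold_mollify s (grid_kernel s (side s m)) f x)) <= e].
Proof.
move=> A0 hA Df e0; have [r r0 fr] := Lq0_support Df; have [f1 f0 _ fq] := Df.
have s0 : 0 < r + 1 by rewrite addr_gt0.
set s := r + 1 in s0 *.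
have rho0 : 0 < s + s by rewrite addr_gt0.
have w0 : 0 < vol (0 : Rn) (n%:R * (s + s)) `^ (1 - q).
  by rewrite powR_gt0// vol_gt0// mulr_gt0// ltr0n.
have N0 : 0 < e / (A + 1) by rewrite divr_gt0// ltr_wpDl.
set N := e / (A + 1) in N0 *.
(* [d] is the bound on the integral of |f - K f|^q that corresponds to the factor [N]; [E0] accounts
   for the splitting into real and imaginary parts. *)
pose d := N `^ q * vol (0 : Rn) (n%:R * (s + s)) `^ (1 - q).
have d0 : 0 < d by rewrite mulr_gt0// powR_gt0.
pose E0 := 2 `^ q * 2; have E00 : 0 < E0 by rewrite mulr_gt0// powR_gt0.
have dE : 0 < d / E0 by rewrite divr_gt0.
have /cintegrableP[fr1 fi1] := f1; have [mf _] := f1; have [mfr mfi] := mf.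
have part (u : Rn -> R) : measurable_fun setT u -> (forall x, `|u x| <= cabs f x) ->
    exists m0, forall m, (m0 <= m)%N -> (Iq q (fun x => u x - dyadic s m u x)%R < (d / E0)%:E)%E.
  move=> mu' uf; have [us uq] := Iq_part q1 r0 mf fr mu' uf.
  exact: (cvg_dyadic s0 q1 mu' us (le_lt_trans uq fq) dE).
have [mr hr] := part _ mfr (fun x => Re_le_normc (f x)).
have [mi hi] := part _ mfi (fun x => Im_le_normc (f x)).
(* A generation of at least 1 ensures [side s m <= s], because [side s 0 = 2 * s]. *)
pose m := (maxn mr mi).+1.
have {}hr : (Iq q (fun x => complex.Re (f x) - dyadic s m (fun y => complex.Re (f y)) x)%R < (d / E0)%:E)%E.
  by apply: hr; apply: leqW; exact: leq_maxl.
have {}hi : (Iq q (fun x => complex.Im (f x) - dyadic s m (fun y => complex.Im (f y)) x)%R < (d / E0)%:E)%E.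
  by apply: hi; apply: leqW; exact: leq_maxr.
have t0 : 0 < side s m by exact: side_gt0.
have ts : side s m <= s.
  rewrite /side ler_pdivrMr ?exprn_gt0// mulrC ler_wpM2l ?(ltW s0)//.
  by rewrite /m exprS ler_peMr// exprn_ege1// ler1n.
have mol : mollifier (side s m) (grid_kernel s (side s m)) by exact: mollifier_grid.
exists s, m; set K := cfold_mollify _ _ f.
have Kf1 : cintegrable K by exact: (cintegrable_cfold_mollify s0 mol).
have supK x : ~ cube 0 (s + side s m) x -> K x = 0.
  exact: (cfold_mollify_support s0 mol).
have DK : D K by exact: (Lq0_cfold_mollify s0 t0 mol f1 f0).
split => //.
have Dg : D (fun x => f x - K x) by exact: csubspaceB.
apply: (@le_trans _ _ (A * N)); last first.
  by rewrite /N mulrA ler_pdivrMr ?ltr_wpDl// mulrC ler_wpM2l ?lerDl// ltW.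
apply: (Ynorm_le_scaled hD hT hA Dg N0).
have [g1 g0 _ _] := Dg.
apply: (Lq0_atom n0 q1 rho0 N0 g1 g0).
  apply: filterS fr => x hx nx; rewrite hx ?supK ?subrr//.
    by move=> xc; apply: nx; apply: sub_cube xc; rewrite lerD2l.
  by move=> xc; apply: nx; apply: sub_cube xc; rewrite /s; lra.
have mKr : measurable_fun setT (dyadic s m (fun y => complex.Re (f y))) by case: Kf1 => -[].
have mKi : measurable_fun setT (dyadic s m (fun y => complex.Im (f y))) by case: Kf1 => -[].
set ur := (fun x => complex.Re (f x) - _) in hr.
set ui := (fun x => complex.Im (f x) - _) in hi.
have mur : measurable_fun setT ur by exact: measurable_funB.
have mui : measurable_fun setT ui by exact: measurable_funB.
have mnr : measurable_fun setT (fun x => `|ur x|) by exact: measurableT_comp.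
have mni : measurable_fun setT (fun x => `|ui x|) by exact: measurableT_comp.
apply: (@le_trans _ _ (Iq q (fun x => `|ur x| + `|ui x|))).
  apply: Iq_le; [exact: ltW|apply: measurable_cabs; by case: g1|exact: measurable_funD|].
  apply: aeW => x; rewrite (ger0_norm (cabs_ge0 _ _)) [leRHS]ger0_norm ?addr_ge0//.
  apply: (le_trans (normc_le_ReIm _)); rewrite /ur /ui /K /cfold_mollify.
  by case: (f x).
have Iabs u : Iq q (fun x : Rn => `|u x| : R) = Iq q u.
  by apply: eq_integral => x _; rewrite normr_id.
apply: (le_trans (Iq_D q1 mnr mni)); rewrite !Iabs.
apply: (@le_trans _ _ ((2 `^ q)%:E * ((d / E0)%:E + (d / E0)%:E))%E).
  by apply: lee_wpmul2l; [rewrite lee_fin powR_ge0|exact: leeD (ltW hr) (ltW hi)].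
rewrite [leLHS](_ : _ = (2 `^ q * (d / E0 + d / E0))%:E)// lee_fin le_eqVlt; apply/orP; left.
by apply/eqP; rewrite -/d /E0; field; rewrite gt_eqF// powR_gt0.
Qed.

(** T f = T (f - K f) + T (K f): the first term is below any given [e], and the second is bounded by
    the mass with a constant that does not depend on the cube and the width chosen for [e]. *)
Lemma Lq0_operator_bound : exists2 C, 0 <= C &
  forall f M, D f -> mass_le M f -> Ynorm (T f) <= C * M.
Proof.
have [A A0 hA] := uniformly_bounded_onP bT.
exists (A * fold_atom_const R n) => [|f M Df [f1 [lam [a [ha m]]]]].
  by rewrite !mulr_ge0// exprn_ge0// mulr_ge0// exprn_ge0.
apply/ler_addgt0Pr => e e0.
have [s [k [s0 ts hK]]] := Lq0_dyadic_approx A0 hA Df e0.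
have t0 : 0 < side s k by exact: side_gt0.
have mol : mollifier (side s k) (grid_kernel s (side s k)) by exact: mollifier_grid.
set K := cfold_mollify s (grid_kernel s (side s k)) in hK *.
have [_ f0 _ _] := Df.
have DK g : cintegrable g -> cintegral g = 0 -> D (K g).
  exact: (Lq0_cfold_mollify s0 t0 mol).
have TK : Ynorm (T (K f)) <= A * fold_atom_const R n * M.
  apply: (bound_cfold_mollify n0 s0 t0 ts mol hD hT A0 _ DK f1 f0 ha m).
  move=> h c r B Dh r0 B0 mh ih sh hB.
  have [N0 _ _ hN] := cube_atom n0 r0 B0 mh sh ih hB.
  exact: (Ynorm_le_scaled hD hT hA Dh N0 (hN q q1)).
rewrite (_ : T f = T (fun x => f x - K f x) + T (K f)); last first.
  by rewrite (linear_onB hT Df (DK f f1 f0)) subrK.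
by apply: (le_trans (Ynorm_D _ _)); rewrite [leRHS]addrC; exact: lerD hK TK.
Qed.

(** A (1,oo)-atom belongs to [Lq0 q], so the partial sums of a decomposition lie in the domain. *)
Lemma Lq0_dense g e : H1 g -> 0 < e -> exists2 f, D f & mass_le e (fun x => g x - f x).
Proof.
move=> /(H1_mass_le)[M hM] e0.
have [N [lam [a [ha hN]]]] := mass_le_tail n0 hM e0.
exists (lincomb (fun j : 'I_N => lam j) (fun j : 'I_N => a j)) => //.
by apply: csubspace_lincomb => // j; exact: atom_oo_Lq0.
Qed.

Lemma Lq0_extension : has_unique_H1_extension D T.
Proof.
have [C C0 hC] := Lq0_operator_bound.
apply: (H1_extension n0 hD hT C0 _ hC Lq0_dense) => f.
exact: (Lq0_H1 n0 q1).
Qed.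

End extension_from_Lq_atoms.

(** * Operators bounded on continuous (1,oo)-atoms *)

Section continuity.
Variables (R : realType) (n : nat).
Local Notation Rn := 'rV[R]_n.
Local Notation mu := (lebesgue_rV R n).
Local Notation nrm := (@ComplexField.Normc.normc R).
Local Notation ball := (@euclidean_closed_ball R n).
Implicit Types (f g h a : Rn -> R[i]) (x y : Rn).

Definition cube_continuous f : Prop := forall x (e : R), 0 < e ->
  exists2 d, 0 < d & forall y, cube x d y -> nrm (f y - f x) <= e.

Lemma cube_sym x y (d : R) : cube x d y -> cube y d x.
Proof. by move=> h i; rewrite distrC. Qed.

Lemma nbhs_cubeP x (A : set Rn) :
  nbhs x A <-> exists2 d : R, 0 < d & cube x d `<=` A.
Proof.
split=> [/nbhs_ballP[e /= e0 eA]|[d d0 dA]].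
  exists (e / 2); first by rewrite divr_gt0.
  move=> y xy; apply: eA; split => // i j; rewrite (ord1 i) /=.
  by apply: (le_lt_trans (cube_sym xy j)); rewrite gtr_pMr// invf_lt1// ltr1n.
apply/nbhs_ballP; exists d => // y [_ xy]; apply: dA => i.
by have := xy ord0 i; rewrite distrC => /ltW.
Qed.

Lemma continuous_cubeP f : continuous (f : Rn -> R[i]^o) <-> cube_continuous f.
Proof.
split=> [cf x e e0|cf x].
  have /cvgrPdist_le/(_ e%:C) h := cf x.
  have /h : 0 < e%:C by rewrite ltcR.
  move=> /nbhs_cubeP[d d0 hd]; exists d => // y /hd /=.
  by rewrite distrC normrE_normc lecR.
have FF : Filter (nbhs x) by exact: nbhs_filter.
apply/cvgrPdist_le => e e0.
have eE : e = (complex.Re e)%:C by rewrite RRe_real// gtr0_real.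
have [|d d0 hd] := cf x (complex.Re e); first by rewrite -ltcR -eE.
apply/nbhs_cubeP; exists d => // y /hd; rewrite -lecR -eE => h /=.
by rewrite distrC normrE_normc.
Qed.

Lemma compact_cube c (r : R) : compact (cube c r : set Rn).
Proof.
rewrite (_ : cube c r = [set v : Rn | forall i, `[c ord0 i - r, c ord0 i + r]%classic (v ord0 i)]).
  by apply: (@rV_compact R n (fun i => `[c ord0 i - r, c ord0 i + r]%classic)) => i;
    exact: segment_compact.
by apply/seteqP; split => x /= h i; have := h i; rewrite /= in_itv/= ler_distl.
Qed.

(** Heine-Cantor on the cube. If only one of the two points lies in the cube, it serves as base
    point; if neither does, both values are 0. *)
Lemma cube_unif_continuous f (r : R) : cube_continuous f ->
  (forall x, ~ cube 0 r x -> f x = 0) -> forall e : R, 0 < e ->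
  exists2 d, 0 < d & forall x y, cube x d y -> nrm (f y - f x) <= e.
Proof.
move=> cf f0 e e0.
pose P (d : R) x := forall y, cube x d y -> nrm (f y - f x) <= e.
have h x : cube 0 r x -> \forall x' \near x & d \near (0 : R)^'+, P d x'.
  move=> _; have e2 : 0 < e / 2 by rewrite divr_gt0.
  have [d d0 hd] := cf x _ e2; have d2 : 0 < d / 2 by rewrite divr_gt0.
  exists (cube x (d / 2), [set d' | d' <= d / 2]).
    by split; [apply/nbhs_cubeP; exists (d / 2)|apply: nbhs_right_le].
  move=> [x' d'] /= [xx' d'd] y x'y.
  rewrite (_ : f y - f x' = (f y - f x) + - (f x' - f x)); last by rewrite opprB addrA subrK.
  apply: (le_trans (normc_D _ _)); rewrite normc_N (splitr e); apply: lerD; apply: hd.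
    move=> i; rewrite -[y ord0 i](subrK (x' ord0 i)) -addrA.
    apply: (le_trans (ler_normD _ _)); rewrite (splitr d); apply: lerD; last exact: xx'.
    exact: le_trans (x'y i) d'd.
  by apply: sub_cube xx'; rewrite ler_pdivrMr// ler_pMr// ler1n.
have := (compact_near_coveringP _).1 (@compact_cube 0 r) R (0 : R)^'+ P _ h.
move=> /(_ _)/nbhs_right0P; case => d /= d0 hd.
have d2 : 0 < d / 2 by rewrite divr_gt0.
have {}hd x : cube 0 r x -> P (d / 2) x.
  have : ball_ [eta Num.Def.normr] 0 d (d / 2).
    rewrite /= sub0r normrN ger0_norm ?(ltW d2)//.
    by rewrite gtr_pMr// invf_lt1// ltr1n.
  by move=> /hd/(_ d2); rewrite add0r; apply.
exists (d / 2) => // x y xy.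
have [xr|nxr] := pselect (cube 0 r x); first exact: hd.
have [yr|nyr] := pselect (cube 0 r y); last by rewrite !f0// subrr normc_0 ltW.
by rewrite -normc_N opprB; apply: (hd y yr); exact: cube_sym.
Qed.

(** Cubes have positive measure, so what holds almost everywhere holds at points arbitrarily close
    to any given one. For continuous functions this makes the almost everywhere clauses of [atom]
    pointwise. *)
Lemma ae_cube (P : Rn -> Prop) x (d : R) : {ae mu, forall y, P y} -> 0 < d ->
  exists2 y, cube x d y & P y.
Proof.
move=> [N [mN N0 hN]] d0; apply: contrapT => nP.
have : (mu (cube x d) <= mu N)%E.
  apply: le_measure; rewrite ?inE//; first exact: measurable_cube.
  by move=> y xy; apply: hN => Py; apply: nP; exists y.
by rewrite [X in (_ <= X)%E]N0 lebesgue_cube ?(ltW d0)// lee_fin leNgt exprn_gt0// mulr_gt0.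
Qed.

Lemma ae_le_continuous f (M : R) : cube_continuous f ->
  {ae mu, forall x, cabs f x <= M} -> forall x, cabs f x <= M.
Proof.
move=> cf fM x; apply/ler_addgt0Pr => e e0; have [d d0 hd] := cf x e e0.
have [y xy fy] := ae_cube x fM d0.
rewrite /cabs -[f x](subrK (f y)); apply: (le_trans (normc_D _ _)).
by rewrite addrC; apply: lerD => //; rewrite -normc_N opprB; exact: hd.
Qed.

Lemma ae_eq0_continuous f c (r : R) : cube_continuous f ->
  {ae mu, forall x, ~ cube c r x -> f x = 0} -> forall x, ~ cube c r x -> f x = 0.
Proof.
move=> cf f0 x /notin_cube[i xi].
suff : cabs f x <= 0 by move=> h; apply/ComplexField.Normc.eq0_normc/le_anti; rewrite h normc_ge0.
apply/ler_addgt0Pr => e e0; rewrite add0r; have [d d0 hd] := cf x e e0.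
pose d' := Num.min d ((`|x ord0 i - c ord0 i| - r) / 2).
have d'0 : 0 < d' by rewrite lt_min d0 divr_gt0// subr_gt0.
have [y xy fy] := ae_cube x f0 d'0.
have fy0 : f y = 0.
  apply: fy => yc; have := yc i; have := xy i.
  have : d' <= (`|x ord0 i - c ord0 i| - r) / 2 by rewrite ge_min lexx orbT.
  have : `|x ord0 i - c ord0 i| <= `|y ord0 i - x ord0 i| + `|y ord0 i - c ord0 i|.
    rewrite -[x ord0 i - c ord0 i](_ : - (y ord0 i - x ord0 i) + (y ord0 i - c ord0 i) = _); last by ring.
    by apply: (le_trans (ler_normD _ _)); rewrite normrN.
  move: xi; lra.
have : nrm (f y - f x) <= e by apply: hd; apply: sub_cube xy; rewrite ge_min lexx.
by rewrite fy0 sub0r normc_N.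
Qed.

End continuity.

(** Telescoping over the factors; it yields the Lipschitz bound of a tensor product kernel. *)
Lemma norm_prodB_le (R : realDomainType) (I : Type) (r : seq I) (a b : I -> R) (B : R) :
  1 <= B -> (forall i, 0 <= a i <= B) -> (forall i, 0 <= b i <= B) ->
  `|\prod_(i <- r) a i - \prod_(i <- r) b i| <= B ^+ size r * \sum_(i <- r) `|a i - b i|.
Proof.
move=> B1 ha hb; have B0 : 0 <= B by exact: le_trans B1.
have prodB (c : I -> R) l : (forall i, 0 <= c i <= B) ->
    0 <= \prod_(i <- l) c i <= B ^+ size l.
  move=> hc; elim: l => [|i l /andP[IH1 IH2]]; first by rewrite big_nil expr0 ler01 lexx.
  have /andP[c0 cB] := hc i.
  by rewrite big_cons exprS mulr_ge0//=; exact: ler_pM.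
elim: r => [|i r IH]; first by rewrite !big_nil subrr normr0 mulr0.
rewrite !big_cons /= exprS.
have /andP[a0 aB] := ha i; have /andP[b0 bB] := hb i.
have /andP[p0 pB] := prodB a r ha.
rewrite (_ : _ - _ = (a i - b i) * \prod_(j <- r) a j +
  b i * (\prod_(j <- r) a j - \prod_(j <- r) b j)); last by ring.
apply: (le_trans (ler_normD _ _)); rewrite !normrM mulrDr; apply: lerD.
  rewrite (ger0_norm p0) mulrC ler_wpM2r//.
  by apply: (le_trans pB); rewrite ler_peMl// exprn_ge0.
rewrite (ger0_norm b0) -mulrA; apply: ler_pM => //.
Qed.

(** * Averages against hat functions *)

Section hat_mollification.
Variables (R : realType) (n : nat) (s t : R).
Local Notation Rn := 'rV[R]_n.
Local Notation mu := (lebesgue_rV R n).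
Local Notation L1 f := (mu.-integrable setT (EFin \o f)).
Local Notation K := (fold_mollify s (hat_kernel t)).
Local Notation kk := (fold_kernel s (hat_kernel t)).
Hypotheses (s0 : 0 < s) (t0 : 0 < t).
Implicit Types (x y : Rn) (u : Rn -> R).

Let mol : mollifier t (hat_kernel t). Proof. exact: mollifier_hat. Qed.

Let tensor x y : R := \prod_i hat_kernel t (x ord0 i) (y ord0 i).

Let measurable_tensor x : measurable_fun setT (tensor x).
Proof.
have [mk _ _ _] := mol; apply: measurable_prod => i _.
apply: (measurable_coord_comp i (h := hat_kernel t (x ord0 i))).
exact: (measurableT_comp mk (pair1_measurable (x ord0 i))).
Qed.

Let hat01 (a b : R) : 0 <= hat_kernel t a b <= t^-1.
Proof. by have [_ h _ _] := mol. Qed.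

Let tensor_ge0 x y : 0 <= tensor x y.
Proof. by apply: prodr_ge0 => i _; have /andP[] := hat01 (x ord0 i) (y ord0 i). Qed.

(** [mollifier] normalises the mass in the first variable; the symmetry of the hat transfers this to
    [y]. *)
Let integral_tensor x : (\int[mu]_y (tensor x y)%:E = 1)%E.
Proof.
have [mk k01 _ hk] := mol.
rewrite (@integral_rV_prod R n (fun i => hat_kernel t (x ord0 i)) (fun=> 1)).
- by rewrite big1.
- move=> i; exact: (measurableT_comp mk (pair1_measurable (x ord0 i))).
- by move=> i v; have /andP[] := hat01 (x ord0 i) v.
move=> i; rewrite -[RHS](hk (x ord0 i)); apply: eq_integral => v _.
by rewrite /hat_kernel distrC.
Qed.

Let integrable_tensor x : L1 (tensor x).
Proof.
apply/integrableP; split; first by apply/measurable_EFinP; exact: measurable_tensor.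
under eq_integral do rewrite /= ger0_norm//.
by rewrite integral_tensor ltry.
Qed.

Let Rintegral_tensor x : \int[mu]_y tensor x y = 1.
Proof. by rewrite /Rintegral integral_tensor. Qed.

(* Folding does nothing to functions supported in the cube [-s, s]^n, so that
   the average is the usual convolution. *)
Lemma fold_mollify_hat_near u x (c e : R) : L1 u -> (forall y, ~ cube 0 s y -> u y = 0) ->
  (forall y, cube x t y -> `|u y - c| <= e) -> `|K u x - c| <= e.
Proof.
move=> u1 us uc; have [_ _ k0 _] := mol.
have KE : K u x = \int[mu]_y (tensor x y * u y).
  apply: eq_Rintegral => y _; have [ys|nys] := pselect (cube 0 s y); last by rewrite us ?mulr0.
  congr (_ * _); apply: eq_bigr => i _; rewrite fold_id//.
  by have := ys i; rewrite mxE subr0 ler_norml.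
have tu1 : L1 (fun y => tensor x y * u y).
  apply: (integrable_bounded_mul (C := t^-1 ^+ n)) => // y.
  rewrite ger0_norm// -[X in _ ^+ X]card_ord -prodr_const.
  by apply: ler_prod => i _; exact: hat01.
have tc1 : L1 (fun y => c * tensor x y) by exact: integrable_EFinZ.
have te1 : L1 (fun y => e * tensor x y) by exact: integrable_EFinZ.
have eE : e = \int[mu]_y (e * tensor x y) by rewrite RintegralZl// Rintegral_tensor mulr1.
have cE : c = \int[mu]_y (c * tensor x y) by rewrite RintegralZl// Rintegral_tensor mulr1.
rewrite KE {1}cE {1}eE -RintegralB//; apply: norm_Rintegral_le => //.
  exact: (integrable_measurable (integrable_EFinB tu1 tc1)).
apply: aeW => y; rewrite (_ : _ - _ = (u y - c) * tensor x y); last by ring.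
have [xy|nxy] := pselect (cube x t y).
  by rewrite normrM (ger0_norm (tensor_ge0 _ _)) ler_wpM2r// uc.
suff -> : tensor x y = 0 by rewrite !mulr0 normr0.
have [i xi] := notin_cube nxy.
by rewrite /tensor (bigD1 i)//= k0 ?mul0r// distrC.
Qed.

(** The constant depends on [t] and [u], which is harmless: it serves to make the averages
    continuous for fixed [t]. *)
Lemma fold_mollify_hat_lipschitz u : L1 u -> exists2 L, 0 <= L &
  forall x x' (d : R), cube x d x' -> `|K u x' - K u x| <= L * d.
Proof.
move=> u1; pose B := Num.max 1 t^-1.
have B1 : 1 <= B by rewrite le_max lexx.
have B0 : 0 <= B by exact: le_trans B1.
have tB : t^-1 <= B by rewrite le_max lexx orbT.
have ti0 : 0 <= t^-1 ^+ 2 by rewrite exprn_ge0// invr_ge0 ltW.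
have I0 : 0 <= \int[mu]_y `|u y| by apply: Rintegral_ge0.
exists (B ^+ n * (t^-1 ^+ 2 *+ n) * \int[mu]_y `|u y|).
  by rewrite !mulr_ge0 ?exprn_ge0// mulrn_wge0.
move=> x x' d xx'.
have kB (v : Rn) y i : 0 <= hat_kernel t (v ord0 i) (fold s (y ord0 i)) <= B.
  by have /andP[-> /le_trans->] := hat01 (v ord0 i) (fold s (y ord0 i)).
have kL y : `|kk x' y - kk x y| <= B ^+ n * (t^-1 ^+ 2 *+ n) * d.
  apply: (le_trans (norm_prodB_le _ B1 (kB x' y) (kB x y))).
  rewrite [size _](_ : _ = n); last by rewrite -[RHS]card_ord cardE enumT.
  rewrite -mulrA ler_wpM2l ?exprn_ge0//.
  apply: (@le_trans _ _ (\sum_(i < n) (t^-1 ^+ 2 * d))).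
    apply: ler_sum => i _; apply: (le_trans (hat_kernel_lipschitz _ _ _ t0)).
    by rewrite ler_wpM2l.
  by rewrite sumr_const card_ord mulrnAl.
have ku1 (v : Rn) : L1 (fun y => kk v y * u y) by exact: (integrable_kernel_mul s0 mol).
rewrite /fold_mollify -RintegralB//.
have u1n : L1 (fun y => `|u y|) by exact: integrable_norm.
rewrite mulrAC -RintegralZl//; apply: norm_Rintegral_le.
- exact: (integrable_measurable (integrable_EFinB (ku1 x') (ku1 x))).
- exact: integrable_EFinZ.
by apply: aeW => y; rewrite -mulrBl normrM ler_wpM2r.
Qed.

Lemma continuous_cfold_mollify_hat (f : Rn -> R[i]) : cintegrable f ->
  cube_continuous (cfold_mollify s (hat_kernel t) f).
Proof.
move=> /cintegrableP[fr fi].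
have [L L0 hL] := fold_mollify_hat_lipschitz fr.
have [L' L'0 hL'] := fold_mollify_hat_lipschitz fi.
move=> x e e0; have D0 : 0 < L + L' + 1 by rewrite ltr_wpDl// addr_ge0.
exists (e / (L + L' + 1)); first by rewrite divr_gt0.
move=> y xy; apply: (le_trans (normc_le_ReIm _)).
apply: (le_trans (lerD (hL _ _ _ xy) (hL' _ _ _ xy))).
by rewrite -mulrDl mulrCA ger_pMr// ler_pdivrMr// mul1r lerDl.
Qed.

Lemma cfold_mollify_hat_near (f : Rn -> R[i]) x (e : R) : cintegrable f ->
  (forall y, ~ cube 0 s y -> f y = 0) ->
  (forall y, cube x t y -> ComplexField.Normc.normc (f y - f x) <= e) ->
  ComplexField.Normc.normc (f x - cfold_mollify s (hat_kernel t) f x) <= 2 * e.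
Proof.
move=> /cintegrableP[fr fi] fs fe.
rewrite -normc_N opprB; apply: (le_trans (normc_le_ReIm _)).
rewrite mulrDl mul1r /cfold_mollify; case fxE : (f x) => [a b] /=.
have reE y : `|complex.Re (f y) - a| <= ComplexField.Normc.normc (f y - f x).
  by apply: le_trans (Re_le_normc _); rewrite fxE; case: (f y).
have imE y : `|complex.Im (f y) - b| <= ComplexField.Normc.normc (f y - f x).
  by apply: le_trans (Im_le_normc _); rewrite fxE; case: (f y).
apply: lerD; apply: fold_mollify_hat_near => //.
- by move=> y /fs ->.
- by move=> y xy; exact: le_trans (reE y) (fe y xy).
- by move=> y /fs ->.
- by move=> y xy; exact: le_trans (imE y) (fe y xy).
Qed.

End hat_mollification.

(** * Step functions away from the faces of their cells *)

Section off_the_grid.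
Variables (R : realType) (n : nat).
Local Notation Rn := 'rV[R]_n.
Local Notation mu := (lebesgue_rV R n).
Implicit Types (x y : Rn).

(** The hyperplane is exhausted by bounded boxes with one side reduced to a point. *)
Lemma ae_coord_neq (i : 'I_n) (c : R) : {ae mu, forall x, x ord0 i != c}.
Proof.
pose E k (j : 'I_n) : set R :=
  if j == i then [set c] else `[- k.+1%:R, k.+1%:R]%classic.
have mE k j : measurable (E k j).
  by rewrite /E; case: (j == i); [exact: measurable_set1|exact: measurable_itv].
have : mu.-negligible (\bigcup_k [set x : Rn | forall j, E k j (x ord0 j)]).
  apply: negligible_bigcup => k; exists [set x : Rn | forall j, E k j (x ord0 j)].
  split => //; first exact: measurable_rV_box.
  pose c' j : R := if j == i then 0 else k.+1%:R - - k.+1%:R.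
  have Ec j : lebesgue_measure (E k j) = (c' j)%:E.
    rewrite /E /c'; case: (j == i); first exact: lebesgue_measure_set1.
    by rewrite lebesgue_measure_itv /= lte_fin ifT// gtrN.
  apply: (etrans (lebesgue_rV_box (mE k) Ec)).
  by rewrite (bigD1 i)//= /c' eqxx mul0r.
apply: negligibleS => x /= /negP; rewrite negbK => /eqP xc.
have S0 : 0 <= \sum_j `|x ord0 j| by apply: sumr_ge0.
exists (Num.trunc (\sum_j `|x ord0 j|)) => // j; rewrite /E; case: eqP => [->//|_] /=.
rewrite in_itv/= -ler_norml; have /andP[_ /ltW] := truncn_itv S0; apply: le_trans.
by rewrite (bigD1 j)//= lerDl sumr_ge0.
Qed.

(** The left endpoint is the only point of a half-open cell that has no neighbourhood inside it. *)
Lemma locally_in_cell (s w u : R) : 0 < w ->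
  u != (Num.floor ((u + s) / w))%:~R * w - s ->
  exists2 d, 0 < d & forall v, `|v - u| <= d -> Num.floor ((v + s) / w) = Num.floor ((u + s) / w).
Proof.
move=> w0; set k := Num.floor _ => uk.
have /eqP : Num.floor ((u + s) / w) = k by [].
rewrite floor_cell// => /andP[u1 u2].
have {}u1 : k%:~R * w - s < u by rewrite lt_neqAle eq_sym uk.
pose a := k%:~R * w - s; have aE : k%:~R * w + w - s = a + w by rewrite /a; ring.
rewrite -/a in u1; rewrite aE in u2.
exists (Num.min ((u - a) / 2) ((a + w - u) / 2)).
  by rewrite lt_min !divr_gt0// subr_gt0.
move=> v; rewrite le_min !ler_norml => /andP[/andP[v1 _] /andP[_ v2]].
apply/eqP; rewrite floor_cell// aE -/a; apply/andP; split; lra.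
Qed.

Lemma ae_locally_constant (s : R) m (h : Rn -> R) : 0 < s ->
  (forall k x y, cell s m k x -> cell s m k y -> h x = h y) ->
  {ae mu, forall x, exists2 d, 0 < d & forall y, cube x d y -> h y = h x}.
Proof.
move=> s0 hstep; have w0 : 0 < side s m by exact: side_gt0.
(* The faces of the cells lie on countably many hyperplanes, which are enumerated through
   [unpickle]. *)
have : {ae mu, forall x, forall p, if @unpickle ('I_n * int)%type p is Some (i, k)
    then x ord0 i != k%:~R * side s m - s else true}.
  apply: ae_foralln => p; case: unpickle => [[i k]|]; first exact: ae_coord_neq.
  exact: aeW.
apply: filterS => x hx.
have /choice[d hd] : forall i : 'I_n, exists d : R, 0 < d /\ forall v, `|v - x ord0 i| <= d ->
    grid_index s m v = grid_index s m (x ord0 i).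
  move=> i; have := hx (pickle (i, grid_index s m (x ord0 i))); rewrite pickleK.
  by move=> /(locally_in_cell w0)[d d0 hd]; exists d.
have S0 : 0 <= \sum_i (d i)^-1 by apply: sumr_ge0 => i _; rewrite invr_ge0 ltW// (hd i).1.
(* A positive number below all the [d i]. *)
exists (1 + \sum_i (d i)^-1)^-1; first by rewrite invr_gt0 ltr_wpDr.
move=> y xy; apply: (hstep (cell_of s m x)) => // i.
apply: (hd i).2; apply: (le_trans (xy i)); rewrite -[leRHS]invrK lef_pV2 ?posrE.
- rewrite (bigD1 i)//= addrCA lerDl addr_ge0// sumr_ge0// => j _.
  by rewrite invr_ge0 ltW// (hd j).1.
- by rewrite ltr_wpDr.
- by rewrite invr_gt0 (hd i).1.
Qed.

End off_the_grid.

Section continuous_functions.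
Variables (R : realType) (n : nat).
Local Notation Rn := 'rV[R]_n.
Local Notation mu := (lebesgue_rV R n).
Local Notation nrm := (@ComplexField.Normc.normc R).
Implicit Types (f g h a : Rn -> R[i]) (x y : Rn).

(** The counterpart of [Lq0]: an explicit form of the span of the continuous atoms. *)
Definition Cc0 : set (Rn -> R[i]) := [set f | [/\ cintegrable f, cintegral f = 0,
  cube_continuous f, exists r, forall x, ~ cube 0 r x -> f x = 0
  & exists M, forall x, cabs f x <= M]].

Lemma csubspace_Cc0 : csubspace Cc0.
Proof.
split.
  split; [exact: cintegrable0|exact: cintegral0| |by exists 0|].
    by move=> x e e0; exists 1 => // y _; rewrite subrr normc_0 ltW.
  by exists 0 => x; rewrite /cabs normc_0.
move=> k f g [f1 f0 cf [r hr] [M hM]] [g1 g0 cg [r' hr'] [M' hM']].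
have kf := cintegrableZ k f1; have fg := cintegrableD kf g1.
have K0 : 0 < nrm k + 1 by rewrite ltr_wpDl// normc_ge0.
split; first exact: fg.
- by rewrite cintegralD// cintegralZ// f0 g0 mulr0 addr0.
- move=> x e e0; have e2 : 0 < e / 2 by rewrite divr_gt0.
  have [d d0 hd] := cf x (e / 2 / (nrm k + 1)) (divr_gt0 e2 K0).
  have [d' d'0 hd'] := cg x (e / 2) e2.
  exists (Num.min d d'); first by rewrite lt_min d0.
  move=> y xy; rewrite (_ : _ - _ = k * (f y - f x) + (g y - g x)); last by ring.
  apply: (le_trans (normc_D _ _)); rewrite (splitr e); apply: lerD; last first.
    by apply: hd'; apply: sub_cube xy; rewrite ge_min lexx orbT.
  rewrite normc_M; apply: (@le_trans _ _ (nrm k * (e / 2 / (nrm k + 1)))).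
    rewrite ler_wpM2l ?normc_ge0//; apply: hd.
    by apply: sub_cube xy; rewrite ge_min lexx.
  by rewrite mulrCA ger_pMr// ler_pdivrMr// mul1r lerDl.
- exists (Num.max r r') => x nx; rewrite hr ?hr' ?mulr0 ?addr0// => xr; apply: nx.
    by apply: sub_cube xr; rewrite le_max lexx orbT.
  by apply: sub_cube xr; rewrite le_max lexx.
exists (nrm k * M + M') => x; apply: (le_trans (normc_D _ _)).
by rewrite normc_M; exact: lerD (ler_wpM2l (normc_ge0 k) (hM x)) (hM' x).
Qed.

Lemma continuous_atom_Cc0 a : (0 < n)%N -> continuous_atom a -> Cc0 a.
Proof.
move=> n0 [ha /continuous_cubeP ca].
have [c [r [r0 a1 a0 ar aM]]] := atom_oo_ae n0 ha.
have [r' hr'] := ball_sub_cube0 c r.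
split; [exact: a1|exact: a0|exact: ca| |].
  exists r'; apply: ae_eq0_continuous => //.
  by apply: filterS ar => x hx nx; apply: hx => /hr'.
by exists (vol c r)^-1; exact: ae_le_continuous.
Qed.

Lemma Cc0_bounds f : Cc0 f -> exists r M, [/\ 0 < r, 0 < M,
  forall x, ~ cube 0 r x -> f x = 0 & forall x, cabs f x <= M].
Proof.
move=> [_ _ _ [r hr] [M hM]]; exists (Num.max r 1), (Num.max M 1).
split; rewrite ?lt_max ?ltr01 ?orbT//.
  by move=> x nx; apply: hr => xr; apply: nx; apply: sub_cube xr; rewrite le_max lexx.
by move=> x; rewrite le_max hM.
Qed.

Lemma Cc0_atom f c (r M : R) : (0 < n)%N -> Cc0 f -> 0 < r -> 0 < M ->
  (forall x, ~ cube c r x -> f x = 0) -> (forall x, cabs f x <= M) ->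
  let N := M * (2 * (n%:R * r)) ^+ n in
  0 < N /\ continuous_atom (fun x => (N^-1)%:C * f x).
Proof.
move=> n0 Df r0 M0 fr fM N; have [[mf _] f0 _ _ _] := Df.
have [N0 _ ha _] := cube_atom n0 r0 M0 mf fr f0 fM.
split => //; split => //; apply/continuous_cubeP.
by have [] := csubspaceZ csubspace_Cc0 (N^-1)%:C Df.
Qed.

(** As in [H1q_finE], one atom is enough. *)
Lemma continuous_H1_finE : (0 < n)%N -> continuous_H1_fin = Cc0.
Proof.
move=> n0; apply/seteqP; split => [f [N [lam [a [ha ->]]]]|f hf].
  by apply: csubspace_lincomb => [|j]; [exact: csubspace_Cc0|exact: continuous_atom_Cc0].
have [r [M [r0 M0 fr fM]]] := Cc0_bounds hf.
have [N0 ha] := Cc0_atom n0 hf r0 M0 fr fM.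
set N := M * _ in N0 ha; exists 1%N, (fun=> N%:C), (fun _ x => (N^-1)%:C * f x); split => //.
by rewrite /lincomb {1}(unscale f N0); apply/funext => x; rewrite big_ord1.
Qed.

Lemma Cc0_cfold_mollify_hat (s t : R) f : 0 < s -> 0 < t -> cintegrable f -> cintegral f = 0 ->
  Cc0 (cfold_mollify s (hat_kernel t) f).
Proof.
move=> s0 t0 f1 f0; have mol := mollifier_hat t0.
have Kf1 := cintegrable_cfold_mollify s0 mol f1.
split; [exact: Kf1|by rewrite (cintegral_cfold_mollify s0 mol)|exact: continuous_cfold_mollify_hat| |].
  by exists (s + t) => x; apply: (cfold_mollify_support s0 mol); case: f1.
exists (2 * (t^-1 ^+ n * \int[mu]_y cabs f y)) => x.
exact: (cfold_mollify_le s0 t0 mol).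
Qed.

End continuous_functions.

Section extension_from_continuous_atoms.
Variables (R : realType) (n : nat) (Y : completeNormedModType R[i]).
Local Notation Rn := 'rV[R]_n.
Local Notation mu := (lebesgue_rV R n).
Local Notation nrm := (@ComplexField.Normc.normc R).
Local Notation D := (@Cc0 R n).
Hypothesis n0 : (0 < n)%N.
Implicit Types (f g h a : Rn -> R[i]) (u v : Rn -> R).

Let hD : csubspace D. Proof. exact: csubspace_Cc0. Qed.

Lemma cfold_mollify_toC (s : R) k1 u :
  cfold_mollify s k1 (toC u) = toC (fold_mollify s k1 u).
Proof.
apply/funext => x; rewrite /cfold_mollify /toC /=; congr (_ +i* _).
rewrite /fold_mollify; under eq_Rintegral do rewrite mulr0.
by rewrite Rintegral_cst// mul0r.
Qed.

(** Closed under linear combinations, which reduces density to the real and imaginary parts of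
    single atoms. *)
Definition approximable g : Prop := forall e : R, 0 < e ->
  exists2 f, D f & mass_le e (fun x => g x - f x).

Lemma approximable_csubspace : csubspace approximable.
Proof.
split.
  move=> e e0; exists (fun=> 0); first exact: hD.1.
  apply: (mass_leW (ltW e0)); apply: (mass_le0 n0); last by apply: aeW => x; rewrite subrr.
  by apply: cmeasurableB; exact: cmeasurable0.
move=> k f g hf hg e e0; have K0 : 0 < nrm k + 1 by rewrite ltr_wpDl// normc_ge0.
have e2 : 0 < e / 2 by rewrite divr_gt0.
have [f' Df' hf'] := hf _ (divr_gt0 e2 K0); have [g' Dg' hg'] := hg _ e2.
exists (fun x => k * f' x + g' x); first exact: hD.2.
have := mass_le_lin n0 k hf' hg'.
rewrite (_ : (fun x => k * _ + _) = (fun x => k * f x + g x - (k * f' x + g' x))); last first.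
  by apply/funext => x; ring.
apply: mass_leW; rewrite [leRHS](splitr e) lerD2r.
by rewrite mulrCA ger_pMr// ler_pdivrMr// mul1r lerDl.
Qed.

(** Off the faces of the cells the hat averages of [u] are equal to [u] as soon as their width is
    small enough. They are bounded by [B] and supported in a fixed cube, so dominated convergence
    gives convergence in L^2, which [small_Lq0_mass] turns into smallness of the mass. *)
Lemma approximable_step (s : R) m u : 0 < s -> mu.-integrable setT (EFin \o u) ->
  (forall k x y, cell s m k x -> cell s m k y -> u x = u y) ->
  (forall x, ~ cell s 0 (fun=> 0) x -> u x = 0) -> \int[mu]_x u x = 0 ->
  (exists B, forall x, `|u x| <= B) -> approximable (toC u).
Proof.
move=> s0 u1 ustep us u0 [B uB] e e0.
have q1 : 1 < 2 :> R by rewrite ltr1n.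
have s1 : 0 < s + 1 by rewrite addr_gt0.
have [d d0 hd] := small_Lq0_mass n0 q1 s1 e0.
pose t k : R := k.+1%:R^-1; have t0 k : 0 < t k by rewrite invr_gt0.
have mol k := mollifier_hat (t0 k).
pose K k := fold_mollify s (hat_kernel (t k)) u.
have K1 k : mu.-integrable setT (EFin \o K k) by exact: (integrable_fold_mollify s0 (mol k)).
have mK k : measurable_fun setT (K k) by exact: integrable_measurable (K1 k).
have mu' : measurable_fun setT u by exact: integrable_measurable u1.
have us' x : ~ cube 0 s x -> u x = 0.
  move=> nx; apply: us => /(cell0P s0) xQ; apply: nx => i.
  by rewrite mxE subr0 ler_norml; have /andP[-> /ltW ->] := xQ i.
have sK k x : ~ cube 0 (s + 1) x -> K k x = 0.
  move=> /notin_cube[j]; rewrite mxE subr0 => xi.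
  apply: (fold_mollify_support s0 (mol k) mu' (i := j)); apply: le_lt_trans xi.
  by rewrite lerD2l invf_le1// ler1n.
have KB k x : `|K k x| <= B.
  have := @fold_mollify_hat_near R n s (t k) s0 (t0 k) u x 0 B u1 us'.
  by rewrite subr0; apply => y _; rewrite subr0.
have B0 : 0 <= B := le_trans (normr_ge0 _) (uB 0).
(* The majorant: [u] and its averages are bounded by [B] and vanish off the cube of radius [s + 1],
   as the widths are at most 1. *)
pose g x : R := 2 * B * \1_(cube (0 : Rn) (s + 1)) x.
have mc : measurable (cube 0 (s + 1) : set Rn) by exact: measurable_cube.
have mg : measurable_fun setT g.
  by apply: measurable_funM => //; exact: measurable_indic.
have Ig : (Iq 2 g < +oo)%E.
  apply: Iq_indicZ_lty => //.
  by rewrite [X in (X < _)%E](lebesgue_cube _ (ltW s1)) ltry.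
have cvgK : {ae mu, forall x, K^~ x @ \oo --> u x}.
  apply: filterS (ae_locally_constant s0 ustep) => x [b b0 hb].
  apply: cvg_near_cst; exists (Num.trunc b^-1).+1 => // k /= bk.
  apply/eqP; rewrite -subr_eq0 -normr_le0.
  apply: (fold_mollify_hat_near s0 (t0 k) u1 us') => y xy.
  rewrite hb ?subrr ?normr0//; apply: sub_cube xy.
  rewrite -[leRHS]invrK lef_pV2 ?posrE ?invr_gt0//.
  have bi0 : 0 <= b^-1 by rewrite invr_ge0 ltW.
  have /andP[_ /ltW h] := truncn_itv bi0; apply: (le_trans h).
  by rewrite ler_nat ltnW// ltnS.
have domK : {ae mu, forall x, forall k, `|u x - K k x| <= `|g x|}.
  apply: aeW => x k; rewrite /g indicE; have [xc|nxc] := pselect (cube 0 (s + 1) x).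
    rewrite mem_set// mulr1 [leRHS]ger0_norm ?mulr_ge0//; apply: (le_trans (ler_normB _ _)).
    by rewrite mulrDl mul1r; exact: lerD.
  rewrite memNset// mulr0 normr0 sK// us' ?subrr ?normr0// => xs; apply: nxc.
  by apply: sub_cube xs; rewrite lerDl.
have [k0 /(_ k0 (leqnn _)) hk0] := Iq_dominated q1 mK mu' mg Ig cvgK domK d0.
have u1C : cintegrable (toC u) by apply/cintegrableP; split => //=; exact: integrable0.
have K1C : cintegrable (toC (K k0)) by apply/cintegrableP; split => //=; exact: integrable0.
exists (toC (K k0)).
  rewrite /K -cfold_mollify_toC; apply: Cc0_cfold_mollify_hat => //.
  by rewrite cintegral_toC u0.
have BE : (fun x => toC u x - toC (K k0) x) = (fun x => (-1) * toC (K k0) x + toC u x).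
  by apply/funext => x; rewrite mulN1r addrC.
have mKC := cintegrableZ (-1) K1C.
apply: hd.
- by rewrite BE; exact: cintegrableD.
- rewrite BE cintegralD// cintegralZ// !cintegral_toC.
  by rewrite (Rintegral_fold_mollify s0 (mol k0))// u0 mulr0 addr0.
- apply: aeW => x nx; rewrite /toC sK// us' ?subrr// => xs; apply: nx.
  by apply: sub_cube xs; rewrite lerDl.
apply: le_trans (ltW hk0); rewrite le_eqVlt; apply/orP; left; apply/eqP.
apply: eq_integral => x _; congr (_ `^ _)%:E.
by rewrite ger0_norm ?cabs_ge0// /cabs /toC -rmorphB normc_real.
Qed.

(** A dyadic average of [u] is a step function, and it is close to [u] in L^2, hence in the atomic
    norm. *)
Lemma approximable_real (s : R) u : 0 < s -> measurable_fun setT u ->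
  @supported R n s u -> \int[mu]_x u x = 0 -> (Iq 2 u < +oo)%E -> approximable (toC u).
Proof.
move=> s0 mu' us u0 u2 e e0; have e2 : 0 < e / 2 by rewrite divr_gt0.
have q1 : 1 < 2 :> R by rewrite ltr1n.
have [d d0 hd] := small_Lq0_mass n0 q1 s0 e2.
have [m /(_ m (leqnn _)) hm] := cvg_dyadic s0 q1 mu' us u2 d0.
have u1 := Lq_integrable s0 q1 mu' us u2.
have E1 := integrable_dyadic s0 m u1.
have E0 : \int[mu]_x dyadic s m u x = 0 by rewrite (Rintegral_dyadic s0 m u1).
have sE x : ~ cell s 0 (fun=> 0) x -> dyadic s m u x = 0 by exact: dyadic_support.
have [f Df hf] : exists2 f, D f & mass_le (e / 2) (fun x => toC (dyadic s m u) x - f x).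
  apply: (approximable_step s0 E1) => //; last exact: (dyadic_bounded s0 m u1).
  by move=> k x y; exact: (dyadic_step s0 u1 us).
exists f => //; rewrite (splitr e).
have u1C : cintegrable (toC u) by apply/cintegrableP; split => //=; exact: integrable0.
have E1C : cintegrable (toC (dyadic s m u)).
  by apply/cintegrableP; split => //=; exact: integrable0.
have BE : (fun x => toC u x - toC (dyadic s m u) x) =
    (fun x => (-1) * toC (dyadic s m u) x + toC u x).
  by apply/funext => x; rewrite mulN1r addrC.
have mKC := cintegrableZ (-1) E1C.
have hud : mass_le (e / 2) (fun x => toC u x - toC (dyadic s m u) x).
  apply: hd.
  - by rewrite BE; exact: cintegrableD.
  - by rewrite BE cintegralD// cintegralZ// !cintegral_toC E0 u0 mulr0 addr0.
  - have supp x : ~ cube 0 s x -> ~ cell s 0 (fun=> 0) x.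
      move=> nx /(cell0P s0) xQ; apply: nx => i.
      by rewrite mxE subr0 ler_norml; have /andP[-> /ltW ->] := xQ i.
    by apply: filterS us => x hx /supp nx; rewrite /toC hx// sE// subrr.
  apply: le_trans (ltW hm); rewrite le_eqVlt; apply/orP; left; apply/eqP.
  apply: eq_integral => x _; congr (_ `^ _)%:E.
  by rewrite ger0_norm ?cabs_ge0// /cabs /toC -rmorphB normc_real.
have := mass_leD n0 hud hf; congr mass_le.
by apply/funext => x; rewrite addrA subrK.
Qed.

Lemma Lq0_approximable f : Lq0 2 f -> approximable f.
Proof.
move=> hf; have q1 : 1 < 2 :> R by rewrite ltr1n.
have [r r0 fr] := Lq0_support hf; have [f1 f0 _ fq] := hf.
have s0 : 0 < r + 1 by rewrite addr_gt0.
have [mf _] := f1; have [mfr mfi] := mf.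
have part u : measurable_fun setT u -> \int[mu]_x u x = 0 ->
    (forall x, `|u x| <= cabs f x) -> approximable (toC u).
  move=> mu' u0 uf; have [us uq] := Iq_part q1 r0 mf fr mu' uf.
  exact: (approximable_real s0 mu' us u0 (le_lt_trans uq fq)).
have [fr0 fi0] : \int[mu]_x complex.Re (f x) = 0 /\ \int[mu]_x complex.Im (f x) = 0.
  by move: f0 => /eqP; rewrite eq_complex /= => /andP[/eqP -> /eqP ->].
have := approximable_csubspace.2 (0 +i* 1) _ _
  (part _ mfi fi0 (fun x => Im_le_normc (f x))) (part _ mfr fr0 (fun x => Re_le_normc (f x))).
congr approximable; apply/funext => x; rewrite /toC; case: (f x) => b c.
by apply/eqP; rewrite eq_complex /=; apply/andP; split; apply/eqP; ring.
Qed.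

Lemma Cc0_dense g e : H1 g -> 0 < e -> exists2 f, D f & mass_le e (fun x => g x - f x).
Proof.
move=> /(H1_mass_le)[M hM] e0; have e2 : 0 < e / 2 by rewrite divr_gt0.
have [N [lam [a [ha hN]]]] := mass_le_tail n0 hM e2.
have : approximable (lincomb (fun j : 'I_N => lam j) (fun j : 'I_N => a j)).
  apply: csubspace_lincomb => [|j]; first exact: approximable_csubspace.
  apply: Lq0_approximable; apply: (atom_oo_Lq0 n0) => //; by rewrite ltr1n.
move=> /(_ _ e2)[f Df hf]; exists f => //; rewrite (splitr e).
have := mass_leD n0 hN hf; congr mass_le.
by apply/funext => x; rewrite addrA subrK.
Qed.

Lemma Cc0_H1 f : D f -> H1 f.
Proof.
move=> Df; apply: (@Lq0_H1 R n n0 2); first by rewrite ltr1n.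
have [r [M [r0 M0 fr fM]]] := Cc0_bounds Df.
have [[mf _] f0 _ _ _] := Df.
have [N0 _ _ ha] := cube_atom n0 r0 M0 mf fr f0 fM.
rewrite (unscale f N0); apply: csubspaceZ; first by apply: csubspace_Lq0; rewrite ltr1n.
by apply: atom_Lq0 => //; [rewrite ltr1n|apply: ha; rewrite ltr1n].
Qed.

Variable T : (Rn -> R[i]) -> Y.
Hypotheses (hT : linear_on D T) (bT : uniformly_bounded_on continuous_atom T).

(** By uniform continuity a hat of small width changes [f] by little at every point; the difference
    is then a multiple of a continuous atom with a small factor. *)
Lemma Cc0_hat_approx f (A e : R) : 0 <= A -> (forall a, continuous_atom a -> Ynorm (T a) <= A) ->
  D f -> 0 < e -> exists s t, [/\ 0 < s, 0 < t, t <= s &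
    Ynorm (T (fun x => f x - cfold_mollify s (hat_kernel t) f x)) <= e].
Proof.
move=> A0 hA Df e0; have [r [M [r0 M0 fr fM]]] := Cc0_bounds Df.
have [f1 f0 cf _ _] := Df.
have s0 : 0 < r + 1 by rewrite addr_gt0.
have v0 : 0 <= (2 * (n%:R * (r + 1 + 1))) ^+ n by rewrite exprn_ge0// !mulr_ge0// !addr_ge0// ltW.
(* The final bound is [E * (e / (E + 1))]. The first 2 comes from the real and imaginary parts;
   [r + 1 + 1] bounds the support, since the folding cube has radius [r + 1] and the width is at
   most 1. *)
pose E := A * (2 * (2 * (n%:R * (r + 1 + 1))) ^+ n).
have E0 : 0 <= E by rewrite !mulr_ge0.
have E1 : 0 < E + 1 by rewrite ltr_wpDl.
have d0 : 0 < e / (E + 1) by rewrite divr_gt0.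
have [t1 t10 ht1] := cube_unif_continuous cf fr d0.
pose t := Num.min t1 1; have t0 : 0 < t by rewrite lt_min t10 ltr01.
have t_1 : t <= 1 by rewrite ge_min lexx orbT.
exists (r + 1), t; split => //; first by apply: (le_trans t_1); rewrite lerDr ltW.
set K := cfold_mollify _ _ f.
have DK : D K by exact: Cc0_cfold_mollify_hat.
have Dg : D (fun x => f x - K x) by exact: csubspaceB.
have fr1 y : ~ cube 0 (r + 1) y -> f y = 0.
  by move=> ny; apply: fr => yr; apply: ny; apply: sub_cube yr; rewrite lerDl.
have gM x : cabs (fun x => f x - K x) x <= 2 * (e / (E + 1)).
  apply: (cfold_mollify_hat_near s0 t0 f1 fr1) => y xy.
  by apply: ht1; apply: sub_cube xy; rewrite ge_min lexx.
have gs x : ~ cube 0 (r + 1 + 1) x -> f x - K x = 0.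
  move=> nx; rewrite fr1; last by move=> xr; apply: nx; apply: sub_cube xr; rewrite lerDl.
  rewrite /K (cfold_mollify_support s0 (mollifier_hat t0)) ?subrr//; first by case: f1.
  by move=> xr; apply: nx; apply: sub_cube xr; rewrite lerD2l.
have s1 : 0 < r + 1 + 1 by rewrite addr_gt0.
have M'0 : 0 < 2 * (e / (E + 1)) by rewrite mulr_gt0.
have [N0 ha] := Cc0_atom n0 Dg s1 M'0 gs gM.
apply: (le_trans (Ynorm_le_scaled hD hT hA Dg N0 ha)).
rewrite (_ : A * _ = e * E / (E + 1)); last by rewrite /E; ring.
by rewrite ler_pdivrMr// ler_wpM2l ?(ltW e0)// lerDl.
Qed.

(** The splitting is that of [Lq0_operator_bound], with the hat kernel in place of the grid kernel:
    the averages have to stay in the domain of [T], hence to be continuous. *)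
Lemma Cc0_operator_bound : exists2 C, 0 <= C &
  forall f M, D f -> mass_le M f -> Ynorm (T f) <= C * M.
Proof.
have [A A0 hA] := uniformly_bounded_onP bT.
exists (A * fold_atom_const R n) => [|f M Df [f1 [lam [a [ha m]]]]].
  by rewrite !mulr_ge0// exprn_ge0// mulr_ge0// exprn_ge0.
apply/ler_addgt0Pr => e e0.
have [s [t [s0 t0 ts hK]]] := Cc0_hat_approx A0 hA Df e0.
have [_ f0 _ _ _] := Df.
set K := cfold_mollify s (hat_kernel t) in hK *.
have DK g : cintegrable g -> cintegral g = 0 -> D (K g) by exact: Cc0_cfold_mollify_hat.
have TK : Ynorm (T (K f)) <= A * fold_atom_const R n * M.
  apply: (bound_cfold_mollify n0 s0 t0 ts (mollifier_hat t0) hD hT A0 _ DK f1 f0 ha m).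
  move=> h c r B Dh r0 B0 mh ih sh hB.
  have [N0 hN] := Cc0_atom n0 Dh r0 B0 sh hB.
  exact: (Ynorm_le_scaled hD hT hA Dh N0 hN).
rewrite (_ : T f = T (fun x => f x - K f x) + T (K f)); last first.
  by rewrite (linear_onB hT Df (DK f f1 f0)) subrK.
by apply: (le_trans (Ynorm_D _ _)); rewrite [leRHS]addrC; exact: lerD hK TK.
Qed.

Lemma Cc0_extension : has_unique_H1_extension D T.
Proof.
have [C C0 hC] := Cc0_operator_bound.
exact: (H1_extension n0 hD hT C0 Cc0_H1 hC Cc0_dense).
Qed.

End extension_from_continuous_atoms.

Theorem corollary3p4 (R : realType) (n : nat) (hn : (1 <= n)%N)
    (Y : completeNormedModType R[i]) :
  (forall (q : R) (T : ('rV[R]_n -> R[i]) -> Y),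
     1 < q ->
     linear_on (H1q_fin q%:E) T ->
     ae_compatible (H1q_fin q%:E) T ->
     uniformly_bounded_on (atom q%:E) T ->
     has_unique_H1_extension (H1q_fin q%:E) T)
  /\
  (forall T : ('rV[R]_n -> R[i]) -> Y,
     linear_on continuous_H1_fin T ->
     uniformly_bounded_on continuous_atom T ->
     has_unique_H1_extension continuous_H1_fin T).
Proof.
split=> [q T q1|T].
  by rewrite H1q_finE// => hT _; exact: Lq0_extension.
by rewrite continuous_H1_finE//; exact: Cc0_extension.
Qed.
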